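(* Let $d\ge 1$ and $n\ge 4$ be integers, let $\rho>0$, and put $\phi:=\pi_d\rho^d$, where $\pi_d$ is the volume of the unit ball in $\mathbb{R}^d$. Let $S$ be the number of points, among $n$ independent uniformly distributed points of the torus $C_n=[0,n^{1/d})^d$, having no other of these points within toroidal distance $\rho$, and let $\mu_S:=\mathbb{E}[S]$, $\sigma_S:=\sqrt{\operatorname{Var}(S)}$. If $n>\max(3^d,2^{d+1}+1)\phi$, then $$D_S\;\le\;\frac{n-\mu_S}{5\sigma_S^2}\left(\sqrt{\frac{11(\kappa_d^+)^2}{\sigma_S}+\frac{5\sqrt{\eta_S(n,\rho)}}{\sqrt n}}+\frac{2\kappa_d^+}{\sqrt{\sigma_S}}\right)^2,$$ where $$\begin{aligned}\eta_S(n,\rho):=\;&2(1+2\kappa_d)^2\left(1+(2^d+1)3^d\phi+\left(\frac{2n-3^d\phi}{n-3^d\phi}\right)9^d\phi^2\right)\\&+\frac{(\kappa_d^+)^2}{2}\left(\bigl(2^d+2(3^d)+3\bigr)\phi+(2^{d+1}+1)\left(\frac{2n-(2^{d+1}+1)\phi}{n-(2^{d+1}+1)\phi}\right)\phi^2+\frac{4n-2}{n-1}\right).\end{aligned}$$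
   Context: $C_n:=[0,n^{1/d})^d$ is equipped with the Euclidean toroidal metric $D$ (periodic boundary conditions), and $B_r(x):=\{y\in C_n: D(x,y)\le r\}$. $U_1,\dots,U_n$ are independent random vectors uniformly distributed over $C_n$, $\mathcal{U}_n:=\{U_1,\dots,U_n\}$, and $$S:=\sum_{i=1}^n\mathbf{1}\bigl\{\mathcal{U}_n\cap B_\rho(U_i)=\{U_i\}\bigr\}.$$ The constant $\pi_d=\pi^{d/2}/\Gamma(1+d/2)$. $\kappa_d$ denotes the maximum number of closed unit balls in $\mathbb{R}^d$ that are pairwise disjoint and all intersect the closed unit ball centered at the origin; $\kappa_d^+:=1+\kappa_d$. For a random variable $X$ with $\operatorname{SD}(X):=\sqrt{\operatorname{Var}(X)}\in(0,\infty)$, $$D_X:=\sup_{t\in\mathbb{R}}\left|P\left[\frac{X-\mathbb{E}X}{\operatorname{SD}(X)}\le t\right]-P[Z\le t]\right|,$$ where $Z$ is a standard normal random variable. *)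

(* Defs.v *)
From HB Require Import structures.
From mathcomp Require Import all_boot all_order all_algebra.
From mathcomp Require Import lra.
From mathcomp Require Import all_classical all_reals all_analysis.
Set Implicit Arguments.
Unset Strict Implicit.
Unset Printing Implicit Defensive.
Import Order.TTheory GRing.Theory Num.Theory.
Import numFieldNormedType.Exports.
Local Open Scope classical_set_scope.
Local Open Scope ring_scope.

(** Points of R^d are [d.-tuple R]: the library equips this type with the
    product (that is, Borel) sigma-algebra. *)

Section Euclidean.
Context {R : realType}.

Definition edist (d : nat) (x y : d.-tuple R) : R :=
  Num.sqrt (\sum_(j < d) (tnth x j - tnth y j) ^+ 2).

Definition origin (d : nat) : d.-tuple R := [tuple 0 | _ < d].

Definition eball (d : nat) (x : d.-tuple R) (r : R) : set (d.-tuple R) :=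
  [set y | edist x y <= r].

(** On Borel sets, iterated integration of sections gives the
    d-dimensional Lebesgue measure (Tonelli). *)
Fixpoint vol (d : nat) : set (d.-tuple R) -> \bar R :=
  match d with
  | 0 => fun A => \d_([tuple] : 0.-tuple R) A
  | d'.+1 => fun A =>
      (\int[@lebesgue_measure R]_x vol [set y : d'.-tuple R | A [tuple of x :: y]])%E
  end.

Definition unit_ball_vol (d : nat) : R := fine (vol (eball (origin d) 1)).

End Euclidean.

Section Packing.
Variables (R : realType) (d : nat).

Definition ball_packing (k : nat) : Prop :=
  exists c : 'I_k -> d.-tuple R,
    (forall i j, i != j -> eball (c i) 1 `&` eball (c j) 1 = set0) /\
    (forall i, eball (c i) 1 `&` eball (origin d) 1 !=set0).

Definition max_packing (k : nat) : Prop :=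
  ball_packing k /\ forall m, ball_packing m -> (m <= k)%N.

(** The default value of [xget] plays no role, by [kappaP] below. *)
Definition kappa : nat := xget 0%N [set k | max_packing k].

Definition kappa_plus : nat := (1 + kappa)%N.

End Packing.

Section Torus.
Context {R : realType}.

Definition side (d n : nat) : R := n%:R `^ (d%:R^-1).

Definition torus (d n : nat) : set (d.-tuple R) :=
  [set x | forall j, 0 <= tnth x j < side d n].

(** Quotient metric of R^d / (n^{1/d} Z)^d: Euclidean distance minimised over
    lattice translates. *)
Definition tdist (d n : nat) (x y : d.-tuple R) : R :=
  inf [set edist x [tuple tnth y j + side d n * (z j)%:~R | j < d]
      | z in [set: 'I_d -> int]].

Definition tball (d n : nat) (x : d.-tuple R) (r : R) : set (d.-tuple R) :=
  [set y | torus n y /\ tdist n x y <= r].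

End Torus.

Section Probability.
Context {R : realType} {disp : measure_display} {T : measurableType disp}.
Variable P : probability T R.

Definition uniform_on_torus (d n : nat) (X : T -> d.-tuple R) : Prop :=
  forall A : set (d.-tuple R), measurable A ->
    P (X @^-1` A) = (vol (A `&` torus n) * (n%:R^-1)%:E)%E.

Definition independent_vectors (d n : nat) (X : 'I_n -> T -> d.-tuple R) : Prop :=
  forall (J : {set 'I_n}) (B : 'I_n -> set (d.-tuple R)),
    (forall i, measurable (B i)) ->
    P [set w | forall i, i \in J -> B i (X i w)]
      = (\prod_(i in J) P (X i @^-1` B i))%E.

Definition mean (X : T -> R) : R := fine 'E_P[X].

Definition sd (X : T -> R) : R := Num.sqrt (fine 'V_P[X]).

(** Meaningful only when [0 < sd X]: otherwise the division is by [0^-1 = 0]. *)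
Definition kolmogorov_normal (X : T -> R) : R :=
  sup [set `| fine (P [set w | (X w - mean X) / sd X <= t])
             - fine (normal_prob 0 1 [set z : R | z <= t]) |
      | t in [set: R]].

End Probability.

Definition isolated_count {R : realType} {T : Type} (d n : nat) (rho : R)
    (U : 'I_n -> T -> d.-tuple R) (w : T) : R :=
  \sum_(i < n)
    (`[< range (fun j => U j w) `&` tball n (U i w) rho = [set U i w] >])%:R.

Definition eta_S {R : realType} (d n : nat) (rho : R) : R :=
  let N : R := n%:R in
  let phi := unit_ball_vol d * rho ^+ d in
  let k : R := (kappa R d)%:R in
  let kp : R := (kappa_plus R d)%:R in
  2 * (1 + 2 * k) ^+ 2 *
    (1 + (2 ^+ d + 1) * 3 ^+ d * phi
       + ((2 * N - 3 ^+ d * phi) / (N - 3 ^+ d * phi)) * 9 ^+ d * phi ^+ 2)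
  + kp ^+ 2 / 2 *
    ((2 ^+ d + 2 * 3 ^+ d + 3) * phi
     + (2 ^+ d.+1 + 1)
       * ((2 * N - (2 ^+ d.+1 + 1) * phi) / (N - (2 ^+ d.+1 + 1) * phi))
       * phi ^+ 2
     + (4 * N - 2) / (N - 1)).

(** The maximum defining [kappa] exists: centres lie in the box [-2, 2]^d, and two
    centres in the same cube of side 1/d would be at distance at most 1. *)
Lemma edist_coord (R : realType) (d : nat) (x y : d.-tuple R) (j : 'I_d) :
  `|tnth x j - tnth y j| <= edist x y.
Proof.
rewrite /edist -sqrtr_sqr ler_sqrt; last by apply: sumr_ge0 => i _; exact: sqr_ge0.
by rewrite (bigD1 j) //= lerDl; apply: sumr_ge0 => i _; exact: sqr_ge0.
Qed.

Lemma ball_packing_bounded (R : realType) (d : nat) :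
  exists N, forall k, ball_packing R d k -> (k <= N)%N.
Proof.
exists #|{ffun 'I_d -> 'I_(4 * d).+1}| => k [c [disj meet]].
have cbd i j : 0 <= tnth (c i) j + 2 <= (4 : R).
  have [y [cy oy]] := meet i.
  have := le_trans (edist_coord (c i) y j) cy.
  have := le_trans (edist_coord (origin d) y j) oy.
  rewrite /origin tnth_mktuple sub0r normrN !ler_norml.
  by move=> /andP[? ?] /andP[? ?]; apply/andP; split; lra.
pose cell i := [ffun j : 'I_d =>
  inord (Num.truncn ((tnth (c i) j + 2) * d%:R)) : 'I_(4 * d).+1].
rewrite -[k in (k <= _)%N]card_ord; apply: (@leq_card _ _ cell) => a b eqab.
apply/eqP; apply: contraT => /disj /seteqP[+ _] => /(_ (c a)).
have self : edist (c a) (c a) <= 1.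
  by rewrite /edist big1 ?sqrtr0 // => j _; rewrite subrr expr0n.
suff close : edist (c b) (c a) <= 1 by case.
rewrite /edist -sqrtr1 ler_sqrt //.
have dlt j : (tnth (c b) j - tnth (c a) j) ^+ 2 <= d%:R^-1.
  have d1 : (1 <= d)%N := leq_ltn_trans (leq0n _) (ltn_ord j).
  have dR : 1 <= d%:R :> R by rewrite ler1n.
  have d0 : 0 < d%:R :> R by lra.
  have /(congr1 val) := congr1 (fun f : {ffun _ -> _} => f j) eqab.
  have bnd i : (Num.truncn ((tnth (c i) j + 2) * d%:R) < (4 * d).+1)%N.
    have /andP[ge0 le4] := cbd i j.
    rewrite ltnS -(ler_nat R) natrM.
    have /truncn_itv/andP[+ _] : 0 <= (tnth (c i) j + 2) * d%:R by rewrite mulr_ge0 // ltW.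
    by move=> /le_trans; apply; rewrite ler_wpM2r // ltW.
  rewrite !ffunE /= !inordK // => eqt.
  have itv i := @truncn_itv _ ((tnth (c i) j + 2) * d%:R)
    (mulr_ge0 (proj1 (andP (cbd i j))) (ltW d0)).
  have /andP[la ua] := itv a; have /andP[lb ub] := itv b.
  rewrite eqt in la ua; rewrite -natr1 in ua ub.
  set s := tnth (c b) j - tnth (c a) j.
  have sd : `|s * d%:R| <= 1.
    rewrite ler_norml; apply/andP; split; rewrite /s; lra.
  rewrite -[d%:R^-1]mul1r ler_pdivlMr //.
  have h : (s * d%:R) ^+ 2 <= 1 by rewrite -real_normK ?num_real // expr_le1.
  apply: le_trans h; rewrite exprMn ler_wpM2l ?sqr_ge0 //.
  by rewrite expr2 ler_peMr // ltW.
apply: (@le_trans _ _ (\sum_(j < d) (d%:R^-1 : R))).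
  by apply: ler_sum => j _; exact: dlt.
rewrite sumr_const card_ord -[leLHS]mulr_natr.
have [->|d0] := posnP d; first by rewrite mulr0.
by rewrite mulVf // pnatr_eq0 -lt0n.
Qed.

Lemma kappaP (R : realType) (d : nat) : max_packing R d (kappa R d).
Proof.
suff ex : exists k, max_packing R d k
  by exact: (@xgetPex _ 0%N [set k | max_packing R d k] ex).
have p0 : ball_packing R d 0 by exists (fun=> origin d); split => [[]|[]].
have [N bnd] := ball_packing_bounded R d.
have exb : exists k, `[< ball_packing R d k >] by exists 0%N; apply/asboolP.
have bndb k : `[< ball_packing R d k >] -> (k <= N)%N by move=> /asboolP/bnd.
exists (ex_maxn exb bndb); case: ex_maxnP => k /asboolP pk mk; split=> // m pm.
by apply: mk; apply/asboolP.
Qed.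

(* Main.v *)
From HB Require Import structures.
Require Import Defs.
From mathcomp Require Import all_boot all_order all_algebra.
From mathcomp Require Import all_classical all_reals all_analysis.
From mathcomp Require Import measurable_realfun zify lra ring.
Set Implicit Arguments.
Unset Strict Implicit.
Unset Printing Implicit Defensive.
Import Order.TTheory GRing.Theory Num.Theory.
Local Open Scope classical_set_scope.
Local Open Scope ring_scope.

(** Let [Y] be the number of points with another point within distance [rho], so
    that [S = n - Y] almost surely. Choose two points [i <> j] uniformly at random
    and, with a probability [weight k] depending on the number [k] of neighbours of
    [i], move [j] to a uniform position in the ball of radius [rho] around [i]. The
    weights are chosen so that the resulting increment [K] of [Y] satisfies
    [E[(Y - E Y) f(Y)] = E Y * E[f(Y + K) - f(Y)]] for every bounded [f], that is,
    so that [Y + K] has the size-biased law of [Y]. A packing argument gives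
    [|K| <= 1 + kappa], and the conditional expectation [drift] of [K] given the points
    is an average of local terms, so the Efron-Stein inequality bounds its variance
    by [eta_S / n]. Stein's method for the normal law, applied to smoothed
    indicators, turns these two bounds into an inequality in which the Kolmogorov
    distance appears on both sides; optimising the smoothing width gives the
    theorem. *)

(** * Expectations of bounded measurable functions *)

(** No enlarged probability space carries the coupling. It appears only as the operator [op],
    sending [phi] to the conditional mean of its increment, and the size-bias identity follows from
    the self-adjointness of averaging over one coordinate. Moving a single point keeps the increment
    bounded; to imitate conditioning on [i] being non-isolated it then suffices to correct the
    degree of [i]. If [N] is the binomial degree among the [m = n - 1] other points, the weight for
    [k < m] is [(P(N > k | N > 0) - P(N > k)) / (P(N = k) (1 - k/m))], where [1 - k/m] is the chance
    that [j] is not yet a neighbour; the move thus turns the law of [N] into its law given [N > 0].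
    The Kolmogorov distance enters its own bound because the Stein solution has curvature of order
    [1 / al] only where the smoothed indicator is not flat, and the probability of that window is
    compared with the normal one. A toroidal ball may wrap around, so its probability is kept exact
    and compared with its Euclidean counterpart only from above. *)

Section BoundedMeasurable.
Context {d : measure_display} {T : measurableType d} {R : realType}.
Implicit Types f g : T -> R.

Definition bmf f := measurable_fun setT f /\ exists M, forall x, `|f x| <= M.

Lemma bmf_measurable f : bmf f -> measurable_fun setT f. Proof. by case. Qed.

Lemma bmf_cst (c : R) : bmf (fun _ : T => c).
Proof. by split=> //; exists `|c|. Qed.

Lemma bmfD f g : bmf f -> bmf g -> bmf (fun x => f x + g x).
Proof.
move=> [mf [M Mf]] [mg [N Ng]]; split; first exact: measurable_funD.
by exists (M + N) => x; rewrite (le_trans (ler_normD _ _)) ?lerD.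
Qed.

Lemma bmfM f g : bmf f -> bmf g -> bmf (fun x => f x * g x).
Proof.
move=> [mf [M Mf]] [mg [N Ng]]; split; first exact: measurable_funM.
by exists (M * N) => x; rewrite normrM ler_pM.
Qed.

Lemma bmfZ (c : R) f : bmf f -> bmf (fun x => c * f x).
Proof. by move=> bf; apply: bmfM => //; exact: bmf_cst. Qed.

Lemma bmfN f : bmf f -> bmf (fun x => - f x).
Proof. by move=> /(bmfZ (-1)); under eq_fun do rewrite mulN1r. Qed.

Lemma bmfB f g : bmf f -> bmf g -> bmf (fun x => f x - g x).
Proof. by move=> bf /bmfN; exact: bmfD. Qed.

Lemma bmfX f n : bmf f -> bmf (fun x => f x ^+ n).
Proof.
move=> bf; elim: n => [|n IH].
  by under eq_fun do rewrite expr0; exact: bmf_cst.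
by under eq_fun do rewrite exprS; exact: bmfM.
Qed.

Lemma bmf_norm f : bmf f -> bmf (fun x => `|f x|).
Proof.
move=> [mf [M Mf]]; split; first exact: measurableT_comp.
by exists M => x; rewrite normr_id.
Qed.

Lemma bmf_sum I (s : seq I) (p : pred I) (F : I -> T -> R) :
  (forall i, p i -> bmf (F i)) -> bmf (fun x => \sum_(i <- s | p i) F i x).
Proof.
move=> bF; elim: s => [|i s IH].
  by under eq_fun do rewrite big_nil; exact: bmf_cst.
have [pi|/negbTE npi] := boolP (p i); last first.
  by under eq_fun do rewrite big_cons npi.
under eq_fun do rewrite big_cons pi.
by apply: bmfD => //; exact: bF.
Qed.

Lemma bmf_prod I (s : seq I) (p : pred I) (F : I -> T -> R) :
  (forall i, p i -> bmf (F i)) -> bmf (fun x => \prod_(i <- s | p i) F i x).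
Proof.
move=> bF; elim: s => [|i s IH].
  by under eq_fun do rewrite big_nil; exact: bmf_cst.
have [pi|/negbTE npi] := boolP (p i); last first.
  by under eq_fun do rewrite big_cons npi.
under eq_fun do rewrite big_cons pi.
by apply: bmfM => //; exact: bF.
Qed.

Lemma bmf_bool (b : T -> bool) :
  measurable_fun setT b -> bmf (fun x => (b x)%:R).
Proof.
move=> mb; split.
  rewrite (_ : (fun x => _) = (fun x => if b x then 1 else 0)).
    exact: measurable_fun_ifT.
  by apply/funext => x; case: (b x).
by exists 1 => x; rewrite normr_nat lern1; case: (b x).
Qed.

Lemma bmf_indic (A : set T) : measurable A -> bmf (fun x => (`[< A x >])%:R).
Proof.
move=> mA; have -> : (fun x => (`[< A x >])%:R) = (\1_A : T -> R).
  by apply/funext => x; rewrite indicE (_ : (x \in A) = `[< A x >])//; apply/idP/asboolP; rewrite inE.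
split; first exact: measurable_indic.
by exists 1 => x; rewrite indicE normr_nat lern1; case: (_ \in _).
Qed.

(** Expansion over Boolean patterns [c]: [h c] times the indicator that the observed pattern is [c],
    itself a product of indicators. Any quantity read off a finite random graph is thus bounded and
    measurable at once. *)
Lemma bmf_finite (K : finType) (b : K -> T -> bool) (h : {ffun K -> bool} -> R) :
  (forall k, measurable_fun setT (b k)) ->
  bmf (fun x => h [ffun k => b k x]).
Proof.
move=> mb.
rewrite (_ : (fun x => _) = fun x => \sum_(c : {ffun K -> bool})
    h c * \prod_k (if c k then (b k x)%:R else 1 - (b k x)%:R)).
  apply: bmf_sum => c _; apply: bmfZ; apply: bmf_prod => k _.
  case: (c k); first exact: bmf_bool.
  by apply: bmfB; [exact: bmf_cst|exact: bmf_bool].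
apply/funext => x; rewrite (bigD1 [ffun k => b k x])//= big1 ?mulr1 ?big1 ?addr0//.
  move=> c ne.
  have [k bk] : exists k, c k != b k x.
    apply/existsP; apply: contraNT ne; rewrite negb_exists => /forallP h0.
    by apply/eqP/ffunP => k; rewrite ffunE; apply/eqP; have := h0 k; rewrite negbK.
  rewrite (bigD1 k)//=; case: (c k) (b k x) bk => -[]//= _.
  - by rewrite mul0r mulr0.
  - by rewrite subrr mul0r mulr0.
by move=> k _; rewrite ffunE; case: (b k x); rewrite ?subr0.
Qed.

End BoundedMeasurable.

Lemma bmf_comp d1 d2 (T1 : measurableType d1) (T2 : measurableType d2)
    (R : realType) (f : T2 -> R) (g : T1 -> T2) :
  bmf f -> measurable_fun setT g -> bmf (fun x => f (g x)).
Proof.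
move=> [mf [M Mf]] mg; split; last by exists M => x; exact: Mf.
exact: (measurableT_comp mf mg).
Qed.

Section Expectation.
Context {d : measure_display} {T : measurableType d} {R : realType}.
Variable P : probability T R.
Implicit Types f g : T -> R.

Definition Ex f := (\int[P]_x f x)%R.

Lemma bmf_integrable f : bmf f -> P.-integrable setT (EFin \o f).
Proof.
move=> [mf [M Mf]]; apply: measurable_bounded_integrable => //.
  by rewrite (le_lt_trans (probability_le1 _ _))// ltry.
exists M; split; first exact: num_real.
by move=> y My x _ /=; rewrite (le_trans (Mf x))// ltW.
Qed.

Lemma EFin_Ex f : bmf f -> (\int[P]_x (f x)%:E = (Ex f)%:E)%E.
Proof.
move=> bf; rewrite /Ex /Rintegral fineK//.
exact: (integrable_fin_num measurableT (bmf_integrable bf)).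
Qed.

Lemma eq_Ex f g : f =1 g -> Ex f = Ex g. Proof. by move=> /funext ->. Qed.

Lemma ExD f g : bmf f -> bmf g -> Ex (fun x => f x + g x) = Ex f + Ex g.
Proof. by move=> bf bg; apply: RintegralD => //; exact: bmf_integrable. Qed.

Lemma ExB f g : bmf f -> bmf g -> Ex (fun x => f x - g x) = Ex f - Ex g.
Proof. by move=> bf bg; apply: RintegralB => //; exact: bmf_integrable. Qed.

Lemma ExZ c f : bmf f -> Ex (fun x => c * f x) = c * Ex f.
Proof. by move=> bf; apply: RintegralZl => //; exact: bmf_integrable. Qed.

Lemma Ex_cst c : Ex (fun=> c) = c.
Proof.
rewrite /Ex Rintegral_cst//; have /= -> := probability_setT P.
by rewrite mulr1.
Qed.

Lemma Ex_ge0 f : (forall x, 0 <= f x) -> 0 <= Ex f.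
Proof. by move=> f0; apply: Rintegral_ge0. Qed.

Lemma Ex_le f g : bmf f -> bmf g -> (forall x, f x <= g x) -> Ex f <= Ex g.
Proof. by move=> bf bg fg; apply: le_Rintegral => //; exact: bmf_integrable. Qed.

Lemma Ex_norm f : bmf f -> `|Ex f| <= Ex (fun x => `|f x|).
Proof. by move=> bf; apply: le_normr_Rintegral => //; exact: bmf_integrable. Qed.

Lemma Ex_bound f c : bmf f -> (forall x, `|f x| <= c) -> `|Ex f| <= c.
Proof.
move=> bf fc; apply: (le_trans (Ex_norm bf)); rewrite -[leRHS](Ex_cst c).
by apply: Ex_le => //; [exact: bmf_norm|exact: bmf_cst].
Qed.

Lemma Ex_sum I (s : seq I) (p : pred I) (F : I -> T -> R) :
  (forall i, p i -> bmf (F i)) ->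
  Ex (fun x => \sum_(i <- s | p i) F i x) = \sum_(i <- s | p i) Ex (F i).
Proof.
move=> bF; elim: s => [|i s IH].
  by under eq_Ex do rewrite big_nil; rewrite big_nil Ex_cst.
have [pi|/negbTE npi] := boolP (p i); last first.
  by under eq_Ex do rewrite big_cons npi; rewrite big_cons npi.
under eq_Ex do rewrite big_cons pi; rewrite big_cons pi.
by rewrite ExD ?IH//; [exact: bF|exact: bmf_sum].
Qed.

Lemma Ex_sqr_le f : bmf f -> Ex f ^+ 2 <= Ex (fun x => f x ^+ 2).
Proof.
move=> bf; have : 0 <= Ex (fun x => (f x - Ex f) ^+ 2).
  by apply: Ex_ge0 => x; exact: sqr_ge0.
under eq_Ex do rewrite sqrrB -mulr_natl mulrA.
have b2 := bmfX 2 bf.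
have bl : bmf (fun x => 2 * f x * Ex f).
  by apply: bmfM; [exact: bmfZ|exact: bmf_cst].
rewrite ExD ?ExB ?Ex_cst//; last 2 first.
- exact: bmfB.
- exact: bmf_cst.
have -> : Ex (fun x => 2 * f x * Ex f) = 2 * Ex f * Ex f.
  under eq_Ex do rewrite mulrAC; rewrite ExZ//; ring.
by move: (Ex _) (Ex _) => a b; nra.
Qed.

Lemma Ex_indic (A : set T) : measurable A ->
  Ex (fun x => (`[< A x >])%:R) = fine (P A).
Proof.
move=> mA; rewrite /Ex /Rintegral; congr fine.
rewrite -[RHS]mul1e -[X in (_ = _ * P X)%E]setIT -(integral_indic _ _ mA)//.
by rewrite mul1e; apply: eq_integral => x _; rewrite indicE (_ : (x \in A) = `[< A x >])//; apply/idP/asboolP; rewrite inE.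
Qed.

End Expectation.

(** * Resampling one coordinate and the Efron-Stein inequality *)

Section PartialExpectation.
Context {d1 d2 : measure_display} {T1 : measurableType d1}
  {T2 : measurableType d2} {R : realType}.

(** Measurability of partial integrals comes from Tonelli, which wants a non-negative integrand; the
    bound [M] is added to [F] and subtracted after integration. *)
Lemma bmf_partial (P : probability T2 R) (F : T1 * T2 -> R) :
  bmf F -> bmf (fun u => Ex P (fun x => F (u, x))).
Proof.
move=> [mF [M FM]].
have bu u : bmf (fun x => F (u, x)).
  split; last by exists M => x; exact: FM.
  exact: measurableT_comp.
split; last by exists M => u; apply: Ex_bound => // x; exact: FM.
have mG : measurable_fun setT (fun z => (F z + M)%:E).
  by apply/measurable_EFinP; apply: measurable_funD.
have G0 z : (0 <= (F z + M)%:E)%E.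
  by rewrite lee_fin; have := FM z; rewrite ler_norml => /andP[? _]; lra.
have := measurable_fun_fubini_tonelli_F (m2 := P) _ mG G0.
rewrite /fubini_F => mI.
rewrite (_ : (fun u => _) = fun u => fine (\int[P]_y (F (u, y) + M)%:E)%E - M); last first.
  apply/funext => u; rewrite -/(Rintegral P setT (fun y => F (u, y) + M)).
  rewrite -/(Ex P (fun y => F (u, y) + M)) ExD//; last exact: bmf_cst.
  by rewrite Ex_cst addrK.
apply: measurable_funB => //.
by apply: measurableT_comp mI; exact: fine_measurable.
Qed.

End PartialExpectation.

Section Resampling.
Context {d : measure_display} {X : measurableType d} {R : realType}.
Variables (lam : probability X R) (n : nat).
Implicit Types (u : n.-tuple X) (F G : n.-tuple X -> R).

Definition upd u (j : 'I_n) (x : X) : n.-tuple X :=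
  [tuple if i == j then x else tnth u i | i < n].

Lemma tnth_upd u j x i : tnth (upd u j x) i = if i == j then x else tnth u i.
Proof. by rewrite tnth_mktuple. Qed.

Lemma upd_upd u j x y : upd (upd u j x) j y = upd u j y.
Proof. by apply: eq_from_tnth => i; rewrite !tnth_upd; case: eqP. Qed.

Lemma upd_comm u i j x y : i != j ->
  upd (upd u j x) i y = upd (upd u i y) j x.
Proof.
move=> ij; apply: eq_from_tnth => l; rewrite !tnth_upd.
by case: (l =P i) => // ->; rewrite (negbTE ij).
Qed.

Lemma measurable_upd j :
  measurable_fun setT (fun z : n.-tuple X * X => upd z.1 j z.2).
Proof.
apply/measurable_fun_tnthP => i.
rewrite (_ : _ \o _ = fun z : n.-tuple X * X => if i == j then z.2 else tnth z.1 i).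
  case: (i == j); first exact: measurable_snd.
  apply: (@measurableT_comp _ _ _ _ _ _ (fun t : n.-tuple X => tnth t i)) => //.
  exact: measurable_tnth.
by apply/funext => z /=; rewrite tnth_upd.
Qed.

Lemma bmf_upd2 j F : bmf F -> bmf (fun z : n.-tuple X * X => F (upd z.1 j z.2)).
Proof. by move=> bF; apply: bmf_comp => //; exact: measurable_upd. Qed.

Lemma bmf_upd j F u : bmf F -> bmf (fun x => F (upd u j x)).
Proof.
move=> bF; apply: bmf_comp => //.
have /measurable_fun_pair2 : measurable_fun setT (fun z : n.-tuple X * X => upd z.1 j z.2).
  exact: measurable_upd.
exact.
Qed.

Definition avg j F u := Ex lam (fun x => F (upd u j x)).

Definition indep j F := forall u x, F (upd u j x) = F u.

Lemma bmf_avg j F : bmf F -> bmf (avg j F).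
Proof. by move=> bF; apply: (bmf_partial lam (bmf_upd2 j bF)). Qed.

Lemma indep_avg j F : indep j (avg j F).
Proof. by move=> u x; apply: eq_Ex => y; rewrite upd_upd. Qed.

Lemma avg_preserves_indep i j F : indep j F -> indep j (avg i F).
Proof.
move=> jF u x; have [->|ij] := eqVneq i j; first exact: indep_avg.
by apply: eq_Ex => y; rewrite upd_comm// jF.
Qed.

Lemma avgB j F G : bmf F -> bmf G ->
  avg j (fun u => F u - G u) = fun u => avg j F u - avg j G u.
Proof. by move=> bF bG; apply/funext => u; rewrite /avg ExB//; exact: bmf_upd. Qed.

Lemma avgM j F G : bmf F -> indep j G ->
  avg j (fun u => G u * F u) = fun u => G u * avg j F u.
Proof.
move=> bF jG; apply/funext => u; rewrite /avg.
by under eq_Ex do rewrite jG; rewrite ExZ//; exact: bmf_upd.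
Qed.

Lemma avg_sqr_le j F u : bmf F -> avg j F u ^+ 2 <= avg j (fun u => F u ^+ 2) u.
Proof. by move=> bF; apply: Ex_sqr_le; exact: bmf_upd. Qed.

Definition multi_avg (s : seq 'I_n) F := foldr avg F s.

Lemma bmf_multi_avg s F : bmf F -> bmf (multi_avg s F).
Proof. by move=> bF; elim: s => //= k s; exact: bmf_avg. Qed.

Lemma multi_avgB s F G : bmf F -> bmf G ->
  multi_avg s (fun u => F u - G u) = fun u => multi_avg s F u - multi_avg s G u.
Proof.
by move=> bF bG; elim: s => //= k s ->; rewrite avgB//; exact: bmf_multi_avg.
Qed.

Lemma indep_multi_avg j s F : (j \in s) || `[< indep j F >] -> indep j (multi_avg s F).
Proof.
elim: s => [/asboolP//|k s IH]; rewrite inE -orbA => /predU1P[->|js] /=.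
  exact: indep_avg.
by apply: avg_preserves_indep; apply: IH.
Qed.

(** [u] is changed into [v] one coordinate at a time; [w m] agrees with [v] on the first [m]
    coordinates. *)
Lemma indep_all_cst F : (forall j, indep j F) -> forall u v, F u = F v.
Proof.
move=> iF u v.
pose w m : n.-tuple X := [tuple if (i < m)%N then tnth v i else tnth u i | i < n].
have w0 : w 0%N = u by apply: eq_from_tnth => i; rewrite tnth_mktuple.
have wn : w n = v by apply: eq_from_tnth => i; rewrite tnth_mktuple ltn_ord.
suff H m : (m <= n)%N -> F (w m) = F u by rewrite -(H n)// wn.
elim: m => [|m IH] mn; first by rewrite w0.
rewrite -IH 1?ltnW// -(iF (Ordinal mn) (w m) (tnth v (Ordinal mn))).
congr F; apply: eq_from_tnth => i; rewrite tnth_upd !tnth_mktuple ltnS leq_eqVlt.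
have [->|] := eqVneq i (Ordinal mn); first by rewrite /= eqxx.
by rewrite -val_eqE /= => /negbTE ->.
Qed.

(** * The Efron-Stein inequality for a law invariant under resampling *)

Section EfronStein.
Variable Q : probability (n.-tuple X) R.
Hypothesis Q_resample : forall j F, bmf F -> Ex Q (avg j F) = Ex Q F.

(** Both sides equal the mean of [avg j F * avg j G]: resampling preserves means, and [avg j] pulls
    out a factor that does not depend on coordinate [j]. *)
Lemma avg_selfadjoint j F G : bmf F -> bmf G ->
  Ex Q (fun u => F u * avg j G u) = Ex Q (fun u => avg j F u * G u).
Proof.
move=> bF bG.
transitivity (Ex Q (fun u => avg j F u * avg j G u)).
  rewrite -(Q_resample j); last by apply: bmfM => //; exact: bmf_avg.
  apply: eq_Ex => u; under [X in avg _ X]eq_fun do rewrite mulrC.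
  rewrite avgM//; [by rewrite mulrC|exact: indep_avg].
rewrite -[RHS](Q_resample j); last by apply: bmfM => //; exact: bmf_avg.
by apply: eq_Ex => u; rewrite avgM//; exact: indep_avg.
Qed.

Lemma multi_avg_sqr_le s F : bmf F ->
  Ex Q (fun u => multi_avg s F u ^+ 2) <= Ex Q (fun u => F u ^+ 2).
Proof.
move=> bF; elim: s => //= k s; apply: le_trans.
rewrite -[leRHS](Q_resample k); last by apply/bmfX/bmf_multi_avg.
apply: Ex_le; [exact/bmfX/bmf_avg/bmf_multi_avg| |].
  exact/bmf_avg/bmfX/bmf_multi_avg.
by move=> u; apply: avg_sqr_le; exact: bmf_multi_avg.
Qed.

(* The conditional mean minimises the squared distance to functions that do not
   depend on coordinate [k]. *)
Lemma avg_sqr_loss k F c : bmf F -> bmf c -> indep k c ->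
  Ex Q (fun u => F u ^+ 2) - Ex Q (fun u => avg k F u ^+ 2)
    <= Ex Q (fun u => (F u - c u) ^+ 2).
Proof.
move=> bF bc ic; have bA := bmf_avg k bF.
have e : Ex Q (fun u => c u * F u) = Ex Q (fun u => c u * avg k F u).
  rewrite -(Q_resample k); last exact: bmfM.
  by apply: eq_Ex => u; rewrite avgM.
have E2 (H : n.-tuple X -> R) : bmf H -> Ex Q (fun u => (H u - c u) ^+ 2) =
    Ex Q (fun u => H u ^+ 2) - 2 * Ex Q (fun u => c u * H u) + Ex Q (fun u => c u ^+ 2).
  move=> bH; rewrite -ExZ; last exact: bmfM.
  rewrite -ExB; [|exact: bmfX|by apply/bmfZ/bmfM].
  rewrite -ExD; [|by apply: bmfB; [exact: bmfX|exact/bmfZ/bmfM]|exact: bmfX].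
  by apply: eq_Ex => u; ring.
have : 0 <= Ex Q (fun u => (avg k F u - c u) ^+ 2) by apply: Ex_ge0 => u; exact: sqr_ge0.
rewrite !E2// e; lra.
Qed.

(** Coordinates are averaged out one after the other until [G] has become its mean. The second
    moment lost at coordinate [k] is at most the squared distance from the partly averaged [G] to
    the equally averaged [Gk k], which is still independent of coordinate [k]; averaging contracts
    squared distances, so the distance from [G] to [Gk k] bounds it. *)
Lemma efron_stein G (Gk : 'I_n -> n.-tuple X -> R) : bmf G ->
  (forall k, bmf (Gk k)) -> (forall k, indep k (Gk k)) ->
  Ex Q (fun u => G u ^+ 2) - Ex Q G ^+ 2
    <= \sum_k Ex Q (fun u => (G u - Gk k u) ^+ 2).
Proof.
move=> bG bGk iGk.
have step s : Ex Q (fun u => G u ^+ 2) - Ex Q (fun u => multi_avg s G u ^+ 2)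
    <= \sum_(k <- s) Ex Q (fun u => (G u - Gk k u) ^+ 2).
  elim: s => [|k s IH]; first by rewrite big_nil subrr.
  rewrite big_cons /=.
  have := avg_sqr_loss (bmf_multi_avg s bG) (bmf_multi_avg s (bGk k))
    (indep_multi_avg (j := k) (s := s) (F := Gk k) _).
  rewrite (introT (asboolP _) (iGk k)) orbT => /(_ isT).
  have := multi_avg_sqr_le s (bmfB bG (bGk k)).
  rewrite multi_avgB// => h1 h2; have := le_trans h2 h1; lra.
have mE s : Ex Q (multi_avg s G) = Ex Q G.
  by elim: s => //= k s <-; rewrite Q_resample//; exact: bmf_multi_avg.
have := step (index_enum 'I_n); set s := index_enum _.
suff -> : Ex Q (fun u => multi_avg s G u ^+ 2) = Ex Q G ^+ 2 by [].
have cst u v : multi_avg s G u = multi_avg s G v.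
  by apply: indep_all_cst => j; apply: indep_multi_avg; rewrite mem_index_enum.
(* A tuple is needed to name the constant value; an empty tuple space carries no probability. *)
have [[v _]|/forallNP ne] := pselect (exists v : n.-tuple X, True).
  rewrite -(mE s); have -> : multi_avg s G = fun=> multi_avg s G v.
    by apply/funext => u; exact: cst.
  by rewrite !Ex_cst.
have := probability_setT Q; rewrite (_ : setT = set0) ?measure0; last first.
  by apply/seteqP; split => // u _; have := ne u.
by move=> [/esym/eqP]; rewrite oner_eq0.
Qed.

End EfronStein.

End Resampling.

(** * The joint law of independent vectors *)

Section Rectangles.
Context {d : measure_display} {X : measurableType d} (n : nat).

Definition box (B : 'I_n -> set X) : set (n.-tuple X) :=
  [set u | forall i, B i (tnth u i)].

Definition boxes : set (set (n.-tuple X)) :=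
  [set A | exists2 B, (forall i, measurable (B i)) & A = box B].

Lemma measurable_box B : (forall i, measurable (B i)) -> measurable (box B).
Proof.
move=> mB; have -> : box B = \big[setI/setT]_(i < n) ((@tnth n X)^~ i @^-1` B i).
  apply/seteqP; split=> u; rewrite -bigcap_seq /=.
    by move=> uB i _; exact: uB.
  by move=> uB i; apply: uB; rewrite /= mem_index_enum.
apply: big_ind => //; first exact: measurableI.
by move=> i _; rewrite -[X in measurable X]setTI; apply: measurable_tnth.
Qed.

Lemma boxes_setI : setI_closed boxes.
Proof.
move=> _ _ [B mB ->] [C mC ->]; exists (fun i => B i `&` C i).
  by move=> i; exact: measurableI.
apply/seteqP; split=> u; first by move=> [uB uC] i; split; [exact: uB|exact: uC].
by move=> uBC; split=> i; case: (uBC i).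
Qed.

Lemma measurable_boxes : @measurable _ (n.-tuple X) = <<s boxes >>.
Proof.
apply/seteqP; split.
  apply: smallest_sub; first exact: smallest_sigma_algebra.
  move=> A; rewrite -bigcup_seq => -[i _ [B mB <-]]; rewrite setTI.
  apply: sub_sigma_algebra; exists (fun k => if k == i then B else setT).
    by move=> k; case: ifP.
  apply/seteqP; split=> u /=; first by move=> Bu k; case: eqP => [->|].
  by move=> /(_ i); rewrite /= eqxx.
apply: smallest_sub; first exact: sigma_algebra_measurable.
by move=> _ [B mB ->]; exact: measurable_box.
Qed.

End Rectangles.

Section IndependentResampling.
Context {d dT : measure_display} {X : measurableType d} {T : measurableType dT}
  {R : realType}.
Variables (P : probability T R) (n : nat) (U : 'I_n -> {mfun T >-> X}).
Variable lam : probability X R.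
Hypothesis U_law : forall i A, measurable A -> P (U i @^-1` A) = lam A.
Hypothesis U_indep : forall B : 'I_n -> set X, (forall i, measurable (B i)) ->
  P [set w | forall i, B i (U i w)] = (\prod_i P (U i @^-1` B i))%E.

Definition joint (w : T) : n.-tuple X := [tuple U i w | i < n].

Lemma measurable_joint : measurable_fun setT joint.
Proof.
apply/measurable_fun_tnthP => i.
rewrite (_ : _ \o _ = U i) //.
by apply/funext => w /=; rewrite tnth_mktuple.
Qed.

HB.instance Definition _ :=
  @isMeasurableFun.Build _ _ _ _ joint measurable_joint.

Definition joint_law : probability (n.-tuple X) R := distribution P joint.

Lemma Ex_joint_law F : bmf F -> Ex joint_law F = Ex P (fun w => F (joint w)).
Proof.
move=> bF; rewrite /Ex /Rintegral; congr fine.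
rewrite integral_distribution//; first exact/measurable_EFinP/bmf_measurable.
by apply: (bmf_integrable P (bmf_comp bF measurable_joint)).
Qed.

Lemma joint_law_box B : (forall i, measurable (B i)) ->
  joint_law (box B) = (\prod_i lam (B i))%E.
Proof.
move=> mB; rewrite /joint_law /= /distribution /pushforward.
have -> : joint @^-1` box B = [set w | forall i, B i (U i w)].
  by apply/seteqP; split=> w /= h i; have := h i; rewrite tnth_mktuple.
by rewrite U_indep//; apply: eq_bigr => i _; rewrite U_law.
Qed.

Definition resample j (z : n.-tuple X * X) := upd z.1 j z.2.

HB.instance Definition _ j :=
  @isMeasurableFun.Build _ _ _ _ (resample j) (measurable_upd j).

(** The joint law and its image under replacing coordinate [j] by an independent point of law [lam]
    agree on boxes, a generating family closed under intersection, hence everywhere. Tonelli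
    rewrites integration against the image as the iterated mean. *)
Lemma joint_law_resample j F : bmf F -> Ex joint_law (avg lam j F) = Ex joint_law F.
Proof.
move=> bF; have [mF [M FM]] := bF.
pose m2_ : {measure set (n.-tuple X) -> \bar R} :=
  pushforward (joint_law \x lam)%E (resample j).
pose m2 := m2_ (measurable_upd j).
have prodE A B : measurable A -> measurable B ->
    (joint_law \x lam)%E (A `*` B) = (joint_law A * lam B)%E.
  exact: product_measure1E.
have eqm A : measurable A -> m2 A = joint_law A.
  move=> mA; apply/esym; apply: (measure_unique (@boxes d X n) (fun _ => setT)) => //.
  - exact: measurable_boxes.
  - exact: boxes_setI.
  - move=> _; exists (fun=> setT) => //; apply/seteqP; split=> //.
  - by apply/seteqP; split=> // x _; exists 0%N.
  - move=> _ [B mB ->]; rewrite [LHS](joint_law_box mB) /m2 /m2_ /= /pushforward.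
    (* The fresh point is constrained by [B j], the replaced one by nothing. *)
    rewrite (_ : resample j @^-1` _ = box (fun i => if i == j then setT else B i) `*` B j).
      rewrite prodE//; last by apply: measurable_box => i; case: ifP.
      rewrite [X in (_ = X * _)%E]joint_law_box; last by move=> i; case: ifP.
      rewrite (bigD1 j)//= [X in (_ = X * _)%E](bigD1 j)//= eqxx muleC; congr (_ * _)%E.
      have /= -> := probability_setT lam; rewrite mul1e.
      by apply: eq_bigr => i /negbTE ->.
    apply/seteqP; split=> -[u x] /=.
      move=> h; split; last by have := h j; rewrite tnth_upd eqxx.
      by move=> i; have := h i; rewrite tnth_upd; case: (i == j).
    move=> [h Bx] i; rewrite /= tnth_upd; have := h i.
    by have [->|] := eqVneq i j.
  - by move=> _; rewrite (le_lt_trans (probability_le1 _ _))// ltry.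
have mFM : measurable_fun setT (fun u => (F u + M)%:E).
  by apply/measurable_EFinP; exact: measurable_funD.
have FM0 u : (0 <= (F u + M)%:E)%E.
  by rewrite lee_fin; have := FM u; rewrite ler_norml => /andP[? _]; lra.
suff : Ex joint_law (avg lam j (fun u => F u + M)) = Ex joint_law (fun u => F u + M).
  rewrite ExD//; last exact: bmf_cst.
  rewrite Ex_cst (_ : avg _ _ _ = fun u => avg lam j F u + M).
    rewrite ExD ?Ex_cst; [exact: addIr|exact: bmf_avg|exact: bmf_cst].
  apply/funext => u; rewrite /avg ExD ?Ex_cst//; [exact: bmf_upd|exact: bmf_cst].
have bFM : bmf (fun u => F u + M) by apply: bmfD => //; exact: bmf_cst.
rewrite {1 2}/Ex /Rintegral; congr fine.
transitivity (\int[joint_law]_u \int[lam]_x ((EFin \o (fun u => F u + M)%R) \o resample j) (u, x))%E.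
  by apply: eq_integral => u _; rewrite /avg -EFin_Ex//; exact: (bmf_upd _ _ bFM).
rewrite -(fubini_tonelli1 ((EFin \o (fun u => F u + M)%R) \o resample j)); last 2 first.
- exact: measurableT_comp.
- by move=> z; exact: FM0.
rewrite -[LHS](@ge0_integral_pushforward _ _ _ _ _ (resample j) (measurable_upd j) _ setT)//;
  last by move=> u _; exact: FM0.
by apply: eq_measure_integral => A mA _; exact: eqm.
Qed.

End IndependentResampling.

(** * The size-bias coupling for the number of non-isolated points *)

Section MoveWeights.
Context {R : realType}.
Variables (theta : R) (m : nat).
Hypotheses (theta_gt0 : 0 < theta) (m_gt0 : (0 < m)%N).

(* With [N] binomial of parameters [m] and [theta / (1 + theta)], this is
   P(N > k) / P(N = k + 1) for [k = m - 1 - j]. *)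
Fixpoint tail_ratio (j : nat) : R :=
  if j is j'.+1 then 1 + theta * (j'.+1)%:R / (m - j')%:R * tail_ratio j' else 1.

Lemma tail_ratio_gt0 j : 0 < tail_ratio j.
Proof.
elim: j => //= j IH; rewrite ltr_pwDl// !mulr_ge0// ?invr_ge0//; exact: ltW.
Qed.

Lemma tail_ratioS j : (j < m)%N -> tail_ratio j <= tail_ratio j.+1.
Proof.
elim: j => [|j IH] jm.
  by rewrite /= lerDl !mulr_ge0// ?invr_ge0//; exact: ltW.
have {}IH := IH (ltnW jm).
rewrite [leRHS]/= [leLHS]/= lerD2l; apply: ler_pM => //.
- by rewrite !mulr_ge0// ?invr_ge0//; exact: ltW.
- exact/ltW/tail_ratio_gt0.
apply: ler_pM => //; first by rewrite !mulr_ge0//; exact: ltW.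
- by rewrite ler_wpM2l ?ler_nat//; exact: ltW.
rewrite lef_pV2 ?posrE ?ltr0n ?subn_gt0//; last exact: ltnW.
by rewrite ler_nat leq_sub2l.
Qed.

Lemma tail_ratio_le i j : (i <= j)%N -> (j <= m)%N -> tail_ratio i <= tail_ratio j.
Proof.
move=> ij; elim: j ij => [|j IH]; first by rewrite leqn0 => /eqP ->.
rewrite leq_eqVlt => /predU1P[->//|ij] jm.
by apply: le_trans (tail_ratioS jm); apply: IH => //; exact: ltnW.
Qed.

(** With the same [N] this is [P(N = 0) / P(N > 0)], so [1 / (1 + odds)] is the probability of
    having a neighbour. *)
Definition odds : R := (m%:R * theta * tail_ratio m.-1)^-1.

Lemma odds_gt0 : 0 < odds.
Proof. by rewrite invr_gt0 !mulr_gt0 ?ltr0n ?tail_ratio_gt0. Qed.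

Let theta_ge0 : 0 <= theta. Proof. exact: ltW. Qed.
Let odds_ge0 : 0 <= odds. Proof. exact/ltW/odds_gt0. Qed.
Let tail_ratio_ge0 j : 0 <= tail_ratio j. Proof. exact/ltW/tail_ratio_gt0. Qed.

(** For [k < m] this is [P(N = 0) P(N > k) / (P(N > 0) P(N = k) (1 - k/m))], since [(k + 1) P(N = k
    + 1) = (m - k) theta P(N = k)]. *)
Definition weight (k : nat) : R :=
  odds * m%:R * theta * tail_ratio (m.-1 - k) / k.+1%:R.

Let m_neq0 : m%:R != 0 :> R. Proof. by rewrite pnatr_eq0 -lt0n. Qed.
Let theta_neq0 : theta != 0. Proof. exact: lt0r_neq0. Qed.
Let tail_neq0 j : tail_ratio j != 0. Proof. exact/lt0r_neq0/tail_ratio_gt0. Qed.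

Lemma weight0 : weight 0 = 1.
Proof.
rewrite /weight /odds subn0 divr1.
by move: (tail_neq0 m.-1) m_neq0 theta_neq0; move: (tail_ratio _) => t t0 m0 h0; field; rewrite t0 m0 h0.
Qed.

Lemma weight_ge0 k : 0 <= weight k.
Proof.
by rewrite /weight !mulr_ge0 ?odds_ge0 ?invr_ge0 ?tail_ratio_ge0.
Qed.

(** The weights have to be probabilities: starting from [weight 0 = 1], neither
    [tail_ratio (m.-1 - k)] nor [1 / (k + 1)] increases with [k]. *)
Lemma weight_le1 k : weight k <= 1.
Proof.
rewrite -weight0 /weight; have o0 := odds_gt0.
apply: ler_pM.
- by rewrite !mulr_ge0 ?tail_ratio_ge0.
- by rewrite invr_ge0.
- rewrite ler_wpM2l//; first by rewrite !mulr_ge0.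
  by apply: tail_ratio_le; rewrite ?subn0 ?leq_subr// leq_pred.
- by rewrite lef_pV2 ?posrE// ler_nat.
Qed.

(** The left side is what the adjoint of the move contributes at a point of degree [k], averaged
    over [j], a fraction [k/m] of which are neighbours. Averaged over points, the right side is
    [count / mean_count - 1], the density of the size-biased law minus 1. *)
Lemma weight_balance (k : nat) : (k <= m)%N ->
  k%:R / m%:R * (weight k + theta^-1 * weight k.-1) - weight k
    = (1 + odds) * (0 < k)%:R - 1.
Proof.
case: k => [_|k km]; first by rewrite weight0 mul0r mul0r mulr0.
(* The goal solved for [odds]. It is the recursion of [tail_ratio] below [m]; for [k.+1 = m] the
   left side vanishes and [weight k = odds * theta]. *)
have e : (m%:R - k.+1%:R) * weight k.+1 = k.+1%:R * weight k / theta - m%:R * odds.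
  rewrite /weight; have [mk|km'] := leqP m k.+1; last first.
    have -> : (m.-1 - k = (m.-1 - k.+1).+1)%N by lia.
    have -> /= : tail_ratio (m.-1 - k.+1).+1 =
       1 + theta * (m - k.+1)%:R / k.+2%:R * tail_ratio (m.-1 - k.+1).
      by rewrite /=; congr (1 + theta * _%:R / _%:R * _); lia.
    rewrite natrB//.
    have k1 : k.+1%:R != 0 :> R by rewrite pnatr_eq0.
    have k2 : k.+2%:R != 0 :> R by rewrite pnatr_eq0.
    move: (tail_ratio _) k1 k2; move: k.+1%:R k.+2%:R => a b t a0 b0.
    by field; rewrite theta_neq0 a0 b0.
  have ekm : k.+1 = m by apply/eqP; rewrite eqn_leq km mk.
  rewrite (_ : (m.-1 - k)%N = 0%N) /=; last by lia.
  rewrite ekm subrr mul0r.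
  by field; rewrite theta_neq0 m_neq0.
rewrite /= mulr1 addrAC subrr add0r.
have -> : odds = (k.+1%:R * weight k / theta - (m%:R - k.+1%:R) * weight k.+1) / m%:R.
  by rewrite e; field; rewrite theta_neq0 m_neq0.
move: (weight _) (weight _) => a b.
by field; rewrite theta_neq0 m_neq0.
Qed.

End MoveWeights.

(** * Effect of moving or deleting one vertex of a finite graph *)

Section Graphs.
Context {n : nat}.
Implicit Types (r : 'I_n -> 'I_n -> bool) (A : {set 'I_n}).

(** Everything is relative to a vertex set [A], so that deleting a point means passing to [A :\ k]
    with the relation unchanged. *)
Definition linked r A m := [exists l in A, (l != m) && r m l].

Definition linked_count r A : nat := \sum_(m in A) linked r A m.

Definition degree r A i := #|[set l in A | (l != i) && r i l]|.

Definition lone r A j := [set m in A | (m != j) && ~~ linked r (A :\ j) m].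

(** The predicate [v] tells which vertices are adjacent to [j], at its old or at its new
    position. *)
Definition touched r A j (v : 'I_n -> bool) := #|[set m in lone r A j | v m]|.

Lemma linked_degree r A i : linked r A i = (0 < degree r A i)%N.
Proof.
rewrite /degree card_gt0; apply/existsP/set0Pn => -[l].
  by move=> /andP[lA h]; exists l; rewrite inE lA.
by rewrite inE => /andP[lA h]; exists l; rewrite lA.
Qed.

(* Moving the vertex [j] only affects [j] itself and the vertices that have no
   neighbour apart from [j]. *)
Lemma linked_count_move r r' A i j : i \in A -> j \in A -> i != j ->
  (forall k l, k != j -> l != j -> r k l = r' k l) ->
  (forall k, r' k j = r' j k) -> r' i j ->
  (linked_count r' A + touched r A j (r ^~ j) =
   linked_count r A + ~~ linked r A j + touched r A j (r' ^~ j))%N.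
Proof.
move=> iA jA ij rr' sym' r'ij; rewrite /linked_count.
rewrite (bigD1 j)//= [in RHS](bigD1 j)//=.
have -> : linked r' A j = true.
  by apply/existsP; exists i; rewrite iA ij -sym'.
have tE (v : 'I_n -> bool) :
    touched r A j v = (\sum_(m in A | m != j) (~~ linked r (A :\ j) m && v m))%N.
  rewrite /touched -sum1_card [RHS]big_mkcond /= big_mkcond; apply: eq_bigr => m _.
  by rewrite !inE; case: (m \in A); case: (m != j); case: (linked _ _ _); case: (v m).
have lE s m : m \in A -> m != j ->
    linked s A m = linked s (A :\ j) m || s m j.
  move=> mA mj; apply/existsP/orP.
    move=> [l /and3P[lA lm sl]]; have [e|lj] := eqVneq l j; first by right; rewrite -e.
    by left; apply/existsP; exists l; rewrite !inE lj lA lm.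
  move=> [/existsP[l]|smj].
    by rewrite !inE => /andP[/andP[lj lA] h]; exists l; rewrite lA.
  by exists j; rewrite jA eq_sym mj.
have eqJ m : m != j -> linked r' (A :\ j) m = linked r (A :\ j) m.
  move=> mj; apply: eq_existsb => l; rewrite !inE.
  by case: (eqVneq l j) => //= lj; rewrite rr'.
rewrite !tE.
have H : (\sum_(m in A | m != j) linked r' A m +
    \sum_(m in A | m != j) (~~ linked r (A :\ j) m && r m j) =
    \sum_(m in A | m != j) linked r A m +
    \sum_(m in A | m != j) (~~ linked r (A :\ j) m && r' m j))%N.
  rewrite -!big_split; apply: eq_bigr => m /andP[mA mj] /=.
  rewrite !lE// eqJ//.
  by case: (linked _ _ _); case: (r m j); case: (r' m j).
by move: H; case: (linked r A j) => /=; lia.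
Qed.

Lemma touched_unlinked r A j : (forall k, r k j = r j k) ->
  ~~ linked r A j -> touched r A j (r ^~ j) = 0%N.
Proof.
move=> sym; rewrite /linked negb_exists => /forallP h; apply/eqP.
rewrite cards_eq0; apply/eqP/setP => m; rewrite !inE.
apply/negP => /andP[/andP[mA /andP[mj _]] rmj].
by have := h m; rewrite mA mj -sym rmj.
Qed.

Lemma degree_setD1 r A i k : ~~ r i k -> degree r (A :\ k) i = degree r A i.
Proof.
move=> rik; congr #|pred_of_set _|; apply/setP => l; rewrite !inE.
by case: (eqVneq l k) => //= ->; rewrite (negbTE rik) !andbF.
Qed.

Lemma linked_setD1 r A i k : ~~ r i k -> linked r (A :\ k) i = linked r A i.
Proof. by move=> rik; rewrite !linked_degree degree_setD1. Qed.

Lemma touched_setD1 r A j k (v : 'I_n -> bool) :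
  ~~ v k -> (forall m, v m -> m != k -> ~~ r m k) ->
  touched r (A :\ k) j v = touched r A j v.
Proof.
move=> vk hv; congr #|pred_of_set _|; apply/setP => m; rewrite !inE.
case vm : (v m); rewrite ?andbF// !andbT.
have mk : m != k by apply: contraNneq vk => <-.
rewrite mk /= (_ : A :\ k :\ j = A :\ j :\ k); last first.
  by apply/setP => l; rewrite !inE andbCA.
by rewrite linked_setD1// hv.
Qed.

End Graphs.

(** * The size-bias identity and the drift for a random geometric graph *)

Section GeometricGraph.
Context {d : measure_display} {X : measurableType d} {R : realType}.
Variables (lam : probability X R) (m : nat).
Let n := m.+1.
Variable Q : probability (n.-tuple X) R.
Hypothesis Q_resample : forall j F, bmf F -> Ex Q (avg lam j F) = Ex Q F.
Variables (D : X -> X -> R) (rho : R).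
Hypothesis D_measurable : measurable_fun setT (fun z : X * X => D z.1 z.2).
Hypothesis D_sym : forall x y, D x y = D y x.
Hypothesis D_triangle : forall x y z, D x z <= D x y + D y z.
Hypothesis rho_gt0 : 0 < rho.
Variable kap : nat.
Hypothesis packing : forall (I : {set 'I_n}) (v : n.-tuple X) y,
  (forall i, i \in I -> D (tnth v i) y <= rho) ->
  (forall i l, i \in I -> l \in I -> i != l -> rho < D (tnth v i) (tnth v l)) ->
  (#|I| <= kap)%N.
Variable p : R.
Hypothesis p_gt0 : 0 < p.
Hypothesis p_lt1 : p < 1.

Definition close (r : R) (x y : X) : bool := D x y <= r.

Local Notation near := (close rho).

Hypothesis near_prob : forall x, Ex lam (fun y => (near x y)%:R) = p.
Hypothesis m_gt0 : (0 < m)%N.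
Variable p3 : R.
Hypothesis p3_ge : forall x, Ex lam (fun y => (close (3 * rho) x y)%:R) <= p3.

Local Notation full := [set: 'I_n]%SET.

Implicit Types (u : n.-tuple X) (x : X) (A : {set 'I_n}) (i j k l : 'I_n).

Definition graph u i j := near (tnth u i) (tnth u j).

Lemma graph_sym u i j : graph u i j = graph u j i.
Proof. by rewrite /graph /close D_sym. Qed.

Lemma near_measurable (r : R) :
  measurable_fun setT (fun z : X * X => close r z.1 z.2).
Proof. exact: measurable_fun_ler. Qed.

Lemma tnth_pair_measurable i j :
  measurable_fun setT (fun u => (tnth u i, tnth u j)).
Proof. by apply: measurable_fun_pair; exact: measurable_tnth. Qed.

Lemma bmf_graph (h : ('I_n -> 'I_n -> bool) -> R) : bmf (fun u => h (graph u)).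
Proof.
have := @bmf_finite _ (n.-tuple X) R _ (fun (ij : 'I_n * 'I_n) u => graph u ij.1 ij.2)
  (fun f => h (fun i j => f (i, j))).
rewrite (_ : (fun u => h (fun i j => [ffun k => graph u k.1 k.2] (i, j))) = fun u => h (graph u)).
  apply=> -[i j].
  exact: (measurableT_comp (near_measurable rho) (tnth_pair_measurable i j)).
by apply/funext => u; congr h; apply/funext => i; apply/funext => j; rewrite ffunE.
Qed.

Lemma bmf_near (r : R) i : bmf (fun z : n.-tuple X * X => (close r (tnth z.1 i) z.2)%:R : R).
Proof.
apply: bmf_bool.
have mp : measurable_fun setT (fun z : n.-tuple X * X => (tnth z.1 i, z.2)).
  apply: measurable_fun_pair; last exact: measurable_snd.
  exact: (measurableT_comp (measurable_tnth i) measurable_fst).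
exact: (measurableT_comp (near_measurable r) mp).
Qed.

Lemma bmf_near1 (r : R) x : bmf (fun y => (close r x y)%:R : R).
Proof.
apply: bmf_bool.
exact: (measurable_fun_pair2 _ (near_measurable r)).
Qed.

Definition count u : R := (linked_count (graph u) full)%:R.

Lemma graph_upd u j x i l : i != j -> l != j -> graph (upd u j x) i l = graph u i l.
Proof. by move=> ij lj; rewrite /graph !tnth_upd (negbTE ij) (negbTE lj). Qed.

(** Lone vertices are pairwise non-adjacent, hence more than [rho] apart, while those counted all
    lie within [rho] of [x]: this is the situation of [packing]. *)
Lemma touched_le u A j x :
  (touched (graph u) A j (fun i => near (tnth u i) x) <= kap)%N.
Proof.
apply: (packing (v := u) (y := x)).
  by move=> i; rewrite inE => /andP[_].
move=> i l; rewrite !inE => /andP[/andP[iA /andP[ij iso]] _].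
move=> /andP[/andP[lA /andP[lj _]] _] il.
rewrite ltNge; apply: contra iso => h; apply/existsP; exists l.
by rewrite !inE lj lA eq_sym il.
Qed.

Lemma touched_self_le u A j :
  (touched (graph u) A j ((graph u) ^~ j) <= kap)%N.
Proof. exact: touched_le. Qed.

Definition gain u A j : R :=
  (~~ linked (graph u) A j)%:R - (touched (graph u) A j ((graph u) ^~ j))%:R.

Definition added u A j x : R :=
  (touched (graph u) A j (fun i => near (tnth u i) x))%:R.

(** Either [j] is linked and only the loss remains, or it is isolated and touches no vertex. *)
Lemma gain_itv u A j : - kap%:R <= gain u A j <= 1.
Proof.
rewrite /gain; have := touched_self_le u A j; rewrite -(ler_nat R).
case: (boolP (linked _ _ _)) => l /=.
  move: (touched _ _ _ _) => t h; rewrite sub0r.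
  by apply/andP; split; have := ler0n R t; lra.
by rewrite touched_unlinked ?subr0//; [lra|move=> k; exact: graph_sym].
Qed.

Lemma added_itv u A j x : 0 <= added u A j x <= kap%:R.
Proof. by rewrite ler0n ler_nat touched_le. Qed.

Lemma count_move u A i j x : i \in A -> j \in A -> i != j -> near (tnth u i) x ->
  (linked_count (graph (upd u j x)) A)%:R - (linked_count (graph u) A)%:R
    = gain u A j + added u A j x.
Proof.
move=> iA jA ij ux.
have := @linked_count_move _ (graph u) (graph (upd u j x)) A i j iA jA ij.
have -> : touched (graph u) A j ((graph (upd u j x)) ^~ j) =
    touched (graph u) A j (fun i => near (tnth u i) x).
  congr #|pred_of_set _|; apply/setP => l; rewrite !inE.
  case: (eqVneq l j) => [->|lj]; first by rewrite !andbF.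
  by rewrite /graph !tnth_upd eqxx (negbTE lj).
move=> H.
have {H} : ((linked_count (graph (upd u j x)) A)%:R + (touched (graph u) A j ((graph u)^~ j))%:R
   = (linked_count (graph u) A)%:R + (~~ linked (graph u) A j)%:R + added u A j x)%R.
  rewrite /added -!natrD; congr _%:R; apply: H.
  - by move=> k l kj lj; rewrite graph_upd.
  - by move=> k; exact: graph_sym.
  - by rewrite /graph !tnth_upd eqxx (negbTE ij).
by rewrite /gain; lra.
Qed.

Local Notation theta := (p / (1 - p)).
Local Notation w := (weight theta m).
Local Notation odds := (odds theta m).

Let theta_gt0 : 0 < theta. Proof. by rewrite divr_gt0// subr_gt0. Qed.
Let p_neq0 : p != 0. Proof. exact: lt0r_neq0. Qed.

(** By [near_prob], [p^-1] normalises [lam] restricted to the ball around point [i] to a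
    probability. *)
Definition move (phi : n.-tuple X -> R) u i j : R :=
  p^-1 * Ex lam (fun x => (near (tnth u i) x)%:R * (phi (upd u j x) - phi u)).

(* The conditional mean, given [u], of the increment of [phi] when [j] is moved next
   to [i] with probability [w (degree i)]. *)
Definition op (phi : n.-tuple X -> R) u : R :=
  (n%:R * m%:R)^-1 * \sum_i \sum_(j | j != i)
    w (degree (graph u) full i) * move phi u i j.

Lemma graph_updr u i j x : i != j -> graph (upd u j x) i j = near (tnth u i) x.
Proof. by move=> ij; rewrite /graph !tnth_upd eqxx (negbTE ij). Qed.

Lemma moveE phi u i j : bmf phi -> i != j ->
  move phi u i j =
    p^-1 * avg lam j (fun v => (graph v i j)%:R * phi v) u - phi u.
Proof.
move=> bphi ij; rewrite /move /avg.
under [in RHS]eq_Ex do rewrite graph_updr//.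
under [in LHS]eq_Ex do rewrite mulrBr.
have bn := bmf_near1 rho (tnth u i).
rewrite ExB; last 2 first.
- by apply: bmfM => //; exact: bmf_upd.
- by apply: bmfM => //; exact: bmf_cst.
under [X in _ * (_ - X)]eq_Ex do rewrite mulrC.
by rewrite ExZ// near_prob mulrBr mulrC [phi u * p]mulrC mulKf// mulrC.
Qed.

Lemma degree_split u i j : j != i ->
  degree (graph u) full i = (degree (graph u) (full :\ j) i + graph u i j)%N.
Proof.
move=> ji; rewrite /degree (cardsD1 j) addnC; congr (_ + _)%N.
  by congr #|pred_of_set _|; apply/setP => l; rewrite !inE; case: (l == j).
by rewrite !inE ji.
Qed.

Lemma degree_upd u i j x : i != j ->
  degree (graph (upd u j x)) (full :\ j) i = degree (graph u) (full :\ j) i.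
Proof.
move=> ij; congr #|pred_of_set _|; apply/setP => l; rewrite !inE.
by case: (eqVneq l j) => //= lj; rewrite graph_upd.
Qed.

(** When [i] and [j] are adjacent, resampling [j] keeps the degree of [i] with probability [p] and
    lowers it by one otherwise; [(1 - p) / p] is [theta^-1]. *)
Lemma avg_weight u i j : i != j -> graph u i j ->
  avg lam j (fun v => w (degree (graph v) full i)) u =
    p * (w (degree (graph u) full i)
         + theta^-1 * w (degree (graph u) full i).-1).
Proof.
move=> ij gij; rewrite /avg.
set N := degree _ _ _.
have N1 : N = (degree (graph u) (full :\ j) i).+1.
  by rewrite /N (@degree_split _ _ j) 1?eq_sym// gij addn1.
transitivity (Ex lam (fun x => (near (tnth u i) x)%:R * (w N - w N.-1) + w N.-1)).
  apply: eq_Ex => x; rewrite (@degree_split _ _ j) 1?eq_sym// degree_upd// graph_updr// N1 /=.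
  by case: (close _ _ _); rewrite ?addn1 ?addn0 ?mul1r ?mul0r ?subrK ?add0r.
have bn := bmf_near1 rho (tnth u i).
rewrite ExD; last 2 first.
- by apply: bmfM => //; exact: bmf_cst.
- exact: bmf_cst.
under eq_Ex do rewrite mulrC.
rewrite ExZ// Ex_cst near_prob; move: (w N) (w _) => a b.
have : 1 - p != 0 by rewrite subr_eq0 eq_sym lt_eqF.
by move=> q0; field; rewrite p_neq0 q0.
Qed.

Lemma sum_graph u i : \sum_(j | j != i) (graph u i j)%:R = (degree (graph u) full i)%:R :> R.
Proof.
rewrite /degree -sum1_card natr_sum [RHS]big_mkcond [LHS]big_mkcond /=.
by apply: eq_bigr => j _; rewrite !inE; case: (j != i); case: (graph _ _ _).
Qed.

Lemma sum_others (i : 'I_n) (c : R) : \sum_(j | j != i) c = m%:R * c.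
Proof.
rewrite sumr_const -[LHS]mulr_natl; congr (_%:R * _).
rewrite -[RHS]/(n.-1) -[n in RHS]card_ord -(cardC1 i).
by apply: eq_card => j.
Qed.

Lemma degree_le u i : (degree (graph u) full i <= m)%N.
Proof.
rewrite -[leqRHS]/(n.-1) -[n in leqRHS]card_ord -(cardC1 i).
apply: subset_leq_card; apply/fintype.subsetP => l.
by rewrite !inE /= => /andP[].
Qed.

(** The moved part of [move] is [p^-1] times an average over coordinate [j]. Self-adjointness passes
    this average from [phi] to the weight, where [avg_weight] evaluates it on the event that [i] and
    [j] are adjacent. *)
Lemma move_mean phi i j : bmf phi -> i != j ->
  Ex Q (fun u => w (degree (graph u) full i) * move phi u i j) =
  Ex Q (fun u => phi u * ((graph u i j)%:R *
     (w (degree (graph u) full i) + theta^-1 * w (degree (graph u) full i).-1)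
     - w (degree (graph u) full i))).
Proof.
move=> bphi ij.
set W := fun u => w (degree (graph u) full i).
have bW : bmf W by exact: (bmf_graph (fun r => w (degree r full i))).
set H := fun v => (graph v i j)%:R * phi v.
have bg : bmf (fun v => (graph v i j)%:R : R) by exact: (bmf_graph (fun r => (r i j)%:R)).
have bH : bmf H by exact: bmfM.
transitivity (Ex Q (fun u => p^-1 * (W u * avg lam j H u) - W u * phi u)).
  apply: eq_Ex => u; rewrite moveE// mulrBr; congr (_ - _).
  by rewrite mulrCA.
have bA := bmf_avg lam j bH.
rewrite ExB; [|by apply: bmfZ; exact: bmfM|exact: bmfM].
rewrite ExZ; last exact: bmfM.
rewrite (avg_selfadjoint Q_resample)// -ExZ; last by apply: bmfM => //; exact: bmf_avg.
rewrite -ExB; last 2 first.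
- by apply: bmfZ; apply: bmfM => //; exact: bmf_avg.
- exact: bmfM.
apply: eq_Ex => u; rewrite /H.
case: (boolP (graph u i j)) => gij; last by rewrite /= !mul0r !mulr0 sub0r sub0r mulrN mulrC.
rewrite /W avg_weight// !mul1r mulrA mulrA mulVf// mul1r mulrBr.
by rewrite mulrC [X in _ - X]mulrC.
Qed.

Lemma bmf_move phi i j : bmf phi -> bmf (fun u => move phi u i j).
Proof.
move=> bphi; apply: bmfZ.
apply: (bmf_partial lam (F := fun z => (near (tnth z.1 i) z.2)%:R * (phi (upd z.1 j z.2) - phi z.1))).
apply: bmfM; first exact: bmf_near.
by apply: bmfB; [exact: bmf_upd2|exact: (bmf_comp bphi measurable_fst)].
Qed.

Lemma bmf_weight i : bmf (fun u => w (degree (graph u) full i)).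
Proof. exact: (bmf_graph (fun r => w (degree r full i))). Qed.

Lemma bmf_op phi : bmf phi -> bmf (op phi).
Proof.
move=> bphi; apply: bmfZ; apply: bmf_sum => i _; apply: bmf_sum => j _.
by apply: bmfM; [exact: bmf_weight|exact: bmf_move].
Qed.

Lemma bmf_count : bmf count.
Proof. exact: (bmf_graph (fun r => (linked_count r full)%:R)). Qed.

Lemma countE u : count u = \sum_i (0 < degree (graph u) full i)%:R.
Proof.
rewrite /count /linked_count natr_sum; apply: eq_big => i; first by rewrite inE.
by rewrite linked_degree.
Qed.

Let m_neq0 : m%:R != 0 :> R. Proof. by rewrite pnatr_eq0 -lt0n. Qed.
Let n_neq0 : n%:R != 0 :> R. Proof. by rewrite pnatr_eq0. Qed.

(** Summing [move_mean] over [j] turns adjacency into the degree of [i], and [weight_balance]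
    collapses the weights to the indicator that [i] is not isolated. *)
Lemma op_mean phi : bmf phi ->
  Ex Q (op phi) = Ex Q (fun u => phi u * ((1 + odds) * count u / n%:R - 1)).
Proof.
move=> bphi.
have bt i j : bmf (fun u => w (degree (graph u) full i) * move phi u i j).
  by apply: bmfM; [exact: bmf_weight|exact: bmf_move].
rewrite /op ExZ; last by apply: bmf_sum => i _; apply: bmf_sum => j _.
rewrite Ex_sum; last by move=> i _; apply: bmf_sum.
pose c u i : R := (1 + odds) * (0 < degree (graph u) full i)%:R - 1.
have bc i : bmf (fun u => phi u * c u i).
  apply: bmfM => //.
  exact: (bmf_graph (fun r => (1 + odds) * (0 < degree r full i)%:R - 1)).
transitivity ((n%:R * m%:R)^-1 * \sum_i m%:R * Ex Q (fun u => phi u * c u i)).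
  congr (_ * _); apply: eq_bigr => i _; rewrite Ex_sum//.
  transitivity (\sum_(j | j != i) Ex Q (fun u => phi u * ((graph u i j)%:R *
     (w (degree (graph u) full i) + theta^-1 * w (degree (graph u) full i).-1)
     - w (degree (graph u) full i)))).
    by apply: eq_bigr => j ji; rewrite move_mean// eq_sym.
  rewrite -Ex_sum; last first.
    move=> j _; apply: bmfM => //.
    exact: (bmf_graph (fun r => (r i j)%:R *
       (w (degree r full i) + theta^-1 * w (degree r full i).-1) - w (degree r full i))).
  rewrite -ExZ//; apply: eq_Ex => u.
  rewrite -mulr_sumr big_split /= -mulr_suml sum_graph.
  rewrite sum_others [RHS]mulrCA; congr (_ * _).
  rewrite /c -weight_balance ?degree_le//.
  by move: (w _) (w _) (degree _ _ _)%:R theta^-1 => a b N t; field; rewrite m_neq0.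
transitivity (n%:R^-1 * \sum_i Ex Q (fun u => phi u * c u i)).
  by rewrite -mulr_sumr; move: (\sum_i _) => S; field; rewrite m_neq0 n_neq0.
rewrite -Ex_sum// -ExZ; last exact: bmf_sum.
apply: eq_Ex => u; rewrite -mulr_sumr mulrCA; congr (_ * _).
rewrite /c big_split /= -mulr_sumr -countE sumr_const card_ord.
by move: (count u) (odds) n_neq0 => a b; rewrite mulNrn -mulr_natl => n0; field.
Qed.

Definition mean_count : R := n%:R / (1 + odds).

Let odds1_gt0 : 0 < 1 + odds. Proof. by rewrite ltr_pwDl// ltW// odds_gt0. Qed.

Lemma op_cst c : op (fun=> c) = fun=> 0.
Proof.
apply/funext => u; rewrite /op big1 ?mulr0// => i _; rewrite big1// => j _.
rewrite /move; under eq_Ex do rewrite subrr mulr0.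
by rewrite Ex_cst !mulr0.
Qed.

Lemma stein_identity phi : bmf phi ->
  Ex Q (fun u => (count u - mean_count) * phi u) = mean_count * Ex Q (op phi).
Proof.
move=> bphi; have bC := bmf_count; rewrite op_mean// -ExZ; last first.
  apply: bmfM => //; apply: bmfB; last exact: bmf_cst.
  by apply: bmfM; [exact: bmfZ|exact: bmf_cst].
apply: eq_Ex => u; rewrite /mean_count.
by move: (lt0r_neq0 odds1_gt0) n_neq0 (count u) => o0 n0 a; field; rewrite o0 n0.
Qed.

(** The size-bias identity at [phi = 1], which [op] annihilates. *)
Lemma Ex_count : Ex Q count = mean_count.
Proof.
have := stein_identity (bmf_cst 1); rewrite op_cst Ex_cst mulr0.
under eq_Ex do rewrite mulr1.
by rewrite ExB ?Ex_cst; [move/eqP; rewrite subr_eq0 => /eqP|exact: bmf_count|exact: bmf_cst].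
Qed.

Lemma mean_count_gt0 : 0 < mean_count.
Proof. by rewrite divr_gt0// ltr0n. Qed.

Lemma mean_count_lt : mean_count < n%:R.
Proof. by rewrite /mean_count ltr_pdivrMr// ltr_pMr ?ltr0n// ltrDl odds_gt0. Qed.

Let w_ge0 (k : nat) : 0 <= w k. Proof. exact: weight_ge0. Qed.
Let w_le1 (k : nat) : w k <= 1. Proof. exact: weight_le1. Qed.

Definition near_avg (F : X -> R) u i : R :=
  p^-1 * Ex lam (fun x => (near (tnth u i) x)%:R * F x).

Lemma bmf_near_weight (F : X -> R) u i : bmf F -> bmf (fun x => (near (tnth u i) x)%:R * F x).
Proof. by move=> bF; apply: bmfM => //; exact: bmf_near1. Qed.

Lemma near_avg_cst c u i : near_avg (fun=> c) u i = c.
Proof.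
rewrite /near_avg; under eq_Ex do rewrite mulrC.
rewrite ExZ; last exact: bmf_near1.
by rewrite near_prob mulrC mulfK.
Qed.

Lemma near_avg_le (F G : X -> R) u i : bmf F -> bmf G ->
  (forall x, near (tnth u i) x -> F x <= G x) -> near_avg F u i <= near_avg G u i.
Proof.
move=> bF bG FG; rewrite /near_avg ler_pM2l ?invr_gt0//.
apply: Ex_le; [exact: bmf_near_weight|exact: bmf_near_weight|move=> x].
by case: (boolP (close _ _ _)) => h; rewrite ?mul0r// !mul1r FG.
Qed.

Lemma eq_near_avg (F G : X -> R) u i :
  (forall x, near (tnth u i) x -> F x = G x) -> near_avg F u i = near_avg G u i.
Proof.
move=> FG; rewrite /near_avg; congr (p^-1 * _); apply: eq_Ex => x.
by case: (boolP (close _ _ _)) => h; rewrite ?mul0r// FG.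
Qed.

Lemma near_avgB (F G : X -> R) u i : bmf F -> bmf G ->
  near_avg (fun x => F x - G x) u i = near_avg F u i - near_avg G u i.
Proof.
move=> bF bG; rewrite /near_avg -mulrBr -ExB; [|exact: bmf_near_weight|exact: bmf_near_weight].
by congr (_ * _); apply: eq_Ex => x; rewrite mulrBr.
Qed.

Lemma near_avgZ (c : R) (F : X -> R) u i : bmf F ->
  near_avg (fun x => c * F x) u i = c * near_avg F u i.
Proof.
move=> bF; rewrite /near_avg; under eq_Ex do rewrite mulrCA.
by rewrite ExZ; [rewrite mulrCA|exact: bmf_near_weight].
Qed.

Lemma near_avg_bound (F : X -> R) u i (c : R) : bmf F ->
  (forall x, near (tnth u i) x -> `|F x| <= c) -> `|near_avg F u i| <= c.
Proof.
move=> bF Fc; rewrite ler_norml -{1}(near_avg_cst (- c) u i) -{2}(near_avg_cst c u i).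
by apply/andP; split; apply: near_avg_le => //; try exact: bmf_cst;
  move=> x /Fc; rewrite ler_norml => /andP[].
Qed.

Lemma opB phi psi (c : R) u : bmf phi -> bmf psi ->
  op phi u - c * op psi u = op (fun v => phi v - c * psi v) u.
Proof.
move=> bphi bpsi; rewrite /op mulrCA -mulrBr; congr (_ * _).
rewrite mulr_sumr -sumrB; apply: eq_bigr => i _.
rewrite mulr_sumr -sumrB; apply: eq_bigr => j _.
rewrite [c * _]mulrCA -mulrBr; congr (_ * _).
have b1 (f : n.-tuple X -> R) : bmf f -> bmf (fun x => f (upd u j x) - f u).
  by move=> bf; apply: bmfB; [exact: bmf_upd|exact: bmf_cst].
rewrite /move -!/(near_avg _ _ _) -near_avgZ; last exact: b1.
rewrite -near_avgB; [|exact: b1|by apply: bmfZ; exact: b1].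
by congr (_ * _); apply: eq_Ex => x; congr (_ * _); ring.
Qed.

Lemma op_bound phi u (c : R) : bmf phi ->
  (forall i j x, i != j -> near (tnth u i) x -> `|phi (upd u j x) - phi u| <= c) ->
  `|op phi u| <= c.
Proof.
move=> bphi phic.
rewrite /op normrM ger0_norm; last by rewrite invr_ge0 mulr_ge0.
rewrite mulrC ler_pdivrMr; last by rewrite mulr_gt0 ?ltr0n.
apply: (le_trans (ler_norm_sum _ _ _)).
apply: (@le_trans _ _ (\sum_(i < n) m%:R * c)); last first.
  rewrite sumr_const card_ord -[leLHS]mulr_natl; rewrite mulrA mulrC //.
apply: ler_sum => i _; apply: (le_trans (ler_norm_sum _ _ _)).
rewrite -(sum_others i c); apply: ler_sum => j ji.
rewrite normrM ger0_norm; last exact: w_ge0.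
rewrite -[leRHS]mul1r; apply: ler_pM => //.
apply: (near_avg_bound (F := fun x => phi (upd u j x) - phi u)) => [|x nx].
  by apply: bmfB; [exact: bmf_upd|exact: bmf_cst].
by apply: phic nx; rewrite eq_sym.
Qed.

Lemma bmf_of_count (f : R -> R) : bmf (fun u => f (count u)).
Proof. exact: (bmf_graph (fun r => f (linked_count r full)%:R)). Qed.

Lemma count_step u i j x : i != j -> near (tnth u i) x ->
  `|count (upd u j x) - count u| <= 1 + kap%:R.
Proof.
move=> ij nx; rewrite /count (count_move _ _ ij nx) ?inE//.
have := gain_itv u full j; have := added_itv u full j x.
by move=> /andP[? ?] /andP[? ?]; rewrite ler_norml; lra.
Qed.

Definition drift := op count.

Lemma bmf_drift : bmf drift. Proof. exact: bmf_op bmf_count. Qed.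

Lemma drift_bound u : `|drift u| <= 1 + kap%:R.
Proof.
apply: op_bound; first exact: bmf_count.
by move=> i j x ij nx; apply: count_step nx.
Qed.

(** With the slope frozen at [f' (count u)], the difference of [op] of [f (count v)] and slope times
    [drift] is [op] of a Taylor remainder, and each admissible move changes the count by at most
    [1 + kap]. The curvature bound [K] depends on the base point; this later localises the
    contribution of the ramp. *)
Lemma stein_taylor (f f' K : R -> R) :
  (forall x y : R, `|y - x| <= 1 + kap%:R ->
     `|f y - f x - (y - x) * f' x| <= K x * (y - x) ^+ 2 / 2) ->
  `|Ex Q (fun u => (count u - mean_count) * f (count u))
    - mean_count * Ex Q (fun u => f' (count u) * drift u)|
    <= mean_count * ((1 + kap%:R) ^+ 2 / 2) * Ex Q (fun u => K (count u)).
Proof.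
move=> fK; have bf := bmf_of_count f.
have bf' : bmf (fun u => f' (count u) * drift u).
  by apply: bmfM; [exact: bmf_of_count|exact: bmf_drift].
(* The hypothesis at [y = x + 1], a step within [1 + kap], forces [K] to be non-negative. *)
have K0 (x : R) : 0 <= K x.
  have := le_trans (normr_ge0 _) (fK x (x + 1) _).
  rewrite addrC addKr normr1 expr1n mulr1 => /(_ _); rewrite -ler_pdivrMr ?invr_gt0// mul0r; apply.
  by rewrite lerDl.
rewrite stein_identity// -mulrBr normrM (ger0_norm (ltW mean_count_gt0)) -mulrA.
rewrite ler_pM2l ?mean_count_gt0// -ExB//; last exact: bmf_op.
have bD : bmf (fun u => op (fun v => f (count v)) u - f' (count u) * drift u).
  by apply: bmfB => //; exact: bmf_op.
apply: (le_trans (Ex_norm _ bD)); rewrite -ExZ; last exact: bmf_of_count.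
apply: Ex_le; [exact: bmf_norm|by apply: bmfZ; exact: bmf_of_count|move=> u].
rewrite opB//; last exact: bmf_count.
apply: op_bound => [|i j x ij nx].
  by apply: bmfB => //; apply: bmfZ; exact: bmf_count.
have h := count_step ij nx.
have -> : f (count (upd u j x)) - f' (count u) * count (upd u j x) -
    (f (count u) - f' (count u) * count u) =
  f (count (upd u j x)) - f (count u) - (count (upd u j x) - count u) * f' (count u).
  by ring.
apply: (le_trans (fK _ _ h)); rewrite -mulrA mulrC ler_wpM2r//.
rewrite ler_wpM2r// -real_normK ?num_real// ler_pXn2r// nnegrE.
exact: addr_ge0.
Qed.

(** * The drift as an average of local terms *)

Lemma added_sum u A j x : added u A j x =
  \sum_l (l \in lone (graph u) A j)%:R * (near (tnth u l) x)%:R.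
Proof.
rewrite /added /touched -sum1_card natr_sum big_mkcond /=; apply: eq_bigr => l _.
by rewrite inE; case: (l \in _); case: (close _ _ _); rewrite ?mul1r ?mul0r.
Qed.

Lemma bmf_added1 u A j : bmf (added u A j).
Proof.
rewrite (funext (added_sum u A j)); apply: bmf_sum => l _.
by apply: bmfZ; exact: bmf_near1.
Qed.

Definition term A u i j : R :=
  w (degree (graph u) A i) * (gain u A j + near_avg (added u A j) u i).

Lemma near_avg_added_itv u A i j : 0 <= near_avg (added u A j) u i <= kap%:R.
Proof.
apply/andP; split.
  rewrite -[leLHS](near_avg_cst 0 u i).
  apply: near_avg_le; [exact: bmf_cst|exact: bmf_added1|move=> x _].
  by have /andP[] := added_itv u A j x.
rewrite -[leRHS](near_avg_cst kap%:R u i).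
apply: near_avg_le; [exact: bmf_added1|exact: bmf_cst|move=> x _].
by have /andP[] := added_itv u A j x.
Qed.

Lemma term_itv A u i j : - kap%:R <= term A u i j <= 1 + kap%:R.
Proof.
rewrite /term; have /andP[g1 g2] := gain_itv u A j.
have /andP[a1 a2] := near_avg_added_itv u A i j.
move: (w_ge0 (degree (graph u) A i)) (w_le1 (degree (graph u) A i)).
move: (w _); move: (gain _ _ _) (near_avg _ _ _) g1 g2 a1 a2 => g a g1 g2 a1 a2 c c0 c1.
have k0 := ler0n R kap.
have l1 : - kap%:R <= g + a by lra.
have l2 : g + a <= 1 + kap%:R by lra.
move: (g + a) l1 l2 => x l1 l2; apply/andP; split; nra.
Qed.

Lemma bmf_term A i j : bmf (fun u => term A u i j).
Proof.
apply: bmfM; first exact: (bmf_graph (fun r => w (degree r A i))).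
apply: bmfD.
  exact: (bmf_graph (fun r => (~~ linked r A j)%:R - (touched r A j (r ^~ j))%:R)).
apply: bmfZ.
apply: (bmf_partial lam (F := fun z => (near (tnth z.1 i) z.2)%:R * added z.1 A j z.2)).
apply: bmfM; first exact: bmf_near.
under eq_fun do rewrite added_sum.
apply: bmf_sum => l _; apply: bmfM; last exact: bmf_near.
apply: (bmf_comp (f := fun u => (l \in lone (graph u) A j)%:R) _ measurable_fst).
exact: (bmf_graph (fun r => (l \in lone r A j)%:R)).
Qed.

Lemma driftE u :
  drift u = (n%:R * m%:R)^-1 * \sum_i \sum_(j | j != i) term full u i j.
Proof.
rewrite /drift /op; congr (_ * _); apply: eq_bigr => i _; apply: eq_bigr => j ji.
rewrite /term; congr (_ * _); rewrite /move.
transitivity (near_avg (fun x => added u full j x - (- gain u full j)) u i).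
  rewrite /near_avg; congr (_ * _); apply: eq_Ex => x.
  case: (boolP (close _ _ _)) => nx; rewrite ?mul0r// !mul1r opprK [RHS]addrC.
  by rewrite /count (@count_move _ _ i)// ?inE// eq_sym.
rewrite near_avgB ?near_avg_cst; [|exact: bmf_added1|exact: bmf_cst].
by rewrite opprK addrC.
Qed.

(** Three steps of length [rho] separate the term at [i] from the points it sees: from [i] to a new
    position, from there to a lone vertex, and from that vertex to a neighbour. *)
Definition far u i k := ~~ close (3 * rho) (tnth u k) (tnth u i).

Lemma far_two u i k y z : far u i k -> close rho (tnth u i) y -> close rho y z ->
  ~~ close rho z (tnth u k).
Proof.
rewrite /far /close -!ltNge => f h1 h2.
have := D_triangle (tnth u k) y (tnth u i); have := D_triangle (tnth u k) z y.
have := D_sym y (tnth u i); have := D_sym z y; have := D_sym (tnth u k) z.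
lra.
Qed.

Lemma far_one u i k y : far u i k -> close rho (tnth u i) y -> ~~ close rho y (tnth u k).
Proof.
rewrite /far /close -!ltNge => f h1.
have := D_triangle (tnth u k) y (tnth u i).
have := D_sym y (tnth u i); have := D_sym (tnth u k) y.
by have := rho_gt0; lra.
Qed.

Lemma far_zero u i k : far u i k -> ~~ close rho (tnth u i) (tnth u k).
Proof.
rewrite /far /close -!ltNge; have := D_sym (tnth u i) (tnth u k).
by have := rho_gt0; lra.
Qed.

(** If [k] is far from [i], neither the weight nor the ball average around [i] sees it, and only
    [gain] at [j] may change, by at most [1 + kap], and only if [k] is near [j]. Otherwise the
    length [1 + 2 * kap] of the range of [term] is used. *)
Lemma term_delete u i j k : i != k -> j != k ->
  `|term full u i j - term (full :\ k) u i j|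
    <= (~~ far u i k)%:R * (1 + 2 * kap%:R) + (~~ far u j k)%:R * (1 + kap%:R).
Proof.
move=> ik jk; have k0 := ler0n R kap.
case: (boolP (far u i k)) => fi /=; last first.
  rewrite mul1r; have := term_itv full u i j; have := term_itv (full :\ k) u i j.
  move: (term _ _ _ _) (term _ _ _ _) => a b /andP[? ?] /andP[? ?].
  apply: (@le_trans _ _ (1 + 2 * kap%:R)); first by rewrite ler_norml; lra.
  by rewrite lerDl mulr_ge0// addr_ge0.
rewrite mul0r add0r.
have -> : term full u i j - term (full :\ k) u i j =
    w (degree (graph u) full i) * (gain u full j - gain u (full :\ k) j).
  rewrite /term degree_setD1; last exact: far_zero.
  have -> : near_avg (added u (full :\ k) j) u i = near_avg (added u full j) u i.
    apply: eq_near_avg => x nx; rewrite /added; congr _%:R; apply: touched_setD1.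
      by rewrite /close D_sym; apply: far_one nx.
    move=> l lx _; rewrite /graph; apply: (far_two fi nx).
    by rewrite /close D_sym.
  by ring.
case: (boolP (far u j k)) => fj /=.
  rewrite /gain linked_setD1; last exact: far_zero.
  rewrite touched_setD1; first by rewrite subrr mulr0 normr0 mul0r.
    by rewrite graph_sym; exact: far_zero.
  move=> l lj _; apply: (far_one fj); by rewrite -/(graph u j l) graph_sym.
rewrite mul1r normrM ger0_norm// -[leRHS]mul1r; apply: ler_pM => //.
have := gain_itv u full j; have := gain_itv u (full :\ k) j.
by move=> /andP[? ?] /andP[? ?]; rewrite ler_norml; lra.
Qed.

Lemma term_indep u i j k x : i != k -> j != k ->
  term (full :\ k) (upd u k x) i j = term (full :\ k) u i j.
Proof.
move=> ik jk; rewrite /term degree_upd//.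
have lE : lone (graph (upd u k x)) (full :\ k) j = lone (graph u) (full :\ k) j.
  apply/setP => l; rewrite !inE; case: (eqVneq l k) => //= lk; congr (_ && ~~ _).
  apply: eq_existsb => l'; rewrite !inE; case: (eqVneq l' k) => [->|lk']; first by rewrite !andbF.
  by rewrite graph_upd.
congr (_ * (_ + _)).
  rewrite /gain; congr ((nat_of_bool (~~ _))%:R - _%:R).
    apply: eq_existsb => l; rewrite !inE; case: (eqVneq l k) => //= lk.
    by rewrite graph_upd.
  rewrite /touched lE; congr #|pred_of_set _|; apply/setP => l.
  rewrite !inE; case: (eqVneq l k) => [->|lk]; first by rewrite ?eqxx ?andbF.
  by rewrite graph_upd.
rewrite /near_avg tnth_upd (negbTE ik); congr (_ * _); apply: eq_Ex => y.
congr (_ * _); rewrite !added_sum lE; apply: eq_bigr => l _.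
have [->|lk] := eqVneq l k; last by rewrite tnth_upd (negbTE lk).
by rewrite !inE eqxx /= !mul0r.
Qed.

(** * Variance of the drift by deleting one point *)

Definition crowd k u : R := \sum_(l | l != k) (~~ far u l k)%:R.

Lemma bmf_not_far k l : bmf (fun u => (~~ far u l k)%:R : R).
Proof.
apply: bmf_bool; under eq_fun do rewrite negbK.
exact: (measurableT_comp (near_measurable (3 * rho)) (tnth_pair_measurable k l)).
Qed.

Lemma bmf_crowd k : bmf (crowd k).
Proof. by apply: bmf_sum => l _; exact: bmf_not_far. Qed.

(* [drift] with point [k] deleted. Each of the [2 * m] terms of [drift] that are lost
   lies in [-kap, 1 + kap]; the summand [m%:R] replaces them by the midpoint 1/2. *)
Definition drift_del k u : R := (n%:R * m%:R)^-1 *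
  (\sum_(i | i != k) \sum_(j | (j != i) && (j != k)) term (full :\ k) u i j + m%:R).

Lemma bmf_drift_del k : bmf (drift_del k).
Proof.
apply: bmfZ; apply: bmfD; last exact: bmf_cst.
by apply: bmf_sum => i _; apply: bmf_sum => j _; exact: bmf_term.
Qed.

Lemma indep_drift_del k : indep k (drift_del k).
Proof.
move=> u x; congr (_ * (_ + _)); apply: eq_bigr => i ik; apply: eq_bigr => j /andP[_ jk].
exact: term_indep.
Qed.

(** Ordered pairs are split into those starting at [k], those ending at [k] and those avoiding [k];
    the added [m] supplies [2^-1] for each of the [2 * m] pairs containing [k]. *)
Lemma sum_pairs_at (T T' : 'I_n -> 'I_n -> R) k :
  \sum_i \sum_(j | j != i) T i j -
   (\sum_(i | i != k) \sum_(j | (j != i) && (j != k)) T' i j + m%:R) =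
  \sum_(j | j != k) (T k j - 2^-1) + \sum_(i | i != k) (T i k - 2^-1) +
   \sum_(i | i != k) \sum_(j | (j != i) && (j != k)) (T i j - T' i j).
Proof.
have e i : i != k -> \sum_(j | j != i) T i j =
    T i k + \sum_(j | (j != i) && (j != k)) T i j.
  by move=> ik; rewrite (bigD1 k)//= eq_sym.
rewrite (bigD1 k)//= (eq_bigr _ e).
under [X in _ = _ + X]eq_bigr do rewrite sumrB.
rewrite !sumrB big_split /= !sum_others.
move: (\sum_(_ | _) _) (\sum_(_ | _) _) (\sum_(_ | _) _) (\sum_(_ | _) _) => a b c f.
lra.
Qed.

(** The [2 * m] pairs containing [k] cost [(1 + 2 * kap) / 2] each. In the other pairs a point not
    far from [k] occurs at most [m] times in either role, so [term_delete] sums to the coefficient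
    [(1 + 2 * kap) + (1 + kap)] of [crowd]. *)
Lemma drift_del_close k u : `|drift u - drift_del k u| <=
  n%:R^-1 * ((1 + 2 * kap%:R) + (2 + 3 * kap%:R) * crowd k u).
Proof.
have k0 := ler0n R kap.
rewrite driftE /drift_del -mulrBr normrM ger0_norm; last by rewrite invr_ge0 mulr_ge0.
rewrite invfM -mulrA ler_pM2l ?invr_gt0 ?ltr0n// ler_pdivrMl ?ltr0n//.
set T := term full u; set T' := term (full :\ k) u.
rewrite (sum_pairs_at T T' k).
have hb c : - kap%:R <= c <= 1 + kap%:R -> `|c - 2^-1| <= (1 + 2 * kap%:R) / 2 :> R.
  by move=> /andP[? ?]; rewrite ler_norml; lra.
have h1 : `|\sum_(j | j != k) (T k j - 2^-1)| <= m%:R * ((1 + 2 * kap%:R) / 2).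
  rewrite -(sum_others k); apply: (le_trans (ler_norm_sum _ _ _)).
  by apply: ler_sum => j _; apply: hb; exact: term_itv.
have h2 : `|\sum_(i | i != k) (T i k - 2^-1)| <= m%:R * ((1 + 2 * kap%:R) / 2).
  rewrite -(sum_others k); apply: (le_trans (ler_norm_sum _ _ _)).
  by apply: ler_sum => j _; apply: hb; exact: term_itv.
have h3 : `|\sum_(i | i != k) \sum_(j | (j != i) && (j != k)) (T i j - T' i j)| <=
    m%:R * ((2 + 3 * kap%:R) * crowd k u).
  pose F i : R := (~~ far u i k)%:R.
  apply: (le_trans (ler_norm_sum _ _ _)).
  apply: (@le_trans _ _ (\sum_(i | i != k) (m%:R * (F i * (1 + 2 * kap%:R))
       + crowd k u * (1 + kap%:R)))).
    apply: ler_sum => i ik; apply: (le_trans (ler_norm_sum _ _ _)).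
    apply: (@le_trans _ _ (\sum_(j | (j != i) && (j != k))
      (F i * (1 + 2 * kap%:R) + F j * (1 + kap%:R)))).
      by apply: ler_sum => j /andP[ji jk]; exact: term_delete.
    rewrite big_split /=; apply: lerD.
      rewrite -(sum_others i) [leLHS]big_mkcond [leRHS]big_mkcond.
      apply: ler_sum => j _; case: (j != i); case: (j != k) => //=.
      by rewrite mulr_ge0 ?ler0n// addr_ge0// mulr_ge0.
    rewrite /crowd mulr_suml [leLHS]big_mkcond [leRHS]big_mkcond.
    apply: ler_sum => j _; case: (j != i); case: (j != k) => //=.
  rewrite big_split /= sum_others -mulr_sumr -mulr_suml -/(crowd k u).
  by rewrite le_eqVlt; apply/orP; left; apply/eqP; ring.
apply: (le_trans (ler_normD _ _)); apply: (le_trans (lerD (ler_normD _ _) (lexx _))).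
apply: (le_trans (lerD (lerD h1 h2) h3)).
by rewrite le_eqVlt; apply/orP; left; apply/eqP; field.
Qed.

Lemma not_far_mean k l : l != k -> Ex Q (fun u => (~~ far u l k)%:R) <= p3.
Proof.
move=> lk; have bf := bmf_not_far k l.
rewrite -(Q_resample l) // -[leRHS](Ex_cst Q p3).
apply: Ex_le; [exact: bmf_avg|exact: bmf_cst|move=> u].
rewrite /avg; under eq_Ex do rewrite /far negbK !tnth_upd eqxx eq_sym (negbTE lk).
exact: p3_ge.
Qed.

(** Averaging over [l] first leaves the factor of [l'] untouched, because [k], [l] and [l'] are
    distinct. *)
Lemma not_far_mean2 k l l' : l != k -> l' != k -> l != l' ->
  Ex Q (fun u => (~~ far u l k)%:R * (~~ far u l' k)%:R) <= p3 ^+ 2.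
Proof.
move=> lk lk' ll'; have bf := bmf_not_far k l; have bf' := bmf_not_far k l'.
have p30 : 0 <= p3 by apply: le_trans (p3_ge point); apply: Ex_ge0 => y; exact: ler0n.
rewrite -(Q_resample l); last exact: bmfM.
apply: (@le_trans _ _ (Ex Q (fun u => p3 * (~~ far u l' k)%:R))); last first.
  by rewrite ExZ// expr2 ler_wpM2l// not_far_mean.
apply: Ex_le; [by apply: bmf_avg; exact: bmfM|exact: bmfZ|move=> u].
under [X in avg _ _ X]eq_fun do rewrite mulrC.
rewrite avgM//; last first.
  by move=> v x; rewrite /far !tnth_upd eq_sym (negbTE lk) eq_sym (negbTE ll').
rewrite mulrC ler_wpM2r//.
rewrite /avg; under eq_Ex do rewrite /far negbK !tnth_upd eqxx eq_sym (negbTE lk).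
exact: p3_ge.
Qed.

Lemma crowd_mean k : Ex Q (crowd k) <= m%:R * p3.
Proof.
rewrite /crowd Ex_sum; last by move=> l _; exact: bmf_not_far.
by rewrite -(sum_others k); apply: ler_sum => l lk; exact: not_far_mean.
Qed.

Lemma crowd_mean2 k : Ex Q (fun u => crowd k u ^+ 2) <= m%:R * p3 + (m%:R * p3) ^+ 2.
Proof.
have b l l' : bmf (fun u => (~~ far u l k)%:R * (~~ far u l' k)%:R : R).
  by apply: bmfM; exact: bmf_not_far.
have p30 : 0 <= p3 by apply: le_trans (p3_ge point); apply: Ex_ge0 => y; exact: ler0n.
have -> : Ex Q (fun u => crowd k u ^+ 2) = \sum_(l | l != k) \sum_(l' | l' != k)
    Ex Q (fun u => (~~ far u l k)%:R * (~~ far u l' k)%:R).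
  under eq_Ex do rewrite expr2 /crowd big_distrlr /=.
  rewrite Ex_sum; last by move=> l _; exact: bmf_sum.
  by apply: eq_bigr => l _; rewrite Ex_sum.
have -> : m%:R * p3 + (m%:R * p3) ^+ 2 = m%:R * (p3 + m%:R * p3 ^+ 2) by ring.
rewrite -(sum_others k); apply: ler_sum => l lk.
rewrite (bigD1 l)//=; apply: lerD.
  under eq_Ex do rewrite -natrM mulnb andbb.
  exact: not_far_mean.
rewrite -(sum_others k) [leLHS]big_mkcond [leRHS]big_mkcond.
apply: ler_sum => l' _; case: (eqVneq l' k) => //= l'k.
case: (eqVneq l' l) => /= [_|l'l]; first exact: sqr_ge0.
by apply: not_far_mean2; rewrite // eq_sym.
Qed.

(** Efron-Stein with the comparison functions [drift_del k]: each of the [n] summands is at most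
    [n^-2] times the second moment of a linear function of [crowd k]. *)
Lemma drift_variance :
  Ex Q (fun u => drift u ^+ 2) - Ex Q drift ^+ 2 <=
  n%:R^-1 * ((1 + 2 * kap%:R) ^+ 2
    + 2 * (1 + 2 * kap%:R) * (2 + 3 * kap%:R) * (m%:R * p3)
    + (2 + 3 * kap%:R) ^+ 2 * (m%:R * p3 + (m%:R * p3) ^+ 2)).
Proof.
have k0 := ler0n R kap.
apply: (le_trans (efron_stein Q_resample bmf_drift bmf_drift_del indep_drift_del)).
set c := (X in _ <= _ * X).
apply: (@le_trans _ _ (\sum_(k < n) (n%:R^-1 ^+ 2 * c))); last first.
  rewrite sumr_const card_ord -[leLHS]mulr_natl le_eqVlt; apply/orP; left; apply/eqP.
  by field.
apply: ler_sum => k _.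
have bc := bmf_crowd k.
have bL : bmf (fun u => (1 + 2 * kap%:R) + (2 + 3 * kap%:R) * crowd k u).
  by apply: bmfD; [exact: bmf_cst|exact: bmfZ].
apply: (@le_trans _ _ (Ex Q (fun u => n%:R^-1 ^+ 2 *
    ((1 + 2 * kap%:R) + (2 + 3 * kap%:R) * crowd k u) ^+ 2))).
  apply: Ex_le; [|by apply: bmfZ; exact: bmfX|move=> u].
    by apply/bmfX/bmfB; [exact: bmf_drift|exact: bmf_drift_del].
  rewrite -exprMn -(real_normK (num_real (drift u - _))) ler_pXn2r ?nnegrE//.
    exact: drift_del_close.
  exact: le_trans (normr_ge0 _) (drift_del_close k u).
rewrite ExZ; last exact: bmfX.
rewrite ler_pM2l ?exprn_gt0 ?invr_gt0 ?ltr0n//.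
have -> : Ex Q (fun u => (1 + 2 * kap%:R + (2 + 3 * kap%:R) * crowd k u) ^+ 2) =
    (1 + 2 * kap%:R) ^+ 2
    + 2 * (1 + 2 * kap%:R) * (2 + 3 * kap%:R) * Ex Q (crowd k)
    + (2 + 3 * kap%:R) ^+ 2 * Ex Q (fun u => crowd k u ^+ 2).
  rewrite -!ExZ//; last exact: bmfX.
  have b1 := bmf_cst (T := n.-tuple X) ((1 + 2 * kap%:R) ^+ 2 : R).
  rewrite -{1}(Ex_cst Q ((1 + 2 * kap%:R) ^+ 2)) -!ExD//; last 3 first.
  - by apply: bmfD => //; exact: bmfZ.
  - by apply: bmfZ; exact: bmfX.
  - exact: bmfZ.
  by apply: eq_Ex => u; ring.
rewrite lerD// ?lerD2l; apply: ler_wpM2l.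
- by rewrite !mulr_ge0// addr_ge0// mulr_ge0.
- exact: crowd_mean.
- exact: sqr_ge0.
- exact: crowd_mean2.
Qed.

End GeometricGraph.

(** * The Stein equation for smoothed indicators *)

Section Gaussian.
Context {R : realType}.
Import numFieldNormedType.Exports.
Local Notation mu := (@lebesgue_measure R).
Implicit Types x y w t : R.

Definition gdens : R -> R := normal_pdf 0 1.

Lemma gdensE x : gdens x = normal_peak 1 * expR (- (x ^+ 2 / 2)).
Proof.
rewrite /gdens normal_pdfE ?oner_eq0// /normal_fun subr0 expr1n mulNr.
by congr (_ * expR (- (_ / _))).
Qed.

Lemma gdens_gt0 x : 0 < gdens x.
Proof. by rewrite gdensE mulr_gt0 ?expR_gt0// normal_peak_gt0 ?oner_eq0. Qed.

Lemma gdens_ge0 x : 0 <= gdens x. Proof. exact/ltW/gdens_gt0. Qed.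

(** Makes [gcdf] Lipschitz with constant 1/2, the source of the term [al / 2] in the smoothing
    bound. *)
Lemma gdens_le_half x : gdens x <= 2^-1.
Proof.
apply: (le_trans (normal_pdf_ub 0 x (oner_neq0 R))).
have pi2 : 0 < pi *+ 2 :> R by rewrite -mulr_natl mulr_gt0// pi_gt0.
rewrite /normal_peak expr1n mul1r lef_pV2 ?posrE ?ltr0n// ?sqrtr_gt0//.
rewrite -[leLHS]ger0_norm// -sqrtr_sqr ler_sqrt ?(ltW pi2)//.
by have := @pi_ge2 R; rewrite -[_ *+ 2]mulr_natl expr2; lra.
Qed.

Lemma gdensN x : gdens (- x) = gdens x.
Proof. by rewrite !gdensE sqrrN. Qed.

Lemma gdens_le x y : 0 <= x -> x <= y -> gdens y <= gdens x.
Proof.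
move=> x0 xy; rewrite !gdensE ler_pM2l ?normal_peak_gt0 ?oner_eq0//.
by rewrite ler_expR lerN2 ler_pM2r ?invr_gt0// ler_pXn2r ?nnegrE// (le_trans x0).
Qed.

Lemma is_derive_gdens x : is_derive x 1 gdens (- x * gdens x).
Proof.
rewrite (_ : gdens = fun x => normal_peak 1 * expR (- (x ^+ 2 / 2))); last first.
  by apply/funext => y; rewrite gdensE.
apply: is_derive_eq.
by rewrite /GRing.scale /=; field.
Qed.

Lemma continuous_gdens : continuous gdens.
Proof. by apply: continuous_normal_pdf; exact: oner_neq0. Qed.

Lemma integrable_gdens (A : set R) : measurable A -> mu.-integrable A (EFin \o gdens).
Proof. by move=> mA; apply: integrableS (integrable_normal_pdf 0 1). Qed.

Lemma cvg_gdens : gdens x @[x --> +oo%R] --> (0 : R).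
Proof.
rewrite (_ : gdens = fun x => normal_peak 1 * expR (- (x ^+ 2 / 2))); last first.
  by apply/funext => y; rewrite gdensE.
rewrite -[0 in X in _ --> X](mulr0 (normal_peak 1 : R)); apply: cvgMr.
apply: (cvg_comp (fun x : R => x ^+ 2 / 2) (fun x => expR (- x))); last exact: cvgr_expR.
apply: gt0_cvgMly; last exact: cvgr_expr2.
by rewrite invr_gt0.
Qed.

Definition gcdf w : R := (\int[mu]_(x in `]-oo, w]) gdens x)%R.
Definition gtail w : R := (\int[mu]_(x in `[w, +oo[) gdens x)%R.

Lemma EFin_gtail w : (gtail w)%:E = (\int[mu]_(x in `[w, +oo[) (gdens x)%:E)%E.
Proof. by rewrite fineK// integrable_fin_num//; exact: integrable_gdens. Qed.

(** Mills' inequality: replace the factor [w] by the integration variable, for which [- gdens] is a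
    primitive. *)
Lemma gtail_mill w : 0 <= w -> w * gtail w <= gdens w.
Proof.
move=> w0.
have e : (\int[mu]_(x in `[w, +oo[) (x * gdens x)%:E = 0%:E - (- gdens w)%:E)%E.
  have dF x : is_derive x 1 (fun x => - gdens x) (x * gdens x).
    have := is_derive_gdens x => h; apply: is_derive_eq; ring.
  have cF : continuous (fun x => - gdens x).
    by move=> x; apply: cvgN; exact: continuous_gdens.
  apply: (ge0_continuous_FTC2y (F := fun x => - gdens x)).
  - by move=> x wx; rewrite mulr_ge0 ?gdens_ge0// (le_trans w0).
  - apply: continuous_subspaceT => x; apply: cvgM; [exact: cvg_id|exact: continuous_gdens].
  - by rewrite -[0]oppr0; apply: cvgN; exact: cvg_gdens.
  - by move=> x _; exact: ex_derive.
  - by apply: cvg_at_right_filter; exact: cF.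
  - by move=> x _; rewrite derive1E derive_val.
have mg : measurable_fun setT gdens by exact: continuous_measurable_fun continuous_gdens.
rewrite -lee_fin EFinM EFin_gtail -ge0_integralZl//=; last 2 first.
- exact/measurable_EFinP/measurable_funTS.
- by move=> x _; rewrite lee_fin gdens_ge0.
have -> : (gdens w)%:E = (\int[mu]_(x in `[w, +oo[) (x * gdens x)%:E)%E.
  by rewrite e -EFinB sub0r opprK.
apply: ge0_le_integral => //=.
- by move=> x _; rewrite -EFinM lee_fin mulr_ge0 ?gdens_ge0.
- by apply/measurable_EFinP/measurable_funM => //; exact: measurable_funTS.
- by apply/measurable_EFinP/measurable_funM => //; exact: measurable_funTS.
- move=> x; rewrite in_itv/= andbT => wx; rewrite -EFinM lee_fin.
  by rewrite ler_wpM2r ?gdens_ge0.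
Qed.

Lemma gtail_ge0 w : 0 <= gtail w.
Proof. by apply: Rintegral_ge0 => x _; rewrite gdens_ge0. Qed.

Lemma gcdf_ge0 w : 0 <= gcdf w.
Proof. by apply: Rintegral_ge0 => x _; rewrite gdens_ge0. Qed.

Lemma gcdf_gtail w : gcdf (- w) = gtail w.
Proof.
rewrite /gcdf /gtail /Rintegral; congr fine.
rewrite (@ge0_integration_by_substitutionNy _ gdens w).
- by apply: eq_integral => x _ /=; rewrite gdensN.
- exact/continuous_subspaceT/continuous_gdens.
- by move=> x _; rewrite gdens_ge0.
Qed.

Lemma gcdf_normal_prob t : fine (normal_prob 0 1 [set z : R | z <= t]) = gcdf t.
Proof.
rewrite /normal_prob /gcdf /Rintegral; congr fine; congr (integral _ _ _).
Qed.

Lemma Rintegral_rayB (f : R -> R) a b : mu.-integrable setT (EFin \o f) -> a <= b ->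
  (\int[mu]_(x in `]-oo, b]) f x)%R - (\int[mu]_(x in `]-oo, a]) f x)%R
    = (\int[mu]_(x in `]a, b]) f x)%R.
Proof.
move=> fi ab; apply: Rintegral_itvB; rewrite ?bnd_simp//.
exact: integrableS fi.
Qed.

Lemma Rintegral_ray_le (f1 f2 : R -> R) w : mu.-integrable setT (EFin \o f1) ->
  mu.-integrable setT (EFin \o f2) -> (forall x, f1 x <= f2 x) ->
  (\int[mu]_(x in `]-oo, w]) f1 x)%R <= (\int[mu]_(x in `]-oo, w]) f2 x)%R.
Proof.
by move=> i1 i2 f12; apply: le_Rintegral => //; [exact: integrableS i1|exact: integrableS i2].
Qed.

Lemma gcdfB_le a b c : a <= b -> (forall x, a <= x <= b -> gdens x <= c) ->
  gcdf b - gcdf a <= c * (b - a).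
Proof.
move=> ab gc; rewrite /gcdf Rintegral_rayB//; last exact: integrable_gdens.
apply: (@le_trans _ _ (\int[mu]_(x in `]a, b]) c)%R).
  apply: le_Rintegral => //.
  - exact: integrable_gdens.
  - apply: measurable_bounded_integrable => //.
      by rewrite /= lebesgue_measure_itv /= lte_fin; case: ifP => // _; rewrite -EFinB ltry.
    by exists `|c|; split; [exact: num_real|move=> y /ltW cy x _ /=].
  - by move=> x /=; rewrite in_itv /= => /andP[/ltW ax xb]; apply: gc; rewrite ax.
rewrite Rintegral_cst//= lebesgue_measure_itv /= lte_fin.
by move: ab; rewrite le_eqVlt => /predU1P[->|->] //=; rewrite ltxx subrr.
Qed.

Lemma gcdfB_le_half a b : a <= b -> gcdf b - gcdf a <= (b - a) / 2.
Proof. by move=> ab; rewrite mulrC; apply: gcdfB_le => // x _; exact: gdens_le_half. Qed.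

Lemma Rintegral_ray_compl (f : R -> R) w : mu.-integrable setT (EFin \o f) ->
  (\int[mu]_x f x)%R = (\int[mu]_(x in `]-oo, w]) f x)%R + (\int[mu]_(x in `]w, +oo[) f x)%R.
Proof.
move=> fi; rewrite -Rintegral_setU//.
- congr (Rintegral _ _ _); apply/seteqP; split => x //= _; rewrite !in_itv /= andbT.
  by case: (leP x w) => _; [left|right].
- by apply: integrableS fi => //; exact: measurableU.
- apply/disj_setPS => x /=; rewrite !in_itv /= andbT => -[xw wx].
  by move: (lt_le_trans wx xw); rewrite ltxx.
Qed.

Lemma gtail_open w : (\int[mu]_(x in `]w, +oo[) gdens x)%R = gtail w.
Proof. by rewrite /gtail Rintegral_itv_obnd_cbnd//; exact: integrable_gdens. Qed.

Lemma gcdf_add_gtail w : gcdf w + gtail w = 1.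
Proof.
rewrite -gtail_open -Rintegral_ray_compl ?integrable_gdens//.
by rewrite /Rintegral integral_normal_pdf.
Qed.

(** For [w >= 1] this is weaker than Mills' inequality. For [w < 1] the mass of [[w, 1]] is at most
    [(1 - w) * gdens w], and the tail beyond 1 is at most [gdens 1 <= gdens w]. *)
Lemma gtail_le w : 0 <= w -> gtail w <= 2 * gdens w.
Proof.
move=> w0; have g0 := gdens_ge0 w; case: (leP 1 w) => w1.
  have := gtail_mill w0; have := gtail_ge0 w; have : gtail w <= w * gtail w.
    by rewrite ler_peMl// gtail_ge0.
  by lra.
have := gtail_mill ler01; rewrite mul1r => m1.
have gw : gdens 1 <= gdens w by apply: gdens_le => //; exact: ltW.
have : gcdf 1 - gcdf w <= gdens w * (1 - w).
  by apply: gcdfB_le; [exact: ltW|move=> x /andP[wx _]; exact: gdens_le].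
have := gcdf_add_gtail w; have := gcdf_add_gtail 1.
have : 0 <= gdens w * w by exact: mulr_ge0.
lra.
Qed.

Lemma gcdf_le w : w <= 0 -> gcdf w <= 2 * gdens w.
Proof. by move=> w0; rewrite -[w]opprK gcdf_gtail gdensN gtail_le// oppr_ge0. Qed.

Lemma gcdf_mill w : w <= 0 -> - w * gcdf w <= gdens w.
Proof. by move=> w0; rewrite -{2 3}[w]opprK gcdf_gtail gdensN gtail_mill// oppr_ge0. Qed.

Lemma is_derive_ray (k : R -> R) w : mu.-integrable setT (EFin \o k) ->
  {for w, continuous k} ->
  is_derive w 1 (fun x => (\int[mu]_(t in `]-oo, x]) k t)%R) (k w).
Proof.
move=> ik ck.
have iray : mu.-integrable [set` Interval -oo%O (BRight (w + 1))] (EFin \o k).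
  exact: integrableS ik.
have w1 : w < w + 1 by rewrite ltrDl.
have [dp e] := continuous_FTC1 w1 iray (ltNyr w) ck.
by apply: DeriveDef; [exact: dp|rewrite -derive1E; exact: e].
Qed.

Section SteinSolution.
Variable h : R -> R.
Hypothesis h_cont : continuous h.
Hypothesis h01 : forall x, 0 <= h x <= 1.

Definition hbar : R := (\int[mu]_x (h x * gdens x))%R.

Let rhs x : R := (h x - hbar) * gdens x.

Lemma integrable_weighted (k : R -> R) : measurable_fun setT k ->
  (exists M, forall x, `|k x| <= M) -> mu.-integrable setT (EFin \o (fun x => k x * gdens x)).
Proof.
move=> mk [M kM]; have M0 : 0 <= M by exact: le_trans (normr_ge0 (k 0)) (kM 0).
have iM : mu.-integrable setT (EFin \o (fun x => M * gdens x)).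
  rewrite (_ : _ \o _ = fun x => (M%:E * (gdens x)%:E)%E); last by apply/funext => x /=; rewrite EFinM.
  by apply: integrableZl => //; exact: integrable_gdens.
apply: le_integrable iM => //.
- apply/measurable_EFinP/measurable_funM => //.
  by exact: continuous_measurable_fun continuous_gdens.
- move=> x _ /=; rewrite lee_fin !normrM (ger0_norm M0) ler_pM//.
Qed.

Let mh : measurable_fun setT h. Proof. exact: continuous_measurable_fun. Qed.

Let ih : mu.-integrable setT (EFin \o (fun x => h x * gdens x)).
Proof.
apply: integrable_weighted => //; exists 1 => x.
by have /andP[? ?] := h01 x; rewrite ger0_norm.
Qed.

Let irhs : mu.-integrable setT (EFin \o rhs).
Proof.
apply: integrable_weighted; first exact: measurable_funB.
exists (1 + `|hbar|) => x; rewrite (le_trans (ler_normB _ _))// lerD2r.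
by have /andP[? ?] := h01 x; rewrite ger0_norm.
Qed.

Let ig : mu.-integrable setT (EFin \o gdens). Proof. exact: integrable_gdens. Qed.

Let igZ c : mu.-integrable setT (EFin \o (fun x => c * gdens x)).
Proof. by apply: integrable_weighted => //; exists `|c|. Qed.

Lemma hbar01 : 0 <= hbar <= 1.
Proof.
apply/andP; split.
  by apply: Rintegral_ge0 => x _; rewrite mulr_ge0 ?gdens_ge0//; have /andP[] := h01 x.
have -> : 1 = (\int[mu]_x gdens x)%R by rewrite /Rintegral integral_normal_pdf.
apply: le_Rintegral => // x _; have /andP[_ h1] := h01 x.
by rewrite ler_piMl ?gdens_ge0.
Qed.

Let total : (\int[mu]_x rhs x)%R = 0.
Proof.
rewrite /rhs; under eq_Rintegral do rewrite mulrBl.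
rewrite RintegralB// RintegralZl// /Rintegral integral_normal_pdf -/(Rintegral mu setT (fun x => h x * gdens x)).
by rewrite -/hbar /= mulr1 subrr.
Qed.

Definition prim w : R := (\int[mu]_(x in `]-oo, w]) rhs x)%R.

(** The bounded solution of Stein's equation [f' w - w * f w = h w - hbar]. *)
Definition solution w : R := prim w / gdens w.

Lemma prim_lo w : - hbar * gcdf w <= prim w <= (1 - hbar) * gcdf w.
Proof.
have ZE c : c * gcdf w = (\int[mu]_(x in `]-oo, w]) (c * gdens x))%R.
  by rewrite RintegralZl//; exact: integrable_gdens.
rewrite !ZE /prim; apply/andP; split; apply: Rintegral_ray_le => // x;
  rewrite /rhs ler_wpM2r ?gdens_ge0//; have /andP[? ?] := h01 x; lra.
Qed.

(** The right-hand side has total integral 0, so [prim] is also minus its integral over the upper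
    ray. This serves positive [w] as [prim_lo] serves the others. *)
Lemma prim_up w : - (1 - hbar) * gtail w <= prim w <= hbar * gtail w.
Proof.
have -> : prim w = - (\int[mu]_(x in `]w, +oo[) rhs x)%R.
  by apply/eqP; rewrite -addr_eq0 -Rintegral_ray_compl// total.
have ZE c : c * gtail w = (\int[mu]_(x in `]w, +oo[) (c * gdens x))%R.
  by rewrite RintegralZl//; [rewrite gtail_open|exact: integrable_gdens].
have le1 (f1 f2 : R -> R) : mu.-integrable setT (EFin \o f1) ->
    mu.-integrable setT (EFin \o f2) -> (forall x, f1 x <= f2 x) ->
    (\int[mu]_(x in `]w, +oo[) f1 x)%R <= (\int[mu]_(x in `]w, +oo[) f2 x)%R.
  by move=> i1 i2 f12; apply: le_Rintegral => //; [exact: integrableS i1|exact: integrableS i2].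
rewrite mulNr lerN2 lerNl -mulNr !ZE; apply/andP; split; apply: le1 => // x;
  rewrite /rhs ler_wpM2r ?gdens_ge0//; have /andP[? ?] := h01 x; lra.
Qed.

Lemma solution_bound w : `|solution w| <= 2.
Proof.
have /andP[H0 H1] := hbar01; have g0 := gdens_gt0 w.
rewrite /solution normrM normfV (gtr0_norm g0) ler_pdivrMr//.
case: (leP w 0) => w0.
  have /andP[] := prim_lo w; have := gcdf_le w0; have := gcdf_ge0 w.
  by move: (gcdf w) (prim w) => L p L0 L2 ? ?; rewrite ler_norml; apply/andP; split; nra.
have /andP[] := prim_up w; have := gtail_le (ltW w0); have := gtail_ge0 w.
by move: (gtail w) (prim w) => L p L0 L2 ? ?; rewrite ler_norml; apply/andP; split; nra.
Qed.

Definition solution' w : R := w * solution w + (h w - hbar).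

(** Mills' inequality on the appropriate tail puts [w * solution w] in [[-(1 - hbar), hbar]], while
    [h w - hbar] lies in [[-hbar, 1 - hbar]]. *)
Lemma solution'_bound w : `|solution' w| <= 1.
Proof.
have /andP[H0 H1] := hbar01; have g0 := gdens_gt0 w; have /andP[h0 h1] := h01 w.
suff : - (1 - hbar) <= w * solution w <= hbar.
  by rewrite /solution' ler_norml => /andP[? ?]; lra.
rewrite /solution mulrA ler_pdivlMr// ler_pdivrMr//.
case: (leP w 0) => w0.
  have /andP[] := prim_lo w; have := gcdf_mill w0; have := gcdf_ge0 w.
  by move: (gcdf w) (prim w) => L p L0 L2 ? ?; apply/andP; split; nra.
have /andP[] := prim_up w; have := gtail_mill (ltW w0); have := gtail_ge0 w.
by move: (gtail w) (prim w) => L p L0 L2 ? ?; apply/andP; split; nra.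
Qed.

Lemma is_derive_solution w : is_derive w 1 solution (solution' w).
Proof.
have dP : is_derive w 1 prim (rhs w).
  apply: is_derive_ray => //; apply: cvgM; last exact: continuous_gdens.
  by apply: cvgB; [exact: h_cont|exact: cvg_cst].
have dG := is_derive_gdens w.
have g0 : gdens w != 0 by rewrite gt_eqF// gdens_gt0.
have -> : solution = prim * (fun x => (gdens x)^-1) by [].
have dV := is_deriveV g0 dG.
apply: is_derive_eq; rewrite /solution' /solution /GRing.scale /= /rhs.
by field.
Qed.

End SteinSolution.

End Gaussian.

(** * Taylor estimates from one derivative *)

Section Taylor.
Context {R : realType}.
Import numFieldNormedType.Exports.
Implicit Types (f g : R -> R) (x y s : R).

Lemma le_away_from g g' x y :
  (forall s, is_derive s 1 g (g' s)) ->
  (forall s, `|s - x| <= `|y - x| -> 0 <= g' s * (s - x)) -> g x <= g y.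
Proof.
move=> dg g'0; have cg : continuous g.
  by move=> s; apply: differentiable_continuous; apply/derivable1_diffP; case: (dg s).
have [xy|yx|->//] := ltgtP x y.
- have [|c] := MVT xy (fun s _ => dg s); first exact: continuous_subspaceT.
  rewrite in_itv /= => /andP[xc cy] e; rewrite -subr_ge0 e mulr_ge0 ?subr_ge0 ?(ltW xy)//.
  have := g'0 c; rewrite !gtr0_norm ?subr_gt0// lerD2r => /(_ (ltW cy)).
  by rewrite pmulr_lge0// subr_gt0.
- have [|c] := MVT yx (fun s _ => dg s); first exact: continuous_subspaceT.
  rewrite in_itv /= => /andP[yc cx] e; rewrite -subr_le0 e.
  have := g'0 c; rewrite !ltr0_norm ?subr_lt0// lerN2 lerD2r => /(_ (ltW yc)).
  by rewrite nmulr_lge0 ?subr_lt0// => h; rewrite mulr_le0_ge0// subr_ge0 ltW.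
Qed.

(** The ramp has corners, so [f'] is controlled only by a Lipschitz estimate from the base point.
    [K (s - x)^2 / 2] plus or minus the remainder vanishes at [x] and its derivative has the sign of
    [s - x], so it grows away from [x]. *)
Lemma taylor_two f f' (K : R) x y :
  (forall s, is_derive s 1 f (f' s)) ->
  (forall s, `|s - x| <= `|y - x| -> `|f' s - f' x| <= K * `|s - x|) ->
  `|f y - f x - (y - x) * f' x| <= K * (y - x) ^+ 2 / 2.
Proof.
move=> df hf.
pose psi (e : R) s := K * (s - x) ^+ 2 / 2 - e * (f s - f x - (s - x) * f' x).
have dpsi e s : is_derive s 1 (psi e) (K * (s - x) - e * (f' s - f' x)).
  have := df s => dfs; rewrite /psi; apply: is_derive_eq.
  by rewrite /GRing.scale /=; field.
have main e : `|e| = 1 -> 0 <= psi e y.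
  move=> e1; have -> : 0 = psi e x.
    by rewrite /psi !subrr expr0n mulr0 mul0r mul0r subrr mulr0 subr0.
  apply: (le_away_from (dpsi e)) => s /hf h.
  rewrite mulrBl subr_ge0; apply: (le_trans (ler_norm _)); rewrite !normrM e1 mul1r.
  have -> : K * (s - x) * (s - x) = K * `|s - x| * `|s - x|.
    by rewrite -!mulrA -!expr2 real_normK ?num_real.
  exact: ler_wpM2r.
have := main 1 (normr1 _); have := main (-1); rewrite normrN1 => /(_ erefl).
by rewrite /psi mulN1r mul1r opprK ler_norml => h1 h2; apply/andP; split; lra.
Qed.

Lemma lipschitz_of_derive f (f' : R -> R) :
  (forall s, is_derive s 1 f (f' s)) -> (forall s, `|f' s| <= 1) ->
  forall x y, `|f y - f x| <= `|y - x|.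
Proof.
move=> df f'1; have cf : continuous f.
  by move=> s; apply: differentiable_continuous; apply/derivable1_diffP; case: (df s).
have lt x y : x < y -> `|f y - f x| <= `|y - x|.
  move=> xy; have [|c _ ->] := MVT xy (fun s _ => df s); first exact: continuous_subspaceT.
  by rewrite normrM ler_piMl.
move=> x y; have [xy|yx|->] := ltgtP x y; first exact: lt.
- by rewrite distrC [leRHS]distrC lt.
- by rewrite !subrr.
Qed.

End Taylor.

(** * Smoothed indicators of half-lines *)

Section Ramp.
Context {R : realType}.
Import numFieldNormedType.Exports.
Variables (z al : R).
Hypothesis al_gt0 : 0 < al.
Implicit Types x y : R.

(* Equal to 1 up to [z], to 0 from [z + al] on, and affine in between. *)
Definition ramp x : R :=
  (1 + `|(z + al - x) / al| - `|(z + al - x) / al - 1|) / 2.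

Let arg1 x : (z + al - x) / al - 1 = (z - x) / al.
Proof. by field; rewrite gt_eqF. Qed.

Lemma ramp01 x : 0 <= ramp x <= 1.
Proof.
rewrite /ramp; move: ((z + al - x) / al) => u.
by case: (ger0P u) => ?; case: (ger0P (u - 1)) => ?; apply/andP; split; lra.
Qed.

Lemma ramp_left x : x <= z -> ramp x = 1.
Proof.
move=> xz; rewrite /ramp arg1 !ger0_norm.
- by field; rewrite gt_eqF.
- by rewrite divr_ge0 ?subr_ge0// ltW.
- by rewrite divr_ge0 ?ltW// subr_gt0 (le_lt_trans xz)// ltrDl.
Qed.

Lemma ramp_right x : z + al <= x -> ramp x = 0.
Proof.
move=> zx; rewrite /ramp arg1 !ler0_norm.
- by field; rewrite gt_eqF.
- rewrite mulr_le0_ge0 ?invr_ge0 ?(ltW al_gt0)// subr_le0 (le_trans _ zx)// lerDl ltW//.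
- by rewrite mulr_le0_ge0 ?invr_ge0 ?(ltW al_gt0)// subr_le0.
Qed.

Lemma ramp_lipschitz x y : `|ramp y - ramp x| <= `|y - x| / al.
Proof.
rewrite /ramp; set u := (z + al - x) / al; set v := (z + al - y) / al.
have e : `|y - x| / al = `|u - v|.
  rewrite -{1}(gtr0_norm al_gt0) -normfV -normrM; congr `|_|.
  by rewrite /u /v; field; rewrite gt_eqF.
rewrite e; have h1 := lerB_dist u v.
case: (ger0P u) => ?; case: (ger0P (u - 1)) => ?; case: (ger0P v) => ?;
  case: (ger0P (v - 1)) => ?; case: (ger0P (u - v)) => ?; rewrite ler_norml; lra.
Qed.

Lemma ramp_continuous : continuous ramp.
Proof.
have cn (k : R -> R) : continuous k -> continuous (fun x => `|k x|).
  by move=> ck x; apply: (cvg_comp k Num.norm); [exact: ck|exact: norm_continuous].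
have cu : continuous (fun x => (z + al - x) / al).
  move=> x; apply: cvgMl; apply: cvgB; first exact: cvg_cst.
  exact: cvg_id.
move=> x; apply: cvgMl; apply: cvgB.
  by apply: cvgD; [exact: cvg_cst|exact: (cn _ cu)].
by apply: (cn (fun x => (z + al - x) / al - 1)) => y; apply: cvgB; [exact: cu|exact: cvg_cst].
Qed.

End Ramp.

(** * Kolmogorov distance from a size-bias coupling *)

(** With [al = a + 4/5 q], multiplying by [al] and cancelling [a D] leaves [4/5 q D] on the left. On
    the right the terms free of [q] are [11/4 a^2 + a eps], where [11/4 = 1/2 + 7/4 + 1/2], and they
    are at most [q^2 / 4]: hence the 11 and the 5. *)
Lemma kolmogorov_recursion (R : realFieldType) (a eps q D : R) :
  0 < a -> 0 <= eps -> 0 < q -> q ^+ 2 = a * (11 * a + 5 * eps) ->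
  (forall al, 0 < al -> D <= al / 2 + eps + 7 / 4 * a + (a ^+ 2 / 2 + a * D) / al) ->
  D <= 3 * a + eps + 4 / 5 * q.
Proof.
move=> a0 e0 q0 q2 H.
have [al e al0] : exists2 al, al = a + 4 / 5 * q & 0 < al by exists (a + 4 / 5 * q) => //; lra.
have := H _ al0; rewrite -(ler_pM2r al0) [leRHS]mulrDl divfK ?gt_eqF// => h.
subst al.
suff : 4 / 5 * q * D <= 4 / 5 * q * (3 * a + eps + 4 / 5 * q).
  by rewrite ler_pM2l// mulr_gt0.
have aq0 : 0 <= a * q by rewrite mulr_ge0// ltW.
have ae0 : 0 <= a * eps by rewrite mulr_ge0// ltW.
have aa0 : 0 <= a * a by rewrite mulr_ge0// ltW.
rewrite expr2 in q2; nra.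
Qed.

Section HbarBounds.
Context {R : realType}.
Import numFieldNormedType.Exports.
Local Notation mu := (@lebesgue_measure R).

Lemma hbar_ramp_bounds (z al : R) : 0 < al ->
  gcdf z <= hbar (ramp z al) <= gcdf (z + al).
Proof.
move=> al0.
have ih : mu.-integrable setT (EFin \o (fun x => ramp z al x * gdens x)).
  apply: integrable_weighted; first by apply: continuous_measurable_fun; exact: ramp_continuous.
  by exists 1 => x; have /andP[? ?] := ramp01 z al x; rewrite ger0_norm.
have r0 x : 0 <= ramp z al x * gdens x.
  by rewrite mulr_ge0 ?gdens_ge0//; have /andP[] := ramp01 z al x.
apply/andP; split.
  rewrite /hbar (Rintegral_ray_compl z ih).
  rewrite [X in X + _](_ : _ = gcdf z); last first.
    by apply: eq_Rintegral => x; rewrite inE /= in_itv /= => xz; rewrite ramp_left// mul1r.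
  by rewrite lerDl; apply: Rintegral_ge0 => x _.
rewrite /hbar (Rintegral_ray_compl (z + al) ih).
rewrite [X in _ + X](_ : _ = 0) ?addr0.
  apply: Rintegral_ray_le => //; first exact: integrable_gdens.
  by move=> x; rewrite ler_piMl ?gdens_ge0//; have /andP[] := ramp01 z al x.
rewrite (_ : 0 = (\int[mu]_(x in `]z + al, +oo[) (0 : R))%R); last first.
  by rewrite /Rintegral integral0.
apply: eq_Rintegral => x; rewrite inE /= in_itv /= andbT => /ltW xz.
by rewrite ramp_right// mul0r.
Qed.

End HbarBounds.

(** * From Taylor estimates to the Kolmogorov distance *)

Section KolmogorovBound.
Import numFieldNormedType.Exports.
Context {R : realType} {d : measure_display} {T : measurableType d}.
Variables (P : probability T R) (Y G : T -> R) (m s B Dl : R).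
Hypothesis bY : forall f : R -> R, bmf (fun w => f (Y w)).
Hypothesis bG : bmf G.
Hypotheses (m_gt0 : 0 < m) (s_gt0 : 0 < s) (B_gt0 : 0 < B) (Dl_ge0 : 0 <= Dl).
Hypothesis Y_mean : Ex P Y = m.
Hypothesis Y_var : Ex P (fun w => (Y w - m) ^+ 2) = s ^+ 2.
Hypothesis G_var : Ex P (fun w => G w ^+ 2) - Ex P G ^+ 2 <= Dl ^+ 2.
Hypothesis G_bound : forall w, `|G w| <= B.
(** The trace of the coupling in this abstract setting, with [G] in the role of the drift. *)
Hypothesis Y_taylor : forall f f' K : R -> R,
  (forall x y : R, `|y - x| <= B ->
     `|f y - f x - (y - x) * f' x| <= K x * (y - x) ^+ 2 / 2) ->
  `|Ex P (fun w => (Y w - m) * f (Y w)) - m * Ex P (fun w => f' (Y w) * G w)|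
    <= m * (B ^+ 2 / 2) * Ex P (fun w => K (Y w)).

Local Notation W w := ((Y w - m) / s).
Local Notation a := (m * B ^+ 2 / s ^+ 3).
Local Notation eps := (m * Dl / s ^+ 2).
Local Notation del := (B / s).

Definition std_cdf (t : R) : R := Ex P (fun w => ((W w <= t)%R)%:R).

Let bW (f : R -> R) : bmf (fun w => f (W w)).
Proof. exact: (bY (fun y => f ((y - m) / s))). Qed.

Let s_neq0 : s != 0. Proof. exact: lt0r_neq0. Qed.

Let G_mean : m * Ex P G = s ^+ 2.
Proof.
(* The identity function has no Taylor remainder, so [K = 0] is allowed and the estimate becomes an
   equality. *)
have := @Y_taylor id (fun=> 1) (fun=> 0).
have h0 (x y : R) : `|y - x| <= B -> `|y - x - (y - x) * 1| <= 0 * (y - x) ^+ 2 / 2.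
  by move=> _; rewrite mulr1 subrr normr0 mul0r mul0r.
move=> /(_ h0); rewrite Ex_cst mulr0 normr_le0 subr_eq0 => /eqP e.
rewrite (_ : Ex P G = Ex P (fun w => 1 * G w)); last by apply: eq_Ex => w; rewrite mul1r.
rewrite -e -Y_var.
have bZ : bmf (fun w => m * (Y w - m)) by exact: (bY (fun y => m * (y - m))).
have -> : Ex P (fun w => (Y w - m) * Y w) =
   Ex P (fun w => (Y w - m) ^+ 2 + m * (Y w - m)).
  by apply: eq_Ex => w; ring.
rewrite ExD//; last exact: (bY (fun y => (y - m) ^+ 2)).
rewrite ExZ; last exact: (bY (fun y => y - m)).
by rewrite ExB ?Y_mean ?Ex_cst ?subrr ?mulr0 ?addr0//; [exact: (bY id)|exact: bmf_cst].
Qed.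

(** [s^2 = m E[G] <= m B], so the standardised step [del] can be absorbed into [a]. *)
Lemma del_le : del <= a.
Proof.
have : s ^+ 2 <= m * B.
  rewrite -G_mean ler_pM2l//; have := Ex_bound P bG G_bound.
  by rewrite ler_norml => /andP[].
move=> h; have -> : a = del * (m * B / s ^+ 2) by field.
have d0 : 0 <= del by rewrite divr_ge0// ltW.
have h1 : 1 <= m * B / s ^+ 2 by rewrite ler_pdivlMr ?exprn_gt0// mul1r.
by rewrite ler_peMr.
Qed.

Lemma abs_dev_le1 : Ex P (fun w => `|W w|) <= 1.
Proof.
have b1 := bW (fun x => `|x|).
have h : Ex P (fun w => `|W w| ^+ 2) = 1.
  have -> : Ex P (fun w => `|W w| ^+ 2) = Ex P (fun w => s ^- 2 * (Y w - m) ^+ 2).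
    by apply: eq_Ex => w; rewrite real_normK ?num_real// exprMn mulrC exprVn.
  rewrite ExZ ?Y_var; first by rewrite mulVf// expf_neq0.
  exact: (bY (fun y => (y - m) ^+ 2)).
have := Ex_sqr_le P b1; rewrite h => h2.
rewrite -(@ler_pXn2r _ 2) ?nnegrE ?ler01 ?expr1n//.
by apply: Ex_ge0 => w.
Qed.

(** The variable is centred because [m E[G] = s^2]; its mean absolute value is at most its standard
    deviation, which is [m / s^2] times that of [G]. *)
Lemma drift_dev : Ex P (fun w => `|1 - m / s ^+ 2 * G w|) <= eps.
Proof.
have bD : bmf (fun w => 1 - m / s ^+ 2 * G w).
  by apply: bmfB; [exact: bmf_cst|exact: bmfZ].
have e0 : 0 <= eps by rewrite divr_ge0 ?mulr_ge0 ?sqr_ge0// ltW.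
rewrite -(@ler_pXn2r _ 2) ?nnegrE//; last by apply: Ex_ge0 => w.
apply: (le_trans (Ex_sqr_le P (bmf_norm bD))).
under eq_Ex do rewrite real_normK ?num_real//.
have b2 := bmfX 2 bG.
have -> : Ex P (fun w => (1 - m / s ^+ 2 * G w) ^+ 2) =
   (m / s ^+ 2) ^+ 2 * (Ex P (fun w => G w ^+ 2) - Ex P G ^+ 2).
  have -> : Ex P (fun w => (1 - m / s ^+ 2 * G w) ^+ 2) =
     Ex P (fun w => 1 - 2 * (m / s ^+ 2) * G w + (m / s ^+ 2) ^+ 2 * G w ^+ 2).
    by apply: eq_Ex => w; ring.
  rewrite ExD ?ExB ?Ex_cst ?ExZ//; try by [exact: bmfZ|exact: bmf_cst].
    have -> : Ex P G = s ^+ 2 / m by rewrite -G_mean mulrC mulKf// gt_eqF.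
    by field; rewrite s_neq0 gt_eqF.
  by apply: bmfB; [exact: bmf_cst|exact: bmfZ].
rewrite (_ : eps ^+ 2 = (m / s ^+ 2) ^+ 2 * Dl ^+ 2); last by rewrite mulrAC exprMn.
by rewrite ler_wpM2l// sqr_ge0.
Qed.

Lemma ramp_bound (D z al : R) : (forall t, `|std_cdf t - gcdf t| <= D) -> 0 < al ->
  `|Ex P (fun w => ramp z al (W w)) - hbar (ramp z al)| <=
    eps + a / 2 * (3 + (2 * D + (al + 2 * del) / 2) / al).
Proof.
move=> HD al0; have del0 : 0 < del by rewrite divr_gt0.
pose h := ramp z al; pose f := solution h; pose f' := solution' h.
have h01 (x : R) : 0 <= h x <= 1 by exact: ramp01.
have hc : continuous h by exact: ramp_continuous.
have df (x : R) : is_derive x 1 f (f' x) by exact: is_derive_solution.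
have f'1 (x : R) : `|f' x| <= 1 by exact: solution'_bound.
have f2 (x : R) : `|f x| <= 2 by exact: solution_bound.
pose I (x : R) : R := ((z - del < x <= z + al + del)%R)%:R.
(* Stein's equation gives [f' s0 - f' x = (s0 - x) f s0 + x (f s0 - f x) + (h s0 - h x)]. The
   summands of [K] bound these in turn, using 2 for [f], 1 for [f'] and slope [1 / al] for the ramp;
   the last is present only when [x] is within [del] of the sloping part. *)
pose K (x : R) : R := 2 + `|x| + al^-1 * I x.
have flip (x y : R) : `|f y - f x| <= `|y - x|.
  exact: lipschitz_of_derive.
have hI (x y : R) : `|y - x| <= del -> `|h y - h x| <= al^-1 * I x * `|y - x|.
  move=> yx; rewrite /I; case: (boolP (_ && _)) => [_|]; first by rewrite mulr1 mulrC; exact: ramp_lipschitz.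
  rewrite mulr0 mul0r normr_le0 subr_eq0 negb_and -leNgt -ltNge => /orP[xz|zx].
    have hx : h x = 1 by apply: ramp_left => //; lra.
    have hy : h y = 1.
      by apply: ramp_left => //; move: yx; rewrite ler_norml => /andP[_ ?]; lra.
    by rewrite hx hy.
  have hx : h x = 0 by apply: ramp_right => //; lra.
  have hy : h y = 0.
    by apply: ramp_right => //; move: yx; rewrite ler_norml => /andP[? _]; lra.
  by rewrite hx hy.
have tay (x y : R) : `|y - x| <= del -> `|f y - f x - (y - x) * f' x| <= K x * (y - x) ^+ 2 / 2.
  move=> yx; apply: taylor_two => // s0 s0x.
  have s0d := le_trans s0x yx.
  have -> : f' s0 - f' x = (s0 - x) * f s0 + x * (f s0 - f x) + (h s0 - h x).
    by rewrite /f' /solution' -/f; ring.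
  apply: (le_trans (ler_normD _ _)); apply: (le_trans (lerD (ler_normD _ _) (lexx _))).
  rewrite /K [leRHS]mulrDl [X in _ <= X + _]mulrDl; apply: lerD; last exact: hI.
  by apply: lerD; rewrite normrM; [rewrite mulrC ler_wpM2r|rewrite ler_wpM2l].
have tayY (x y : R) : `|y - x| <= B ->
   `|f ((y - m) / s) - f ((x - m) / s) - (y - x) * (f' ((x - m) / s) / s)|
    <= K ((x - m) / s) / s ^+ 2 * (y - x) ^+ 2 / 2.
  move=> yx.
  have e : (y - m) / s - (x - m) / s = (y - x) / s by field.
  have := tay ((x - m) / s) ((y - m) / s); rewrite e normrM normfV (gtr0_norm s_gt0).
  rewrite ler_pM2r ?invr_gt0// => /(_ yx).
  have -> : (y - x) / s * f' ((x - m) / s) = (y - x) * (f' ((x - m) / s) / s) by ring.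
  by congr (_ <= _); rewrite exprMn exprVn; field.
have := Y_taylor tayY.
have bfW := bW f; have bf'G : bmf (fun w => f' (W w) * G w) by apply: bmfM => //; exact: bW.
have -> : Ex P (fun w => (Y w - m) * f (W w)) = s * Ex P (fun w => W w * f (W w)).
  rewrite -ExZ; last exact: (bW (fun x => x * f x)).
  by apply: eq_Ex => w; field.
have -> : Ex P (fun w => f' (W w) / s * G w) = s^-1 * Ex P (fun w => f' (W w) * G w).
  by rewrite -ExZ//; apply: eq_Ex => w; ring.
have -> : Ex P (fun w => K (W w) / s ^+ 2) = s ^- 2 * Ex P (fun w => K (W w)).
  by rewrite -ExZ; [apply: eq_Ex => w; rewrite mulrC|exact: bW].
have EK : Ex P (fun w => K (W w)) <= 3 + (2 * D + (al + 2 * del) / 2) / al.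
  rewrite /K ExD; last 2 first.
  - exact: (bW (fun x => 2 + `|x|)).
  - exact: (bW (fun x => al^-1 * I x)).
  rewrite ExD; last 2 first.
  - exact: bmf_cst.
  - exact: (bW Num.norm).
  rewrite Ex_cst; apply: lerD; first by have := abs_dev_le1; lra.
  rewrite ExZ; last exact: (bW I).
  rewrite mulrC ler_wpM2r ?invr_ge0 ?(ltW al0)//.
  (* The probability of this window, of length [al + 2 * del], is a difference of two distribution
     values, each within [D] of the normal one: here the Kolmogorov distance returns. *)
  have -> : Ex P (fun w => I (W w)) = std_cdf (z + al + del) - std_cdf (z - del).
    rewrite /std_cdf -ExB; last 2 first.
    - exact: (bW (fun x => ((x <= z + al + del)%R)%:R)).
    - exact: (bW (fun x => ((x <= z - del)%R)%:R)).
    apply: eq_Ex => w; rewrite /I ltNge.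
    case: (leP (W w) (z - del)) => h1 /=; last by rewrite subr0.
    by rewrite (_ : W w <= z + al + del) ?subrr//; lra.
  have ab : z - del <= z + al + del by lra.
  have := gcdfB_le_half ab.
  have := HD (z + al + del); have := HD (z - del).
  by rewrite !ler_norml => /andP[? ?] /andP[? ?]; lra.
set A := Ex P (fun w => W w * f (W w)); set C := Ex P (fun w => f' (W w) * G w).
set E := Ex P (fun w => K (W w)) in EK *.
move=> HA.
have HA' : `|A - m / s ^+ 2 * C| <= a / 2 * E.
  rewrite -(ler_pM2l s_gt0) -{1}(gtr0_norm s_gt0) -normrM.
  have -> : s * (A - m / s ^+ 2 * C) = s * A - m * (s^-1 * C) by field.
  by apply: (le_trans HA); rewrite le_eqVlt; apply/orP; left; apply/eqP; field.
have -> : Ex P (fun w => ramp z al (W w)) - hbar (ramp z al) =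
    Ex P (fun w => f' (W w) * (1 - m / s ^+ 2 * G w)) + (m / s ^+ 2 * C - A).
  rewrite /C /A -ExZ// -ExB; last 2 first.
  - exact: bmfZ.
  - exact: (bW (fun x => x * f x)).
  rewrite -ExD; last 2 first.
  - apply: bmfM; first exact: bW.
    by apply: bmfB; [exact: bmf_cst|exact: bmfZ].
  - by apply: bmfB; [exact: bmfZ|exact: (bW (fun x => x * f x))].
  rewrite -[hbar _](Ex_cst P) -ExB; last 2 first.
  - exact: (bW h).
  - exact: bmf_cst.
  by apply: eq_Ex => w; rewrite /f' /solution' -/f -/h; ring.
apply: (le_trans (ler_normD _ _)); apply: lerD; last first.
  rewrite distrC; apply: (le_trans HA').
  by rewrite ler_wpM2l// !divr_ge0 ?mulr_ge0 ?exprn_ge0 ?ltW.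
have bD : bmf (fun w => 1 - m / s ^+ 2 * G w).
  by apply: bmfB; [exact: bmf_cst|exact: bmfZ].
have bfD : bmf (fun w => f' (W w) * (1 - m / s ^+ 2 * G w)).
  by apply: bmfM => //; exact: bW.
apply: (le_trans (Ex_norm P bfD)); apply: le_trans drift_dev.
apply: Ex_le; [exact: bmf_norm|exact: bmf_norm|move=> w].
by rewrite normrM ler_piMl.
Qed.

(** The indicator of [x <= t] lies between the ramps that start to descend at [t - al] and at [t];
    their normal means differ from [gcdf t] by at most [al / 2]. *)
Lemma smoothing_bound (D t al : R) : (forall t, `|std_cdf t - gcdf t| <= D) -> 0 < al ->
  `|std_cdf t - gcdf t| <= al / 2 + eps + 7 / 4 * a + (a ^+ 2 / 2 + a * D) / al.
Proof.
move=> HD al0.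
have a0 : 0 < a by rewrite divr_gt0 ?mulr_gt0 ?exprn_gt0.
have slack : a / 2 * (3 + (2 * D + (al + 2 * del) / 2) / al) <=
    7 / 4 * a + (a ^+ 2 / 2 + a * D) / al.
  have -> : a / 2 * (3 + (2 * D + (al + 2 * del) / 2) / al) =
     7 / 4 * a + (a * del / 2 + a * D) / al by field; rewrite s_neq0 gt_eqF.
  rewrite lerD2l ler_pM2r ?invr_gt0// lerD2r ler_pM2r ?invr_gt0// expr2 ler_pM2l//.
  exact: del_le.
have step z := ramp_bound z HD al0.
have mono (k1 k2 : R -> R) : (forall x, k1 x <= k2 x) ->
    Ex P (fun w => k1 (W w)) <= Ex P (fun w => k2 (W w)).
  by move=> k12; apply: Ex_le => [||w]; [exact: bW|exact: bW|exact: k12].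
have up : std_cdf t <= Ex P (fun w => ramp t al (W w)).
  apply: (mono (fun x => ((x <= t)%R)%:R) (ramp t al)) => x; case: (leP x t) => xt.
    by rewrite ramp_left.
  by have /andP[] := ramp01 t al x.
have lo : Ex P (fun w => ramp (t - al) al (W w)) <= std_cdf t.
  apply: (mono (ramp (t - al) al) (fun x => ((x <= t)%R)%:R)) => x; case: (leP x t) => xt.
    by have /andP[] := ramp01 (t - al) al x.
  by rewrite ramp_right// subrK ltW.
have /andP[b1 b2] := hbar_ramp_bounds t al0.
have /andP[b3 b4] := hbar_ramp_bounds (t - al) al0; rewrite subrK in b4.
have l1 : t <= t + al by rewrite lerDl ltW.
have l2 : t - al <= t by rewrite gerBl ltW.
have := gcdfB_le_half l1; have := gcdfB_le_half l2.
have := step t; have := step (t - al); rewrite !ler_norml => /andP[? ?] /andP[? ?] ? ?.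
by apply/andP; split; lra.
Qed.

Lemma std_cdf01 t : 0 <= std_cdf t <= 1.
Proof.
have b : bmf (fun w => ((W w <= t)%R)%:R : R) by exact: (bW (fun x => ((x <= t)%R)%:R)).
apply/andP; split; first by apply: Ex_ge0 => w.
rewrite -[leRHS](Ex_cst P 1); apply: Ex_le => //; first exact: bmf_cst.
by move=> w; rewrite lern1; case: (_ <= _).
Qed.

(** The recursion is applied to the supremum of the deviations itself. Expanding the square recovers
    [3 a + eps + 4/5 q]: [(11 + 4) / 5] gives 3, [5 Dl] gives [eps], and the cross term gives
    [4/5 q]. *)
Theorem size_bias_kolmogorov t : `|std_cdf t - gcdf t| <=
  m / (5 * s ^+ 2) * (Num.sqrt (11 * B ^+ 2 / s + 5 * Dl) + 2 * B / Num.sqrt s) ^+ 2.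
Proof.
set X := 11 * B ^+ 2 / s + 5 * Dl; set r := Num.sqrt s; set x := Num.sqrt X.
have X0 : 0 < X by rewrite ltr_pwDl ?mulr_ge0// divr_gt0// mulr_gt0// exprn_gt0.
have x0 : 0 < x by rewrite sqrtr_gt0.
have r0 : 0 < r by rewrite sqrtr_gt0.
have x2 : x ^+ 2 = X by rewrite sqr_sqrtr// ltW.
have r2 : r ^+ 2 = s by rewrite sqr_sqrtr// ltW.
have a0 : 0 < a by rewrite divr_gt0 ?mulr_gt0 ?exprn_gt0.
have e0 : 0 <= eps by rewrite divr_ge0 ?mulr_ge0 ?exprn_ge0// ltW.
pose q := m / s ^+ 2 * (B / r) * x.
have q0 : 0 < q by rewrite !mulr_gt0 ?invr_gt0 ?exprn_gt0.
have q2 : q ^+ 2 = a * (11 * a + 5 * eps).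
  have -> : q ^+ 2 = (m / s ^+ 2) ^+ 2 * (B ^+ 2 / r ^+ 2) * x ^+ 2.
    by rewrite /q; field; rewrite s_neq0 gt_eqF.
  by rewrite r2 x2 /X; field.
have -> : m / (5 * s ^+ 2) * (x + 2 * B / r) ^+ 2 = 3 * a + eps + 4 / 5 * q.
  have -> : m / (5 * s ^+ 2) * (x + 2 * B / r) ^+ 2 =
     m / (5 * s ^+ 2) * (x ^+ 2 + 4 * B ^+ 2 / r ^+ 2) + 4 / 5 * q.
    by rewrite /q; field; rewrite gt_eqF.
  by rewrite x2 r2 /X; field.
pose S := [set `|std_cdf t - gcdf t| | t in [set: R]].
have subS : has_sup S.
  split; first by exists `|std_cdf 0 - gcdf 0|, 0.
  exists 1 => _ [u _ <-]; have := std_cdf01 u; have := gcdf_ge0 u.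
  have := gcdf_add_gtail u; have := gtail_ge0 u.
  by move=> ? ? ? /andP[? ?]; rewrite ler_norml; lra.
have HD u : `|std_cdf u - gcdf u| <= sup S.
  by apply: ub_le_sup; [case: subS|exists u].
apply: (le_trans (HD t)); apply: (kolmogorov_recursion a0 e0 q0 q2) => al al0.
apply: ge_sup; first by case: subS.
by move=> _ [u _ <-]; exact: smoothing_bound.
Qed.

End KolmogorovBound.

(** * Volumes of Euclidean and toroidal balls *)

Section AffineChange.
Context {R : realType}.
Local Notation mu := (@lebesgue_measure R).
Implicit Types (a b c x y : R).

Let affine a c (x : measurableTypeR R) : measurableTypeR R := (c * x + a)%R.

Let measurable_affine a c : measurable_fun setT (affine a c).
Proof. by apply: measurable_funD => //; exact: measurable_funM. Qed.

Lemma lebesgue_affine a c (A : set R) : 0 < c -> measurable A ->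
  mu A = (c%:E * mu ((fun x => c * x + a)%R @^-1` A))%E.
Proof.
move=> c0 mA; have cnn : (0 <= c) by exact: ltW.
pose push_ : {measure set (measurableTypeR R) -> \bar R} := pushforward mu (affine a c).
pose push := push_ (measurable_affine a c).
pose m2 : {measure set (measurableTypeR R) -> \bar R} := mscale (NngNum cnn) push.
rewrite -[RHS]/(m2 A); apply: lebesgue_measure_unique mA => _ [[x y] _ <-].
rewrite /m2 /= /mscale /= /push /push_ /= /pushforward /=.
have -> : affine a c @^-1` `]x, y] = `](x - a) / c, (y - a) / c]%classic.
  apply/seteqP; split => u /=; rewrite !in_itv /= /affine ltr_pdivrMr// ler_pdivlMr// ?ltrBlDr ?lerBrDr mulrC//.
rewrite !lebesgue_measure_itv /= !lte_fin ltr_pM2r ?invr_gt0// ltrD2r.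
case: ifPn => xy; last by rewrite mule0.
by rewrite -EFinB -EFinM; congr EFin; field; rewrite gt_eqF.
Qed.

Lemma integral_affine a c (f : R -> R) : 0 < c -> measurable_fun setT f ->
  (forall x, 0 <= f x) ->
  (\int[mu]_x (f x)%:E = c%:E * \int[mu]_x (f (c * x + a))%:E)%E.
Proof.
move=> c0 mf f0; have cnn : (0 <= c) by exact: ltW.
pose push_ : {measure set (measurableTypeR R) -> \bar R} := pushforward mu (affine a c).
pose push := push_ (measurable_affine a c).
pose m2 : {measure set (measurableTypeR R) -> \bar R} := mscale (NngNum cnn) push.
rewrite (@eq_measure_integral _ _ _ _ m2); last first.
  by move=> A mA _; exact: lebesgue_affine.
have mEf : measurable_fun setT (EFin \o f) by exact/measurable_EFinP.
rewrite ge0_integral_mscale//; last by move=> x _; rewrite lee_fin.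
congr (_ * _)%E.
rewrite (@ge0_integral_pushforward _ _ _ _ _ (affine a c) (measurable_affine a c) mu setT (EFin \o f))//.
by move=> x _; rewrite /= lee_fin.
Qed.

Lemma integral_indic_mul (A : set R) (f : R -> R) :
  (\int[mu]_(x in A) (f x)%:E = \int[mu]_x (f x * \1_A x)%:E)%E.
Proof.
rewrite integral_mkcond; apply: eq_integral => x _.
by rewrite patchE indicE; case: ifP => _; rewrite ?mulr1 ?mulr0.
Qed.

Lemma integral_shift a (A : set R) (f : R -> R) : measurable A ->
  measurable_fun setT f -> (forall x, 0 <= f x) ->
  (\int[mu]_(x in A) (f x)%:E =
   \int[mu]_(x in (fun x => x + a)%R @^-1` A) (f (x + a))%:E)%E.
Proof.
move=> mA mf f0; rewrite [LHS]integral_indic_mul [RHS]integral_indic_mul.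
rewrite (@integral_affine a 1 (fun x => f x * \1_A x))//.
- rewrite mul1e; apply: eq_integral => x _; rewrite mul1r.
  by congr (_ * _)%:E; rewrite !indicE; congr (nat_of_bool _)%:R; apply/idP/idP; rewrite !inE.
- by apply: measurable_funM => //; exact: measurable_indic.
- by move=> x; rewrite mulr_ge0// indicE.
Qed.

Lemma itvco_shift a b c : (fun x : R => x + c) @^-1` `[a + c, b + c[ = `[a, b[%classic.
Proof. by apply/seteqP; split => x /=; rewrite !in_itv /= lerD2r ltrD2r. Qed.

Lemma integral_itvco_cat a b c (f : R -> R) : a <= b -> b <= c ->
  measurable_fun setT f -> (forall x, 0 <= f x) ->
  (\int[mu]_(x in `[a, c[) (f x)%:E =
   \int[mu]_(x in `[a, b[) (f x)%:E + \int[mu]_(x in `[b, c[) (f x)%:E)%E.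
Proof.
move=> ab bc mf f0; rewrite -ge0_integral_setU//=.
- congr (integral _ _ _); apply/seteqP; split => x /=; rewrite !in_itv /=.
    by move=> /andP[ax xc]; case: (ltP x b) => xb; [left|right]; apply/andP.
  move=> [/andP[ax xb]|/andP[bx xc]]; apply/andP; split=> //.
    exact: lt_le_trans bc.
  exact: le_trans bx.
- exact/measurable_EFinP/measurable_funTS.
- by move=> x _; rewrite lee_fin.
- apply/disj_setPS => x /=; rewrite !in_itv /= => -[/andP[_ xb] /andP[bx _]].
  by move: (lt_le_trans xb bx); rewrite ltxx.
Qed.

(** After a shift by whole periods the interval is [[b, b + s)] with [0 <= b < s]. It shares
    [[b, s)] with [[0, s)], and the remaining pieces differ by one period. *)
Lemma integral_periodic a (s : R) (f : R -> R) : 0 < s ->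
  measurable_fun setT f -> (forall x, 0 <= f x) ->
  (forall x (z : int), f (x + s * z%:~R) = f x) ->
  (\int[mu]_(x in `[a, (a + s)%R[) (f x)%:E = \int[mu]_(x in `[0%R, s[) (f x)%:E)%E.
Proof.
move=> s0 mf f0 fper.
have sh (b c : R) (z : int) : (\int[mu]_(x in `[(b + s * z%:~R)%R, (c + s * z%:~R)%R[) (f x)%:E =
    \int[mu]_(x in `[b, c[) (f x)%:E)%E.
  rewrite (integral_shift (s * z%:~R))// itvco_shift.
  by apply: eq_integral => x _; rewrite fper.
have [N [b [ab b0 bs]]] : exists (N : int) (b : R), [/\ a = b + s * N%:~R, 0 <= b & b < s].
  exists (Num.floor (a / s)), (a - s * (Num.floor (a / s))%:~R); rewrite subrK.
  have /andP[h1 h2] := floor_itv (a / s).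
  rewrite ler_pdivlMr// in h1; rewrite ltr_pdivrMr// intrD in h2.
  by split=> //; [rewrite subr_ge0 mulrC|rewrite ltrBlDr; lra].
rewrite ab -addrA [s * _ + s]addrC addrA sh.
rewrite (@integral_itvco_cat b s (b + s))//; [|exact: ltW|by rewrite lerDr].
rewrite [in RHS](@integral_itvco_cat 0 b s)//; last exact: ltW.
rewrite addeC; congr (_ + _)%E.
by have := sh 0 b 1; rewrite mulr1 add0r.
Qed.

End AffineChange.

(** * Squared distance to 0 on a circle of length [s] *)

Section SquaredCircleDistance.
Context {R : realType}.
Variable s : R.
Hypothesis s_gt0 : 0 < s.
Implicit Types t : R.

Definition nearest t : int := Num.floor (t / s + 2^-1).

Definition qdist t : R := (t - s * (nearest t)%:~R) ^+ 2.

Lemma nearest_itv t : - (s / 2) <= t - s * (nearest t)%:~R < s / 2.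
Proof.
have /andP[] := floor_itv (t / s + 2^-1); rewrite -/(nearest t) intrD.
move: (nearest t)%:~R => N.
rewrite -lerBlDr ler_pdivlMr// => h1; rewrite -ltrBrDr ltr_pdivrMr// => h2.
by apply/andP; split; nra.
Qed.

Lemma qdist_min t (z : int) : qdist t <= (t + s * z%:~R) ^+ 2.
Proof.
rewrite /qdist; have /andP[] := nearest_itv t.
pose k := (z + nearest t)%R.
have -> : t + s * z%:~R = t - s * (nearest t)%:~R + s * k%:~R by rewrite /k intrD; ring.
move: (t - _) k => u k h1 h2.
have [->|[k1|k1]] : k = 0 \/ (1 <= k \/ k <= -1) by lia.
- by rewrite mulr0 addr0.
- have k1R : 1 <= k%:~R :> R by rewrite ler1z.
  have : s <= s * k%:~R by rewrite ler_peMr// ltW.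
  move: (s * _) => x sx; have : 0 <= x * (2 * u + x) by rewrite mulr_ge0//; lra.
  by rewrite !expr2; lra.
have k1R : k%:~R <= -1 :> R by rewrite -[-1]/((-1)%:~R) ler_int.
have : s * k%:~R <= - s by rewrite -[leRHS]mulrN1 ler_pM2l.
move: (s * _) => x sx; have : 0 <= x * (2 * u + x) by rewrite mulr_le0//; lra.
by rewrite !expr2; lra.
Qed.

Lemma qdist_per t (z : int) : qdist (t + s * z%:~R) = qdist t.
Proof.
apply/eqP; rewrite eq_le; apply/andP; split.
  rewrite /qdist -/(qdist _).
  have := qdist_min (t + s * z%:~R) (- (z + nearest t)).
  by rewrite intrN intrD /qdist; congr (_ <= _ ^+ 2); ring.
have := qdist_min t (z - nearest (t + s * z%:~R)).
by rewrite intrB {3}/qdist; congr (_ <= _ ^+ 2); ring.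
Qed.

Lemma qdistN t : qdist (- t) = qdist t.
Proof.
suff h u : qdist (- u) <= qdist u by apply/eqP; rewrite eq_le h -{1}[t]opprK h.
have := qdist_min (- u) (nearest u).
by rewrite {3}/qdist; congr (_ <= _); ring.
Qed.

Lemma qdist_sqr t : - (s / 2) <= t < s / 2 -> qdist t = t ^+ 2.
Proof.
move=> /andP[h1 h2]; rewrite /qdist (_ : nearest t = 0) ?mulr0 ?subr0//.
apply: floor_def; rewrite add0r -lerBlDr ler_pdivlMr// -ltrBrDr ltr_pdivrMr//.
by apply/andP; split; lra.
Qed.

Lemma qdist_ge0 t : 0 <= qdist t. Proof. exact: sqr_ge0. Qed.

Lemma measurable_qdist : measurable_fun setT qdist.
Proof.
apply: measurable_funX; apply: measurable_funB => //; apply: measurable_funM => //.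
apply: nondecreasing_measurable => // x y xy.
by rewrite ler_int /nearest; apply: le_floor; rewrite lerD2r ler_pM2r ?invr_gt0.
Qed.

End SquaredCircleDistance.

(** * Volumes of sublevel sets of sums over coordinates *)

Section SumBalls.
Context {R : realType}.
Local Notation mu := (@lebesgue_measure R).

(* Volume of [{y in D^k | sum_j w (y_j) <= t}], one coordinate at a time. *)
Fixpoint sumvol (D : set R) (w : R -> R) (k : nat) (t : R) : R :=
  if k is k'.+1 then (\int[mu]_(y in D) sumvol D w k' (t - w y))%R
  else ((0 <= t)%R)%:R.

Section Properties.
Variables (D : set R) (w : R -> R).
Hypothesis mD : measurable D.
Hypothesis mw : measurable_fun setT w.
Hypothesis w_ge0 : forall y, 0 <= w y.
Hypothesis fin : forall t, (mu (D `&` [set y | (w y <= t)%R]) < +oo)%E.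

Lemma sumvol_ge0 k t : 0 <= sumvol D w k t.
Proof. by case: k => [|k] /=; [exact: ler0n|apply: Rintegral_ge0 => y _; elim: k (t - w y)%R => [|k IH] u /=; [exact: ler0n|apply: Rintegral_ge0]]. Qed.

Let msub : forall t, measurable (D `&` [set y | (w y <= t)%R]).
Proof.
move=> t; apply: measurableI => //.
rewrite (_ : [set y | _] = w @^-1` `]-oo, t]); last first.
  by apply/seteqP; split => y /=; rewrite in_itv.
by rewrite -[X in measurable X]setTI; exact: mw.
Qed.

(** The integrand vanishes outside the sublevel set of [w] at height [t], which has finite measure
    in [D], and is at most [sumvol D w k t] on it. *)
Let integrable_sub k : {homo sumvol D w k : t u / t <= u} ->
  (forall t, t < 0 -> sumvol D w k t = 0) ->
  forall t, mu.-integrable D (EFin \o (fun y => sumvol D w k (t - w y))).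
Proof.
move=> mono zero t; pose E := D `&` [set y | (w y <= t)%R].
have iE : mu.-integrable D (EFin \o (fun y => sumvol D w k t * \1_E y)).
  rewrite (_ : _ \o _ = fun y => ((sumvol D w k t)%:E * (\1_E y)%:E)%E); last first.
    by apply/funext => y /=; rewrite EFinM.
  apply: integrableZl => //; apply/integrableP; split.
    by apply/measurable_EFinP/measurable_indic; exact: msub.
  have -> : (\int[mu]_(x in D) `|(\1_E x)%:E| = \int[mu]_(x in D) (\1_E x)%:E)%E.
    by apply: eq_integral => x _; rewrite /= ger0_norm// indicE.
  by rewrite integral_indic//; [rewrite /E setIAC setIid; exact: fin|exact: msub].
apply: le_integrable iE => //.
  apply/measurable_EFinP/measurable_funTS.
  apply: (measurableT_comp (f := sumvol D w k)); last exact: measurable_funB.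
  exact: nondecreasing_measurable.
move=> y Dy /=; have i0 : 0 <= \1_E y :> R by rewrite indicE ler0n.
have c0 := sumvol_ge0 k t; have c1 := sumvol_ge0 k (t - w y).
rewrite lee_fin (ger0_norm c1) (ger0_norm (mulr_ge0 c0 i0)).
rewrite indicE; case: (leP (w y) t) => wyt.
  rewrite mem_set// mulr1; apply: mono; rewrite gerBl; exact: w_ge0.
by rewrite zero ?mulr_ge0// subr_lt0.
Qed.

Lemma sumvol_props k :
  {homo sumvol D w k : t u / t <= u} /\ (forall t, t < 0 -> sumvol D w k t = 0).
Proof.
elim: k => [|k [mono zero]].
  split=> [t u tu|t t0] /=; last by rewrite leNgt t0.
  by rewrite ler_nat; case: (leP 0 t) => // t0; rewrite (le_trans t0 tu).
have int := integrable_sub mono zero.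
split=> [t u tu|t t0] /=.
  by apply: le_Rintegral => // y _; apply: mono; rewrite lerD2r.
rewrite (_ : 0 = (\int[mu]_(y in D) (0 : R))%R); last by rewrite /Rintegral integral0.
by apply: eq_Rintegral => y _; apply: zero; rewrite (le_lt_trans _ t0)// gerBl.
Qed.

Lemma sumvol_mono k : {homo sumvol D w k : t u / t <= u}.
Proof. by case: (sumvol_props k). Qed.

Lemma sumvol_lt0 k t : t < 0 -> sumvol D w k t = 0.
Proof. by case: (sumvol_props k) => _; apply. Qed.

Lemma measurable_sumvol k : measurable_fun setT (sumvol D w k).
Proof. by apply: nondecreasing_measurable => //; exact: sumvol_mono. Qed.

Lemma integrable_sumvol k t : mu.-integrable D (EFin \o (fun y => sumvol D w k (t - w y))).
Proof. by apply: integrable_sub; [exact: sumvol_mono|exact: sumvol_lt0]. Qed.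

Lemma EFin_sumvol k t :
  (sumvol D w k.+1 t)%:E = (\int[mu]_(y in D) (sumvol D w k (t - w y))%:E)%E.
Proof. by rewrite /= fineK//; apply: integrable_fin_num => //; exact: integrable_sumvol. Qed.

End Properties.

Lemma vol_set0 (d : nat) : vol (set0 : set (d.-tuple R)) = 0%E.
Proof.
elim: d => [|d IH] /=; first by rewrite diracE in_set0.
apply: integral0_eq => x _.
by rewrite (_ : [set y | _] = set0) ?IH//; apply/seteqP.
Qed.

(** Follows the recursion of [vol]: the section at first coordinate [y] is a set of the same kind in
    one dimension less, with [t] reduced by [w x0 y]. [PhiS] demands that the one-dimensional
    integral be the same for every coordinate [x0] of the centre. *)
Lemma vol_sumball (D : set R) (w : R -> R -> R) (Phi : nat -> R -> R) (d : nat)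
    (x : d.-tuple R) (t : R) :
  (forall u, Phi 0%N u = ((0 <= u)%R)%:R) ->
  (forall k u x0, (\int[mu]_(y in D) (Phi k (u - w x0 y)%R)%:E = (Phi k.+1 u)%:E)%E) ->
  vol [set y : d.-tuple R | (forall j, D (tnth y j)) /\
        \sum_j w (tnth x j) (tnth y j) <= t] = (Phi d t)%:E.
Proof.
move=> Phi0 PhiS; elim: d x t => [|d IH] x t.
  rewrite Phi0 /= diracE; congr (_%:R)%:E; congr nat_of_bool.
  apply/idP/idP; rewrite inE /= big_ord0; first by case.
  by move=> t0; split=> // -[].
have xS j : tnth x (lift ord0 j) = tnth [tuple of behead x] j.
  by rewrite {1}(tuple_eta x) tnthS.
rewrite /= -(PhiS _ _ (tnth x ord0)) [RHS]integral_mkcond; apply: eq_integral => y _; rewrite patchE.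
case: ifPn => [|]; rewrite ?inE ?notin_setE => Dy; last first.
  rewrite (_ : [set y0 | _] = set0) ?vol_set0//; apply/seteqP; split=> // z /= [/(_ ord0)].
  by rewrite tnth0.
rewrite -(IH [tuple of behead x]); congr vol; apply/seteqP; split=> z /=.
  move=> [Dz]; rewrite big_ord_recl tnth0 => h; split.
    by move=> j; have := Dz (lift ord0 j); rewrite tnthS.
  rewrite lerBrDl; apply: le_trans h; rewrite lerD2l; apply: ler_sum => j _.
  by rewrite tnthS xS.
move=> [Dz h]; split.
  by move=> j; case: (unliftP ord0 j) => [j' ->|->]; rewrite ?tnth0 ?tnthS.
rewrite big_ord_recl tnth0 addrC -lerBrDr; apply: le_trans h; apply: ler_sum => j _.
by rewrite tnthS xS.
Qed.

End SumBalls.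

(** * Euclidean and toroidal ball volumes as functions of the squared radius *)

Section BallVolumes.
Context {R : realType}.
Local Notation mu := (@lebesgue_measure R).
Implicit Types (t u r : R) (k d : nat).

Definition ballvol k t : R := sumvol setT (fun y : R => y ^+ 2) k t.

Let msqr : measurable_fun setT (fun y : R => y ^+ 2).
Proof. exact: measurable_funX. Qed.

Let fin_sqr t : (mu (setT `&` [set y : R | (y ^+ 2 <= t)%R]) < +oo)%E.
Proof.
apply: (@le_lt_trans _ _ (mu `[- (1 + `|t|), 1 + `|t|]%classic)).
  apply: le_measure; rewrite ?inE//.
    rewrite setTI (_ : [set y | _] = (fun y : R => y ^+ 2) @^-1` `]-oo, t]); last first.
      by apply/seteqP; split => y /=; rewrite in_itv.
    by rewrite -[X in measurable X]setTI; exact: msqr.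
  move=> y [_ /= yt]; rewrite in_itv /= -ler_norml.
  rewrite leNgt; apply/negP => h; have := ler_norm t.
  have : (1 + `|t|) ^+ 2 < `|y| ^+ 2 by rewrite ltr_pXn2r// ?nnegrE// addr_ge0.
  by rewrite real_normK ?num_real// expr2; have := normr_ge0 t; nra.
rewrite lebesgue_measure_itv /= lte_fin; case: ifP => _; last exact: ltry.
by rewrite -EFinB ltry.
Qed.

Let sq0 (y : R) : 0 <= y ^+ 2. Proof. exact: sqr_ge0. Qed.

Lemma EFin_ballvol k t : (ballvol k.+1 t)%:E = (\int[mu]_y (ballvol k (t - y ^+ 2))%:E)%E.
Proof. exact: EFin_sumvol. Qed.

Lemma ballvol_ge0 k t : 0 <= ballvol k t. Proof. exact: sumvol_ge0. Qed.

Lemma measurable_ballvol k : measurable_fun setT (ballvol k).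
Proof. exact: measurable_sumvol. Qed.

Let measurable_ballvol_sub k t : measurable_fun setT (fun y : R => ballvol k (t - y ^+ 2)).
Proof.
apply: (measurableT_comp (f := ballvol k)); last exact: measurable_funB.
exact: measurable_ballvol.
Qed.

Lemma ballvol_scale k r t : 0 < r -> ballvol k (r ^+ 2 * t) = r ^+ k * ballvol k t.
Proof.
move=> r0; elim: k t => [|k IH] t.
  rewrite expr0 mul1r /ballvol /=; congr (nat_of_bool _)%:R.
  by rewrite pmulr_rge0// exprn_gt0.
apply: EFin_inj; rewrite EFin_ballvol.
rewrite (@integral_affine R 0 r (fun y => ballvol k (r ^+ 2 * t - y ^+ 2)))//.
rewrite [r ^+ k.+1]exprS -[r * _ * _]mulrA EFinM; congr (_ * _)%E; rewrite EFinM EFin_ballvol -ge0_integralZl//.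
- apply: eq_integral => y _; rewrite addr0 exprMn -mulrBr IH.
  by rewrite EFinM.
- by apply/measurable_EFinP; exact: measurable_ballvol_sub.
- by move=> y _; rewrite lee_fin ballvol_ge0.
- by rewrite lee_fin exprn_ge0// ltW.
by move=> y; exact: ballvol_ge0.
Qed.

Lemma unit_ball_volE d : unit_ball_vol d = ballvol d 1 :> R.
Proof.
rewrite /unit_ball_vol.
have -> : eball (origin d) 1 = [set y : d.-tuple R | (forall j, setT (tnth y j)) /\
        \sum_j (fun _ y : R => y ^+ 2) (tnth (origin d) j) (tnth y j) <= 1].
  have oE (y : d.-tuple R) : Defs.edist (origin d) y = Num.sqrt (\sum_j tnth y j ^+ 2).
    by rewrite /Defs.edist; congr Num.sqrt; apply: eq_bigr => j _; rewrite /origin tnth_mktuple sub0r sqrrN.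
  apply/seteqP; split => y; rewrite /eball /= oE.
    by move=> h; split=> //; move: h; rewrite -{1}sqrtr1 ler_sqrt.
  by move=> [_ h]; rewrite -[leRHS]sqrtr1 ler_sqrt.
have := @vol_sumball R setT (fun _ y => y ^+ 2) ballvol d (origin d) 1.
by move=> -> // k u _; rewrite EFin_ballvol.
Qed.

Section Torus.
Variable s : R.
Hypothesis s_gt0 : 0 < s.

Definition torusvol k t : R := sumvol `[0, s[ (qdist s) k t.

Let mq : measurable_fun setT (qdist s). Proof. exact: measurable_qdist. Qed.

Let q0 (y : R) : 0 <= qdist s y. Proof. exact: qdist_ge0. Qed.

Let fin_q t : (mu (`[0%R, s[ `&` [set y : R | (qdist s y <= t)%R]) < +oo)%E.
Proof.
apply: (@le_lt_trans _ _ (mu `[0, s[%classic)).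
  apply: le_measure; rewrite ?inE//.
  apply: measurableI => //.
  rewrite (_ : [set y | _] = qdist s @^-1` `]-oo, t]); last first.
    by apply/seteqP; split => y /=; rewrite in_itv.
  by rewrite -[X in measurable X]setTI; exact: mq.
by rewrite lebesgue_measure_itv /= lte_fin s_gt0 -EFinB ltry.
Qed.

Lemma EFin_torusvol k t :
  (torusvol k.+1 t)%:E = (\int[mu]_(y in `[0%R, s[) (torusvol k (t - qdist s y))%:E)%E.
Proof. exact: EFin_sumvol. Qed.

Lemma torusvol_ge0 k t : 0 <= torusvol k t. Proof. exact: sumvol_ge0. Qed.

Lemma torusvol_mono k : {homo torusvol k : t u / t <= u}.
Proof. exact: sumvol_mono. Qed.

Lemma measurable_torusvol k : measurable_fun setT (torusvol k).
Proof. exact: measurable_sumvol. Qed.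

Let measurable_torusvol_sub k t (x : R) :
  measurable_fun setT (fun y : R => torusvol k (t - qdist s (y + x))).
Proof.
apply: (measurableT_comp (f := torusvol k)); first exact: measurable_torusvol.
apply: measurable_funB => //; apply: (measurableT_comp mq).
exact: measurable_funD.
Qed.

(** Translation and reflection bring the integral to an integral of the periodic [qdist] over
    another period, which has the same value; so the volume does not depend on the centre. *)
Lemma torusvol_step k t (x : R) :
  (\int[mu]_(y in `[0%R, s[) (torusvol k (t - qdist s (x - y))%R)%:E = (torusvol k.+1 t)%:E)%E.
Proof.
rewrite EFin_torusvol -[RHS](@integral_periodic R (- x) s (fun y => torusvol k (t - qdist s y)))//.
- have := @integral_shift R (- x) `[- x, - x + s[ (fun y => torusvol k (t - qdist s y)).
  move=> -> //; last 2 first.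
  + by have := measurable_torusvol_sub k t 0; under eq_fun do rewrite addr0.
  + by move=> y; exact: torusvol_ge0.
  have -> : `[- x, - x + s[%classic = `[0 + - x, s + - x[%classic by rewrite add0r addrC.
  rewrite itvco_shift; apply: eq_integral => y _.
  by rewrite -(qdistN s_gt0) opprB.
- by have := measurable_torusvol_sub k t 0; under eq_fun do rewrite addr0.
- by move=> y; exact: torusvol_ge0.
- by move=> y z; rewrite qdist_per.
Qed.

(** On the period [[-s/2, s/2)] the function [qdist] is the square; the domain is then enlarged to
    the whole line. *)
Lemma torusvol_le_ballvol k t : torusvol k t <= ballvol k t.
Proof.
elim: k t => [//|k IH] t; rewrite -lee_fin EFin_torusvol EFin_ballvol.
rewrite -(@integral_periodic R (- (s / 2)) s (fun y => torusvol k (t - qdist s y)))//.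
- apply: (@le_trans _ _ (\int[mu]_(y in `[(- (s / 2))%R, (- (s / 2) + s)%R[) (ballvol k (t - y ^+ 2))%:E)%E).
    apply: ge0_le_integral => //.
    + by move=> y _; rewrite lee_fin torusvol_ge0.
    + apply/measurable_EFinP/measurable_funTS.
      by have := measurable_torusvol_sub k t 0; under eq_fun do rewrite addr0.
    + by apply/measurable_EFinP/measurable_funTS; exact: measurable_ballvol_sub.
    + move=> y /=; rewrite in_itv /= => /andP[y1 y2]; rewrite lee_fin qdist_sqr//.
      by rewrite y1 /=; lra.
  apply: ge0_subset_integral => //.
  + by apply/measurable_EFinP; exact: measurable_ballvol_sub.
  + by move=> y _; rewrite lee_fin ballvol_ge0.
- by have := measurable_torusvol_sub k t 0; under eq_fun do rewrite addr0.
- by move=> y; exact: torusvol_ge0.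
- by move=> y z; rewrite qdist_per.
Qed.

Lemma torusvol_gt0 k t : 0 < t -> 0 < torusvol k t.
Proof.
elim: k t => [|k IH] t t0; first by rewrite /torusvol /= ltW.
(* One coordinate in [[0, b)] uses at most half of [t], and [b <= s / 2] keeps the interval inside
   the period. *)
pose b := Num.min (s / 2) (Num.sqrt (t / 2)).
have t20 : 0 < t / 2 by rewrite divr_gt0.
have b0 : 0 < b by rewrite lt_min divr_gt0//= sqrtr_gt0.
rewrite -lte_fin EFin_torusvol.
apply: (@lt_le_trans _ _ (\int[mu]_(y in `[0%R, b[) (torusvol k (t / 2))%:E)%E).
  rewrite integral_cst//= lebesgue_measure_itv /= lte_fin b0 -EFinB subr0 -EFinM lte_fin.
  by rewrite mulr_gt0// IH.
apply: (@le_trans _ _ (\int[mu]_(y in `[0%R, b[) (torusvol k (t - qdist s y))%:E)%E).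
  apply: ge0_le_integral => //.
  - by move=> y _; rewrite lee_fin torusvol_ge0.
  - apply/measurable_EFinP/measurable_funTS.
    by have := measurable_torusvol_sub k t 0; under eq_fun do rewrite addr0.
  move=> y /=; rewrite in_itv /= => /andP[y1 y2]; rewrite lee_fin.
  apply: torusvol_mono; rewrite lerBrDr -lerBrDl.
  move: y2; rewrite lt_min => /andP[y2 y3].
  have := qdist_min s_gt0 y 0; rewrite mulr0 addr0 => /le_trans; apply.
  apply: (@le_trans _ _ (Num.sqrt (t / 2) ^+ 2)).
    by rewrite ler_pXn2r ?nnegrE ?sqrtr_ge0// ltW.
  by rewrite sqr_sqrtr ?(ltW t20)//; lra.
apply: ge0_subset_integral => //.
- apply/measurable_EFinP/measurable_funTS.
  by have := measurable_torusvol_sub k t 0; under eq_fun do rewrite addr0.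
- by move=> y _; rewrite lee_fin torusvol_ge0.
- move=> y /=; rewrite !in_itv /= => /andP[-> yb] /=; apply: (lt_le_trans yb).
  by rewrite ge_min; apply/orP; left; have := s_gt0; lra.
Qed.

Lemma vol_torus_ball d (x : d.-tuple R) t :
  vol [set y : d.-tuple R | (forall j, 0 <= tnth y j < s) /\
        \sum_j qdist s (tnth x j - tnth y j) <= t] = (torusvol d t)%:E.
Proof.
have := @vol_sumball R `[0, s[ (fun x y => qdist s (x - y)) torusvol d x t.
by move=> <- // k u x0; exact: torusvol_step.
Qed.

End Torus.

End BallVolumes.

(** * The toroidal metric *)

Section Euclid.
Context {R : realType} {d : nat}.
Implicit Types (a b : 'I_d -> R) (x y z : d.-tuple R).

Definition enorm a : R := Num.sqrt (\sum_j a j ^+ 2).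

Let sum_sqr_ge0 a : 0 <= \sum_j a j ^+ 2.
Proof. by apply: sumr_ge0 => j _; exact: sqr_ge0. Qed.

Lemma enorm_ge0 a : 0 <= enorm a. Proof. exact: sqrtr_ge0. Qed.

Lemma enorm_sqr a : enorm a ^+ 2 = \sum_j a j ^+ 2.
Proof. by rewrite sqr_sqrtr. Qed.

Lemma cauchy_schwarz a b : \sum_j a j * b j <= enorm a * enorm b.
Proof.
set A := \sum_j a j ^+ 2; set B := \sum_j b j ^+ 2; set C := \sum_j _.
have : 0 <= \sum_i \sum_j (a i * b j - a j * b i) ^+ 2.
  by apply: sumr_ge0 => i _; apply: sumr_ge0 => j _; exact: sqr_ge0.
have -> : \sum_i \sum_j (a i * b j - a j * b i) ^+ 2 = A * B + B * A - (C * C + C * C).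
  rewrite /A /B /C !big_distrlr /= -!big_split -sumrB /=; apply: eq_bigr => i _.
  by rewrite -!big_split -sumrB /=; apply: eq_bigr => j _; ring.
move=> h; apply: (le_trans (ler_norm _)).
rewrite -(@ler_pXn2r _ 2) ?nnegrE ?mulr_ge0 ?enorm_ge0//.
rewrite exprMn !enorm_sqr real_normK ?num_real// -/A -/B expr2; lra.
Qed.

Lemma enorm_triangle a b : enorm (fun j => a j + b j) <= enorm a + enorm b.
Proof.
rewrite -(@ler_pXn2r _ 2) ?nnegrE ?addr_ge0 ?enorm_ge0//.
rewrite sqrrD !enorm_sqr.
have -> : \sum_j (a j + b j) ^+ 2 =
    \sum_j a j ^+ 2 + (\sum_j a j * b j) *+ 2 + \sum_j b j ^+ 2.
  by rewrite -sumrMnl -!big_split; apply: eq_bigr => j _; rewrite sqrrD.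
by rewrite lerD2r lerD2l lerMn2r cauchy_schwarz.
Qed.

Lemma enormZ (c : R) a : 0 <= c -> enorm (fun j => c * a j) = c * enorm a.
Proof.
move=> c0; rewrite /enorm (_ : \sum_j _ = c ^+ 2 * \sum_j a j ^+ 2).
  by rewrite sqrtrM ?sqr_ge0// sqrtr_sqr ger0_norm.
by rewrite mulr_sumr; apply: eq_bigr => j _; rewrite exprMn.
Qed.

Lemma edistE x y : Defs.edist x y = enorm (fun j => tnth x j - tnth y j).
Proof. by []. Qed.

End Euclid.

Section TorusMetric.
Context {R : realType} {d n : nat}.
Hypothesis n_gt0 : (0 < n)%N.
Implicit Types (x y z : d.-tuple R).

Local Notation s := (@side R d n).

Lemma side_gt0 : 0 < s. Proof. by apply: powR_gt0; rewrite ltr0n. Qed.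

Let s_gt0 : 0 < s. Proof. exact: side_gt0. Qed.

(* The representative of [x - y] modulo the lattice that is closest to 0. *)
Definition lift x y (j : 'I_d) : R :=
  tnth x j - tnth y j - s * (nearest s (tnth x j - tnth y j))%:~R.

(** The infimum over lattice translates is attained coordinatewise at the nearest integer. *)
Lemma tdistE x y : tdist n x y = enorm (lift x y).
Proof.
rewrite /tdist; apply/eqP; rewrite eq_le; apply/andP; split.
  apply: ge_inf.
    by exists 0 => _ [u _ <-]; exact: sqrtr_ge0.
  exists (fun j => nearest s (tnth x j - tnth y j)) => //.
  by congr Num.sqrt; apply: eq_bigr => j _; rewrite tnth_mktuple /lift; congr (_ ^+ 2); ring.
apply: lb_le_inf; first by eexists; exists (fun=> 0).
move=> _ [u _ <-]; rewrite ler_sqrt; last by apply: sumr_ge0 => j _; exact: sqr_ge0.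
apply: ler_sum => j _; rewrite tnth_mktuple.
have := qdist_min s_gt0 (tnth x j - tnth y j) (- u j).
by rewrite /qdist /lift intrN; congr (_ <= _ ^+ 2); ring.
Qed.

Lemma tdist_sqr x y : tdist n x y ^+ 2 = \sum_j qdist s (tnth x j - tnth y j).
Proof. by rewrite tdistE enorm_sqr. Qed.

Lemma tdist_ge0 x y : 0 <= tdist n x y. Proof. by rewrite tdistE enorm_ge0. Qed.

Lemma tdist_qdist x y : tdist n x y = Num.sqrt (\sum_j qdist s (tnth x j - tnth y j)).
Proof. by rewrite tdistE. Qed.

Lemma tdist_le_enorm x y (a : 'I_d -> R) (u : 'I_d -> int) :
  (forall j, a j = tnth x j - tnth y j + s * (u j)%:~R) -> tdist n x y <= enorm a.
Proof.
move=> au; rewrite tdist_qdist ler_sqrt; last by apply: sumr_ge0 => j _; exact: sqr_ge0.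
by apply: ler_sum => j _; rewrite au; exact: qdist_min.
Qed.

Lemma tdist_sym x y : tdist n x y = tdist n y x.
Proof.
rewrite !tdist_qdist; congr Num.sqrt; apply: eq_bigr => j _.
by rewrite -(qdistN s_gt0) opprB.
Qed.

(** The sum of the shortest representatives of [x - y] and [y - z] represents [x - z]. *)
Lemma tdist_triangle x y z : tdist n x z <= tdist n x y + tdist n y z.
Proof.
rewrite [tdist n x y]tdistE [tdist n y z]tdistE; apply: le_trans (enorm_triangle _ _).
apply: (@tdist_le_enorm x z _ (fun j =>
  - (nearest s (tnth x j - tnth y j) + nearest s (tnth y j - tnth z j)))) => j.
by rewrite /lift intrN intrD; ring.
Qed.

Lemma tdist_xx x : tdist n x x = 0.
Proof.
apply/eqP; rewrite eq_le tdist_ge0 andbT.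
apply: (le_trans (@tdist_le_enorm x x (fun=> 0) (fun=> 0) _)).
  by move=> j; rewrite subrr mulr0 addr0.
by rewrite /enorm big1 ?sqrtr0// => j _; rewrite expr0n.
Qed.

Lemma measurable_tdist :
  measurable_fun setT (fun z : d.-tuple R * d.-tuple R => tdist n z.1 z.2).
Proof.
have mc j : measurable_fun setT
    (fun z : d.-tuple R * d.-tuple R => tnth z.1 j - tnth z.2 j).
  apply: measurable_funB.
    exact: (measurableT_comp (measurable_tnth j) measurable_fst).
  exact: (measurableT_comp (measurable_tnth j) measurable_snd).
have ms : measurable_fun setT (fun z : d.-tuple R * d.-tuple R =>
    \sum_j qdist s (tnth z.1 j - tnth z.2 j)).
  by apply: measurable_sum => j; exact: (measurableT_comp (measurable_qdist s_gt0) (mc j)).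
have msqrt : measurable_fun setT (@Num.sqrt R).
  by apply: continuous_measurable_fun; exact: sqrt_continuous.
under eq_fun do rewrite tdist_qdist.
exact: (measurableT_comp msqrt ms).
Qed.

(** The shortest representatives of the differences with [y], scaled by [2 / rho], lie within 2 of
    the origin. They are more than 2 apart, since a difference of representatives is no shorter than
    the toroidal distance. The unit balls around them are thus disjoint, and each meets the central
    one at half its centre. *)
Lemma packing_torus (rho : R) m (I : {set 'I_m}) (v : m.-tuple (d.-tuple R)) y :
  0 < rho ->
  (forall i, i \in I -> tdist n (tnth v i) y <= rho) ->
  (forall i l, i \in I -> l \in I -> i != l -> rho < tdist n (tnth v i) (tnth v l)) ->
  (#|I| <= kappa R d)%N.
Proof.
move=> rho0 near apart; have [_ maxk] := kappaP R d; apply: maxk.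
pose e (k : 'I_#|I|) := lift (tnth v (enum_val k)) y.
have c0 : 0 <= 2 / rho by rewrite divr_ge0// ltW.
pose c k : d.-tuple R := [tuple (2 / rho) * e k j | j < d].
exists c; split.
  move=> i l il; apply/seteqP; split=> // u [ci cl].
  have : rho < enorm (fun j => e i j - e l j).
    apply: (lt_le_trans (apart _ _ (enum_valP i) (enum_valP l) _)).
      by apply: contra il => /eqP/enum_val_inj ->.
    apply: (@tdist_le_enorm _ _ _ (fun j =>
      nearest s (tnth (tnth v (enum_val l)) j - tnth y j)
      - nearest s (tnth (tnth v (enum_val i)) j - tnth y j))) => j.
    by rewrite /e /lift intrB; ring.
  have : enorm (fun j => (2 / rho) * (e i j - e l j)) <= 2.
    apply: (@le_trans _ _ (Defs.edist (c i) u + Defs.edist (c l) u)); last first.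
      by rewrite (_ : 2 = 1 + 1)// lerD.
    have -> : Defs.edist (c l) u = enorm (fun j => tnth u j - tnth (c l) j).
      by congr Num.sqrt; apply: eq_bigr => j _; rewrite -sqrrN opprB.
    rewrite edistE; apply: le_trans (enorm_triangle _ _).
    rewrite le_eqVlt; apply/orP; left; apply/eqP; congr Num.sqrt.
    by apply: eq_bigr => j _; rewrite !tnth_mktuple; congr (_ ^+ 2); ring.
  rewrite enormZ// mulrAC ler_pdivrMr// ler_pM2l// => h1 h2.
  by move: (lt_le_trans h2 h1); rewrite ltxx.
move=> i; exists [tuple 2^-1 * tnth (c i) j | j < d].
have ei : enorm (e i) <= rho by rewrite -tdistE near// enum_valP.
have half : enorm (fun j => rho^-1 * e i j) <= 1.
  by rewrite enormZ ?invr_ge0 ?(ltW rho0)// mulrC ler_pdivrMr// mul1r.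
split; rewrite /eball /=; apply: le_trans half;
  rewrite le_eqVlt; apply/orP; left; apply/eqP; congr Num.sqrt;
  apply: eq_bigr => j _; rewrite !tnth_mktuple.
- by congr (_ ^+ 2); field; rewrite gt_eqF.
- by rewrite sub0r sqrrN; congr (_ ^+ 2); field; rewrite gt_eqF.
Qed.

End TorusMetric.

(** Centres at [3/2] and [-3/2] on the first axis. The value 2 is what makes
    [2 + 3 k <= 8/5 (1 + 2 k)] in [eta_S_ge]. *)
Lemma kappa_ge2 (R : realType) (d : nat) : (0 < d)%N -> (2 <= kappa R d)%N.
Proof.
case: d => // d' _; have [_ maxk] := kappaP R d'.+1; apply: maxk.
pose h (k : 'I_2) : R := if k == ord0 then 3 / 2 else - (3 / 2).
pose pt (a : R) : d'.+1.-tuple R := [tuple if j == ord0 then a else 0 | j < d'.+1].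
have ptE a b : Defs.edist (pt a) (pt b) = `|a - b|.
  rewrite /Defs.edist (bigD1 ord0)//= big1 ?addr0 ?tnth_mktuple ?eqxx ?sqrtr_sqr//.
  by move=> j j0; rewrite !tnth_mktuple (negbTE j0) subrr expr0n.
exists (fun k => pt (h k)); split.
  have far (u : d'.+1.-tuple R) (i l : 'I_2) : i = ord0 -> l != ord0 ->
      eball (pt (h i)) 1 u -> eball (pt (h l)) 1 u -> False.
    move=> -> l0; rewrite /eball /= => h1 h2.
    have := le_trans (edist_coord _ _ ord0) h1; have := le_trans (edist_coord _ _ ord0) h2.
    rewrite !tnth_mktuple eqxx /h (negbTE l0) eqxx !ler_norml => /andP[? ?] /andP[? ?].
    lra.
  move=> i l il; apply/seteqP; split=> // u [h1 h2].
  have [i0|i0] := eqVneq i ord0.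
    by apply: (far u i l i0 _ h1 h2); rewrite -i0 eq_sym.
  have [l0|l0] := eqVneq l ord0; first exact: (far u l i l0 i0 h2 h1).
  by move: (ltn_ord i) (ltn_ord l) il i0 l0; rewrite -!val_eqE /=; lia.
move=> k; exists (pt (h k / 2)); split; rewrite /eball /=.
  by rewrite ptE ler_norml /h; case: ifP => _; lra.
have -> : origin d'.+1 = pt 0.
  by apply: eq_from_tnth => j; rewrite !tnth_mktuple if_same.
by rewrite ptE sub0r normrN ler_norml /h; case: ifP => _; lra.
Qed.

(** * Isolated points on the torus *)

(** The left side is the bound of [drift_variance] with [T = m p3]. Put [x = 3^d phi]. From
    [2^d + 1 >= 3] and a fraction at least 2, the first summand of [eta_S] is at least
    [2 (1 + 2 k)^2 (1 + 3 x + 2 x^2)], which dominates it; the second summand is non-negative. *)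
Lemma eta_S_ge (R : realType) (d n : nat) (rho T : R) :
  (1 <= d)%N -> (4 <= n)%N ->
  let phi := unit_ball_vol d * rho ^+ d in
  let k : R := (kappa R d)%:R in
  0 <= phi -> 3 ^+ d * phi < n%:R -> (2 ^+ d.+1 + 1) * phi < n%:R ->
  0 <= T -> T <= 3 ^+ d * phi ->
  (1 + 2 * k) ^+ 2 + 2 * (1 + 2 * k) * (2 + 3 * k) * T + (2 + 3 * k) ^+ 2 * (T + T ^+ 2)
   <= eta_S d n rho.
Proof.
move=> d1 n4 phi k phi0 h3 h2 T0 Tle.
have k2 : 2 <= k by rewrite /k ler_nat kappa_ge2.
rewrite /eta_S -/phi -/k; clearbody phi; set N : R := n%:R in h3 h2 *.
have N4 : 4 <= N by rewrite /N ler_nat.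
set x := 3 ^+ d * phi in h3 Tle *; set y := (2 ^+ d.+1 + 1) * phi in h2 *.
have x0 : 0 <= x by rewrite mulr_ge0 ?exprn_ge0.
have y0 : 0 <= y by rewrite mulr_ge0 ?addr_ge0 ?exprn_ge0.
have frac z : 0 <= z -> z < N -> 2 <= (2 * N - z) / (N - z).
  by move=> z0 zN; rewrite ler_pdivlMr ?subr_gt0//; lra.
have e9 : 9 ^+ d * phi ^+ 2 = x ^+ 2.
  have -> : 9 = 3 ^+ 2 :> R by ring.
  by rewrite /x [RHS]exprMn -!exprM mulnC.
have two_d : 2 <= 2 ^+ d :> R.
  by case: d d1 {k k2 phi phi0 x x0 y y0 h2 h3 Tle e9} => // d' _; rewrite exprS ler_peMr// exprn_ege1// ler1n.
have fx := frac _ x0 h3; have fy := frac _ y0 h2.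
set second := (kappa_plus R d)%:R ^+ 2 / 2 * _.
have s0 : 0 <= second.
  rewrite /second; apply: mulr_ge0; first by rewrite mulr_ge0 ?exprn_ge0.
  apply: addr_ge0; last by rewrite divr_ge0//; lra.
  apply: addr_ge0.
    by rewrite mulr_ge0// !addr_ge0 ?mulr_ge0 ?exprn_ge0.
  rewrite mulr_ge0 ?sqr_ge0// mulr_ge0 ?addr_ge0 ?exprn_ge0//.
  exact: le_trans fy.
have main : (1 + 2 * k) ^+ 2 + 2 * (1 + 2 * k) * (2 + 3 * k) * T
    + (2 + 3 * k) ^+ 2 * (T + T ^+ 2) <=
   2 * (1 + 2 * k) ^+ 2 * (1 + 3 * x + 2 * x ^+ 2).
  set a := 1 + 2 * k; set b := 2 + 3 * k.
  have a0 : 0 <= a by rewrite /a; lra.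
  have b0 : 0 <= b by rewrite /b; lra.
  have ba : b <= 8 / 5 * a by rewrite /a /b; lra.
  have T2 : T ^+ 2 <= x ^+ 2 by rewrite ler_pXn2r.
  have h1 : a * b * T <= a * (8 / 5 * a) * x.
    by apply: ler_pM => //; [exact: mulr_ge0|exact: ler_wpM2l].
  have h4 : b ^+ 2 * (T + T ^+ 2) <= (8 / 5 * a) ^+ 2 * (x + x ^+ 2).
    apply: ler_pM; rewrite ?sqr_ge0 ?addr_ge0 ?sqr_ge0//; last exact: lerD.
    by rewrite ler_pXn2r ?nnegrE// mulr_ge0.
  apply: (@le_trans _ _ (a ^+ 2 + 2 * (a * (8 / 5 * a) * x) + (8 / 5 * a) ^+ 2 * (x + x ^+ 2))).
    by move: h1 h4; clear; clearbody a b => h1 h4; lra.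
  have -> : a ^+ 2 + 2 * (a * (8 / 5 * a) * x) + (8 / 5 * a) ^+ 2 * (x + x ^+ 2)
     = a ^+ 2 * (1 + 16 / 5 * x + 64 / 25 * (x + x ^+ 2)) by field.
  have -> : 2 * a ^+ 2 * (1 + 3 * x + 2 * x ^+ 2) = a ^+ 2 * (2 * (1 + 3 * x + 2 * x ^+ 2)) by ring.
  rewrite ler_wpM2l ?sqr_ge0//; have := sqr_ge0 x; lra.
apply: (le_trans main); apply: (@le_trans _ _ (2 * (1 + 2 * k) ^+ 2 *
   (1 + (2 ^+ d + 1) * 3 ^+ d * phi + (2 * N - x) / (N - x) * 9 ^+ d * phi ^+ 2))).
  apply: ler_wpM2l; first by rewrite mulr_ge0 ?sqr_ge0.
  have -> : (2 ^+ d + 1) * 3 ^+ d * phi = (2 ^+ d + 1) * x by rewrite /x mulrA.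
  rewrite -[(2 * N - x) / (N - x) * 9 ^+ d * phi ^+ 2]mulrA e9.
  apply: lerD; last by rewrite ler_wpM2r ?sqr_ge0.
  by rewrite lerD2l ler_wpM2r//; lra.
by rewrite lerDl.
Qed.

Lemma mean_Ex (R : realType) (d : measure_display) (T : measurableType d)
  (P : probability T R) (S : T -> R) : mean P S = Ex P S.
Proof. by rewrite /mean unlock. Qed.

Lemma sd_Ex (R : realType) (d : measure_display) (T : measurableType d)
  (P : probability T R) (S : T -> R) :
  sd P S = Num.sqrt (Ex P (fun w => (S w - mean P S) ^+ 2)).
Proof.
by rewrite /sd /variance !unlock /Ex /Rintegral /mean unlock.
Qed.

(** * Ball probabilities for a uniform point of the torus *)

Section UniformTorus.
Context {R : realType} {d n : nat}.
Hypothesis n_gt0 : (0 < n)%N.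
Variable lam : probability (d.-tuple R) R.
Hypothesis lam_uniform : forall A, measurable A ->
  lam A = (vol (A `&` torus n) * (n%:R^-1)%:E)%E.
Implicit Types (x y : d.-tuple R) (r : R).

Local Notation D := (@tdist R d n).
Local Notation s := (@side R d n).

Let s_gt0 : 0 < s. Proof. exact: side_gt0. Qed.

Lemma measurable_close r x : measurable [set y | close D r x y].
Proof.
have mb : measurable_fun setT (close D r x).
  apply: measurable_fun_ler => //.
  exact: (measurableT_comp (@measurable_tdist R d n n_gt0) (pair1_measurable x)).
rewrite (_ : [set y | _] = setT `&` close D r x @^-1` [set true]); first exact: mb.
by rewrite setTI; apply/seteqP; split=> y /=; rewrite /preimage /= => ->.
Qed.

Lemma measurable_torus : measurable (torus n : set (d.-tuple R)).
Proof.
rewrite (_ : torus n = box (fun=> `[0, s[%classic)).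
  by apply: measurable_box => j; exact: measurable_itv.
by apply/seteqP; split=> x h j; have := h j; rewrite /= in_itv.
Qed.

Lemma lam_torusC : lam (~` torus n) = 0%E.
Proof.
rewrite lam_uniform; last exact: measurableC measurable_torus.
by rewrite setICl vol_set0 mul0e.
Qed.

Lemma Ex_close r x : 0 <= r ->
  Ex lam (fun y => (close D r x y)%:R) = torusvol s d (r ^+ 2) / n%:R.
Proof.
move=> r0.
have -> : (fun y => (close D r x y)%:R : R) = (fun y => (`[< [set y | close D r x y] y >])%:R).
  by apply/funext => y; congr (_%:R); congr nat_of_bool; rewrite /= asboolb.
rewrite Ex_indic ?lam_uniform//; try exact: measurable_close.
have -> : [set y | close D r x y] `&` torus n =
    [set y | (forall j, 0 <= tnth y j < s) /\ \sum_j qdist s (tnth x j - tnth y j) <= r ^+ 2].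
  apply/seteqP; split=> y /= [h1 h2]; split=> //.
    by rewrite -tdist_sqr// ler_pXn2r ?nnegrE ?tdist_ge0.
  by move: h2; rewrite -tdist_sqr// ler_pXn2r ?nnegrE ?tdist_ge0.
by rewrite vol_torus_ball.
Qed.

Lemma torusvol_le_unit_ball r : 0 < r -> torusvol s d (r ^+ 2) <= unit_ball_vol d * r ^+ d.
Proof.
move=> r0; apply: (le_trans (torusvol_le_ballvol s_gt0 _ _)).
by rewrite -[r ^+ 2]mulr1 ballvol_scale// unit_ball_volE mulrC.
Qed.

(** A positive value [v] would be at most [unit_ball_vol d * r] for every positive [r <= 1], by
    monotonicity and scaling. This is what makes coincidences of two points null. *)
Lemma torusvol0 : (0 < d)%N -> torusvol s d 0 = 0.
Proof.
move=> d0; apply/eqP; rewrite eq_le torusvol_ge0 andbT leNgt; apply/negP.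
set v := torusvol s d 0 => v0.
have b0 : 0 <= unit_ball_vol d :> R by rewrite unit_ball_volE ballvol_ge0.
pose r := Num.min 1 (v / (2 * (unit_ball_vol d + 1))).
have r0 : 0 < r by rewrite lt_min ltr01/= divr_gt0// mulr_gt0//; lra.
have : v <= unit_ball_vol d * r.
  apply: (@le_trans _ _ (torusvol s d (r ^+ 2))).
    by apply: torusvol_mono => //; exact: sqr_ge0.
  apply: (le_trans (torusvol_le_unit_ball r0)); apply: ler_wpM2l => //.
  case: d d0 => // d' _; rewrite exprS ler_piMr ?(ltW r0)// exprn_ile1 ?(ltW r0)//.
  by rewrite /r ge_min lexx.
apply/negP; rewrite -ltNge; set b := unit_ball_vol d in b0 r r0 *.
apply: (@le_lt_trans _ _ (b * (v / (2 * (b + 1))))).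
  by rewrite ler_wpM2l// /r ge_min lexx orbT.
rewrite mulrA ltr_pdivrMr; last by lra.
have : 0 <= b * v by rewrite mulr_ge0 ?(ltW v0).
by have := v0; clearbody v b; lra.
Qed.

End UniformTorus.

(** The difference is at most [M + M'] on a finite union of null events and 0 elsewhere. *)
Lemma Ex_eq_off_null (R : realType) (d : measure_display) (T : measurableType d)
    (P : probability T R) (K : finType) (b : K -> T -> bool) (F G : T -> R) :
  (forall k, measurable_fun setT (b k)) -> (forall k, Ex P (fun w => (b k w)%:R) = 0) ->
  bmf F -> bmf G -> (forall w, (forall k, ~~ b k w) -> F w = G w) -> Ex P F = Ex P G.
Proof.
move=> mb b0 bF bG FG; have [_ [M FM]] := bF; have [_ [M' GM]] := bG.
have bb k : bmf (fun w => (b k w)%:R : R) by exact: bmf_bool.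
have bS : bmf (fun w => \sum_k (b k w)%:R : R) by apply: bmf_sum => k _.
apply/eqP; rewrite -subr_eq0 -ExB// -normr_le0.
apply: (le_trans (Ex_norm _ (bmfB bF bG))).
have -> : 0 = Ex P (fun w => (M + M') * \sum_k (b k w)%:R).
  by rewrite ExZ// Ex_sum// big1 ?mulr0.
apply: Ex_le; [exact/bmf_norm/bmfB|exact: bmfZ|move=> w].
have [/forallP h|] := boolP [forall k, ~~ b k w].
  by rewrite FG// subrr normr0 big1 ?mulr0// => k _; rewrite (negbTE (h k)).
rewrite negb_forall => /existsP[k]; rewrite negbK => bk.
have M0 := le_trans (normr_ge0 _) (FM w); have M'0 := le_trans (normr_ge0 _) (GM w).
apply: (le_trans (ler_normB _ _)); apply: (le_trans (lerD (FM w) (GM w))).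
rewrite ler_peMr ?addr_ge0// (bigD1 k)//= bk lerDl.
by apply: sumr_ge0.
Qed.

(** Reflection replaces [V <= - t] by [V < - t], and [Y] may have atoms. The strict event contains
    [V <= - t - a] for each [a > 0], and the Lipschitz bound on [gcdf] lets [a] tend to 0. *)
Lemma kolmogorov_reflect (R : realType) (d : measure_display) (T : measurableType d)
    (P : probability T R) (Y : T -> R) (m s e c : R) :
  (forall f : R -> R, bmf (fun w => f (Y w))) ->
  (forall t, `|std_cdf P Y m s t - gcdf t| <= e) ->
  forall t, `|std_cdf P (fun w => c - Y w) (c - m) s t - gcdf t| <= e.
Proof.
move=> bY h t; rewrite /std_cdf.
pose V (y : R) : R := (y - m) / s.
have -> : Ex P (fun w => ((c - Y w - (c - m)) / s <= t)%R%:R) =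
    1 - Ex P (fun w => (V (Y w) < - t)%R%:R).
  apply/esym/eqP; rewrite subr_eq -ExD; last 2 first.
  - exact: (bY (fun y => ((c - y - (c - m)) / s <= t)%R%:R)).
  - exact: (bY (fun y => (V y < - t)%R%:R)).
  apply/eqP; rewrite -[LHS](Ex_cst P); apply: eq_Ex => w.
  have -> : (c - Y w - (c - m)) / s = - V (Y w) by rewrite /V -mulNr; congr (_ * _); ring.
  by rewrite lerNl leNgt; case: ltP; rewrite ?addr0 ?add0r.
have -> : gcdf t = 1 - gcdf (- t) by rewrite gcdf_gtail -(gcdf_add_gtail t) addrK.
have -> : forall a b : R, 1 - a - (1 - b) = - (a - b) by move=> *; ring.
rewrite normrN ler_norml; apply/andP; split.
  apply/ler_addgt0Pr => a a0.
  have := h (- t - a); rewrite ler_norml => /andP[+ _].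
  have := @gcdfB_le_half R (- t - a) (- t); rewrite lerBlDr lerDl (ltW a0) => /(_ isT).
  have : std_cdf P Y m s (- t - a) <= Ex P (fun w => (V (Y w) < - t)%R%:R).
    apply: Ex_le; [exact: (bY (fun y => (V y <= - t - a)%R%:R))
      |exact: (bY (fun y => (V y < - t)%R%:R))|move=> w].
    rewrite ler_nat; case: (leP _ (- t - a)) => //= Vle.
    by rewrite (le_lt_trans Vle)// ltrBlDr ltrDl.
  lra.
have := h (- t); rewrite ler_norml => /andP[_]; apply: le_trans.
rewrite lerD2r; apply: Ex_le; [exact: (bY (fun y => (V y < - t)%R%:R))
  |exact: (bY (fun y => (V y <= - t)%R%:R))|move=> w].
by rewrite ler_nat; case: (ltP (V _)) => //= /ltW ->.
Qed.

(** * Isolation in terms of pairwise conditions *)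

Section Isolation.
Context {R : realType} {d m : nat}.
Local Notation n := m.+1.
Local Notation X := (d.-tuple R).
Local Notation D := (@tdist R d n).
Implicit Types (u : n.-tuple X) (i j : 'I_n).

Definition isolated rho u i : bool :=
  `[< range (fun j => tnth u j) `&` tball n (tnth u i) rho = [set tnth u i] >].

Definition neighbour rho (ij : 'I_n * 'I_n) u :=
  `[< torus n (tnth u ij.2) >] && close D rho (tnth u ij.1) (tnth u ij.2).

Definition same (ij : 'I_n * 'I_n) u := tnth u ij.1 == tnth u ij.2.

(** Brings the equality of sets into a Boolean combination of finitely many pairwise conditions, as
    [bmf_finite] wants. The existential factor says that the point belongs to its own ball. *)
Lemma isolatedE rho u i : isolated rho u i =
  [forall j, neighbour rho (i, j) u ==> same (i, j) u] &&
  [exists j, neighbour rho (i, j) u && same (i, j) u].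
Proof.
apply/asboolP/andP => [/seteqP[h1 h2]|[/forallP h1 /existsP[k /andP[nk sk]]]].
  split.
    apply/forallP => j; apply/implyP => /andP[/asboolP tj cj].
    by apply/eqP/esym; apply: h1; split; [exists j|split].
  apply/existsP; exists i; rewrite /same eqxx andbT /neighbour /=.
  by have [_ [ti ci]] := h2 _ erefl; apply/andP; split=> //; apply/asboolP.
apply/seteqP; split=> y.
  move=> [[j _ <-] [tj cj]]; apply/esym/eqP; apply: (implyP (h1 j)).
  by apply/andP; split=> //; apply/asboolP.
move=> ->; split; first by exists i.
have /eqP e := sk; move: nk; rewrite /neighbour /= -e => /andP[/asboolP ti ci].
by split.
Qed.

Lemma measurable_same ij : measurable_fun setT (same ij).
Proof.
have -> : same ij = fun u => \sum_k (tnth (tnth u ij.1) k - tnth (tnth u ij.2) k) ^+ 2 <= 0.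
  apply/funext => u; apply/eqP/idP => [->|h].
    by rewrite big1// => k _; rewrite subrr expr0n.
  apply: eq_from_tnth => k; apply/eqP; rewrite -subr_eq0 -(sqrf_eq0) eq_le sqr_ge0 andbT.
  apply: le_trans h; rewrite (bigD1 k)//= lerDl; apply: sumr_ge0 => ? _; exact: sqr_ge0.
apply: measurable_fun_ler => //.
apply: measurable_sum => k; apply: measurable_funX; apply: measurable_funB.
  exact: (measurableT_comp (measurable_tnth k) (measurable_tnth ij.1)).
exact: (measurableT_comp (measurable_tnth k) (measurable_tnth ij.2)).
Qed.

Lemma measurable_in_torus i : measurable_fun setT (fun u => `[< torus n (tnth u i) >]).
Proof.
have mt := @measurable_torus R d n.
apply: (@measurable_fun_bool _ _ _ _ true).
rewrite (_ : _ @^-1` _ = (@tnth n X)^~ i @^-1` torus n).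
  by apply: measurable_tnth.
by apply/seteqP; split=> u /=; [move/asboolP|move=> ?; apply/asboolP].
Qed.

Lemma bmf_isolated rho (f : R -> R) : bmf (fun u => f (\sum_i (isolated rho u i)%:R)).
Proof.
pose b (k : bool * ('I_n * 'I_n)) := if k.1 then neighbour rho k.2 else same k.2.
pose h (c : {ffun bool * ('I_n * 'I_n) -> bool}) : R := f (\sum_i
  ([forall j, c (true, (i, j)) ==> c (false, (i, j))] &&
   [exists j, c (true, (i, j)) && c (false, (i, j))])%:R).
have -> : (fun u => f (\sum_i (isolated rho u i)%:R)) = (fun u => h [ffun k => b k u]).
  apply/funext => u; rewrite /h; congr f; apply: eq_bigr => i _; rewrite isolatedE.
  by congr ((_ && _)%:R); [apply: eq_forallb|apply: eq_existsb] => j; rewrite !ffunE.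
apply: bmf_finite => -[[] ij]; rewrite /b /=; last exact: measurable_same.
apply: measurable_and; first exact: measurable_in_torus.
exact: (measurableT_comp (near_measurable (@measurable_tdist R d n isT) rho)
           (tnth_pair_measurable ij.1 ij.2)).
Qed.

(** A coinciding copy of a point disappears in the set equality but is a neighbour for [count], and
    a point off the torus is never [isolated]. Away from these two cases the notions are
    complementary. *)
Lemma sum_isolated rho u : 0 <= rho ->
  (forall i, torus n (tnth u i)) -> (forall i j, i != j -> tnth u i != tnth u j) ->
  \sum_i (isolated rho u i)%:R = n%:R - count D rho u.
Proof.
move=> rho0 ut ui; rewrite countE -[n in n%:R]card_ord -sum1_card natr_sum -sumrB.
apply: eq_bigr => i _; rewrite -linked_degree.
have -> : isolated rho u i = ~~ linked (graph D rho u) [set: 'I_n]%SET i.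
  rewrite isolatedE /linked negb_exists; apply/andP/forallP.
    move=> [/forallP h _] j; rewrite inE /=; apply/negP => /andP[ji cj].
    have /implyP := h j; rewrite /neighbour /= asboolT//= => /(_ cj).
    by apply/negP; apply: ui; rewrite eq_sym.
  move=> h; split.
    apply/forallP => j; apply/implyP => /andP[_ cj].
    have := h j; rewrite inE /= negb_and negbK => /orP[/eqP -> //|]; first exact: eqxx.
    by rewrite /graph cj.
  apply/existsP; exists i; rewrite /neighbour /same eqxx andbT /= asboolT//=.
  by rewrite /close tdist_xx.
by case: linked; rewrite /= ?subrr ?subr0.
Qed.

End Isolation.

Lemma count_full (R : realType) (disp : measure_display) (X : measurableType disp) (m : nat)
    (D : X -> X -> R) (rho : R) (x : X) (u : m.+1.-tuple X) :
  (0 < m)%N -> (forall y z, D y z = D z y) -> (forall w y z, D w z <= D w y + D y z) ->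
  (forall i, D x (tnth u i) <= rho / 2) -> count D rho u = m.+1%:R.
Proof.
move=> m0 sym tri near; rewrite countE -[m.+1 in RHS]card_ord -sum1_card natr_sum.
apply: eq_bigr => i _; rewrite -linked_degree (_ : linked _ _ _ = true)//.
have [j ji] : exists j : 'I_m.+1, j != i.
  case: (eqVneq i ord0) => [->|i0]; last by exists ord0; rewrite eq_sym.
  by exists ord_max; rewrite -val_eqE /= -lt0n.
apply/existsP; exists j; rewrite inE ji /graph /close /=.
by apply: (le_trans (tri _ x _)); rewrite sym; have := near i; have := near j; lra.
Qed.

(** With positive probability all points fall in [B]; the count then takes its largest value, which
    exceeds [mu]. *)
Lemma Ex_count_var_gt0 (R : realType) (disp : measure_display) (X : measurableType disp) (m : nat)
    (Q : probability (m.+1.-tuple X) R) (lam : probability X R)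
    (D : X -> X -> R) (rho mu : R) (B : set X) :
  (forall C : 'I_m.+1 -> set X, (forall i, measurable (C i)) -> Q (box C) = (\prod_i lam (C i))%E) ->
  measurable_fun setT (fun z : X * X => D z.1 z.2) ->
  measurable B -> (0 < lam B)%E ->
  (forall u : m.+1.-tuple X, box (fun=> B) u -> count D rho u = m.+1%:R) ->
  mu < m.+1%:R -> 0 < Ex Q (fun u => (count D rho u - mu) ^+ 2).
Proof.
move=> Qbox mD mB B0 full mu_lt.
have mbox : measurable (box (fun=> B) : set (m.+1.-tuple X)) by apply: measurable_box.
have lamB : lam B = (fine (lam B))%:E by rewrite fineK ?fin_num_measure.
have QB : fine (Q (box (fun=> B))) = fine (lam B) ^+ m.+1.
  by rewrite Qbox// (eq_bigr (fun=> (fine (lam B))%:E))// prodEFin prodr_const card_ord.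
apply: (@lt_le_trans _ _ ((m.+1%:R - mu) ^+ 2 * fine (Q (box (fun=> B))))).
  rewrite QB mulr_gt0 ?exprn_gt0 ?subr_gt0//.
  by rewrite lamB lte_fin in B0.
rewrite -Ex_indic// -ExZ; last exact: bmf_indic.
apply: Ex_le.
- by apply: bmfZ; exact: bmf_indic.
- by apply: bmfX; apply: bmfB; [exact: bmf_count|exact: bmf_cst].
- move=> u; case: asboolP => [/full ->|_]; first by rewrite mulr1.
  by rewrite mulr0 sqr_ge0.
Qed.

(** * The Kolmogorov bound for the number of isolated points *)

Section RandomGeometricGraph.
Context {R : realType} {disp : measure_display} {T : measurableType disp}.
Variables (P : probability T R) (d m : nat) (rho : R).
Local Notation n := m.+1.
Local Notation X := (d.-tuple R).
Local Notation D := (@tdist R d n).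
Variable U : 'I_n -> {RV P >-> X}.
Hypotheses (d_ge1 : (1 <= d)%N) (n_ge4 : (4 <= n)%N) (rho_gt0 : 0 < rho).
Hypothesis U_uniform : forall i, uniform_on_torus P n (U i).
Hypothesis U_indep : independent_vectors P U.

Let lam : probability X R := distribution P (U ord0).
Let Q : probability (n.-tuple X) R := joint_law P U.

Let m_gt0 : (0 < m)%N. Proof. by case: (m) n_ge4. Qed.

Lemma lam_uniform A : measurable A -> lam A = (vol (A `&` torus n) * (n%:R^-1)%:E)%E.
Proof. exact: U_uniform. Qed.

Lemma U_law i A : measurable A -> P (U i @^-1` A) = lam A.
Proof. by move=> mA; rewrite U_uniform// lam_uniform. Qed.

Lemma U_box_indep (B : 'I_n -> set X) : (forall i, measurable (B i)) ->
  P [set w | forall i, B i (U i w)] = (\prod_i P (U i @^-1` B i))%E.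
Proof.
move=> mB; have := @U_indep [set: 'I_n]%SET B mB.
rewrite (_ : [set w | _] = [set w | forall i, B i (U i w)]).
  by move=> ->; apply: eq_bigl => i; rewrite inE.
by apply/seteqP; split=> w /= h i => [|_]; apply: h; rewrite ?inE.
Qed.

(** The exceptional events are a point off the torus and two points at toroidal distance 0. The
    latter is null by resampling one of the two points, together with [torusvol0]. *)
Lemma Ex_off_diagonal (f g : n.-tuple X -> R) : bmf f -> bmf g ->
  (forall u, (forall i, torus n (tnth u i)) ->
     (forall i j, i != j -> tnth u i != tnth u j) -> f u = g u) ->
  Ex Q f = Ex Q g.
Proof.
move=> bf bg fg.
pose b (k : 'I_n + 'I_n * 'I_n) (u : n.-tuple X) := match k with
  | inl i => ~~ `[< torus n (tnth u i) >]
  | inr (i, j) => (i != j) && close D 0 (tnth u i) (tnth u j) end.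
have mD := @measurable_tdist R d n isT.
have mt : measurable (~` torus n : set X) by apply: measurableC; exact: measurable_torus.
apply: (@Ex_eq_off_null _ _ _ Q _ b).
- case=> [i|[i j]] /=; first by apply: measurable_neg; exact: measurable_in_torus.
  apply: measurable_and => //.
  exact: (measurableT_comp (near_measurable mD 0) (tnth_pair_measurable i j)).
- case=> [i|[i j]] /=.
    rewrite Ex_joint_law; last by apply: bmf_bool; apply: measurable_neg; exact: measurable_in_torus.
    rewrite (_ : (fun w => _) = fun w => (`[< (U i @^-1` (~` torus n)) w >])%:R).
      rewrite Ex_indic; last by rewrite -[X in measurable X]setTI; exact: measurable_funPT.
      by rewrite U_law// lam_torusC//; exact: lam_uniform.
    by apply/funext => w; rewrite tnth_mktuple asbool_neg.
  have [->|ij] := eqVneq i j; first by rewrite Ex_cst.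
  have bn : bmf (fun u : n.-tuple X => (close D 0 (tnth u i) (tnth u j))%:R : R).
    by apply: bmf_bool; exact: (measurableT_comp (near_measurable mD 0) (tnth_pair_measurable i j)).
  rewrite -(joint_law_resample U_law U_box_indep j bn) -[RHS](Ex_cst Q).
  apply: eq_Ex => u; rewrite /avg.
  under eq_Ex => y do rewrite !tnth_upd eqxx (negbTE ij).
  by rewrite (@Ex_close R d n isT lam lam_uniform)// expr0n/= torusvol0// mul0r.
- exact: bf.
- exact: bg.
- move=> u good; apply: fg => [i|i j ij].
    by have := good (inl i); rewrite negbK => /asboolP.
  have := good (inr (i, j)); rewrite /= ij /=; apply: contra => /eqP ->.
  by rewrite /close tdist_xx.
Qed.

Let S := isolated_count rho U.
Let W := fun u : n.-tuple X => n%:R - count D rho u.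

Lemma isolated_countE w : S w = \sum_i (isolated rho (joint U w) i)%:R.
Proof.
have Uw : (fun j => U j w) = (fun j => tnth (joint U w) j).
  by apply/funext => j; rewrite tnth_mktuple.
by rewrite /S /isolated_count Uw; apply: eq_bigr => i _; rewrite /isolated tnth_mktuple.
Qed.

Lemma Ex_isolated_count (f : R -> R) : Ex P (fun w => f (S w)) = Ex Q (fun u => f (W u)).
Proof.
have bi := @bmf_isolated R d m rho f.
rewrite -(@Ex_off_diagonal _ _ bi); last 2 first.
- by rewrite /W; apply: (bmf_of_count m rho _ (fun y => f (n%:R - y))); exact: measurable_tdist.
- by move=> u ut ui; rewrite /W sum_isolated ?ltW.
by rewrite Ex_joint_law//; apply: eq_Ex => w; rewrite isolated_countE.
Qed.

Let phi := unit_ball_vol d * rho ^+ d.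
Hypothesis phi_small : Num.max (3 ^+ d) (2 ^+ d.+1 + 1) * phi < n%:R.

Let p := torusvol (side d n) d (rho ^+ 2) / n%:R.
Let p3 := torusvol (side d n) d ((3 * rho) ^+ 2) / n%:R.
Let mc := mean_count m p.
Let s := sd P S.

Let phi_ge0 : 0 <= phi.
Proof. by rewrite mulr_ge0 ?exprn_ge0 ?(ltW rho_gt0)// unit_ball_volE ballvol_ge0. Qed.

Let phi3 : 3 ^+ d * phi < n%:R.
Proof.
apply: le_lt_trans phi_small; apply: ler_wpM2r => //.
by rewrite le_max lexx.
Qed.

Let phi2 : (2 ^+ d.+1 + 1) * phi < n%:R.
Proof.
apply: le_lt_trans phi_small; apply: ler_wpM2r => //.
by rewrite le_max lexx orbT.
Qed.

Let p_gt0 : 0 < p.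
Proof. by rewrite divr_gt0// torusvol_gt0 ?side_gt0// exprn_gt0. Qed.

Let p_lt1 : p < 1.
Proof.
rewrite ltr_pdivrMr// mul1r; apply: le_lt_trans phi3.
apply: (le_trans (torusvol_le_unit_ball _ _)) => //.
by rewrite ler_peMl// exprn_ege1// ler1n.
Qed.

Let near_prob x : Ex lam (fun y => (close D rho x y)%:R) = p.
Proof. by rewrite (@Ex_close R d n isT lam lam_uniform)// ltW. Qed.

Let near3_prob x : Ex lam (fun y => (close D (3 * rho) x y)%:R) <= p3.
Proof. by rewrite (@Ex_close R d n isT lam lam_uniform)// mulr_ge0// ltW. Qed.

Let p3_ge0 : 0 <= p3.
Proof. by rewrite divr_ge0// torusvol_ge0. Qed.

Let p3_le : m%:R * p3 <= 3 ^+ d * phi.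
Proof.
apply: (@le_trans _ _ (n%:R * p3)).
  by apply: ler_wpM2r => //; rewrite ler_nat.
rewrite /p3 mulrCA divff ?gt_eqF// mulr1.
apply: (le_trans (torusvol_le_unit_ball _ _)) => //; first by rewrite mulr_gt0.
by rewrite exprMn /phi mulrCA.
Qed.

Let mD := @measurable_tdist R d n isT.
Let D_sym := @tdist_sym R d n isT.
Let D_tri := @tdist_triangle R d n isT.
Let packing (I : {set 'I_n}) (v : n.-tuple X) (y : X) :=
  @packing_torus R d n isT rho n I v y rho_gt0.
Let resample := joint_law_resample U_law U_box_indep.

Lemma Ex_countE : Ex Q (count D rho) = mc.
Proof. exact: (Ex_count resample mD p_gt0 p_lt1 near_prob m_gt0). Qed.

Lemma mean_isolated_count : mean P S = n%:R - mc.
Proof.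
rewrite mean_Ex (Ex_isolated_count id) /W ExB; last 2 first.
- exact: bmf_cst.
- exact: bmf_count.
by rewrite Ex_cst Ex_countE.
Qed.

Let var_eq : Ex Q (fun u => (count D rho u - mc) ^+ 2) = s ^+ 2.
Proof.
rewrite /s sd_Ex mean_isolated_count (Ex_isolated_count (fun y => (y - (n%:R - mc)) ^+ 2)).
rewrite sqr_sqrtr; last by apply: Ex_ge0 => u; exact: sqr_ge0.
by apply: eq_Ex => u; rewrite /W -sqrrN; congr (_ ^+ 2); ring.
Qed.

(** All points may fall in one ball of radius [rho / 2], which has positive probability and leaves
    no point isolated, whereas the mean of the count is below [n]. *)
Lemma sd_isolated_count_gt0 : 0 < s.
Proof.
rewrite lt_def sqrtr_ge0 andbT -sqrf_eq0 -var_eq gt_eqF//.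
pose B := [set y : X | close D (rho / 2) (origin d) y].
have mB : measurable B by exact: measurable_close.
apply: (@Ex_count_var_gt0 _ _ _ _ Q lam D rho mc B) => //.
- exact: joint_law_box U_law U_box_indep.
- have := @Ex_close R d n isT lam lam_uniform (rho / 2) (origin d) (ltW (divr_gt0 rho_gt0 (ltr0n R 2))).
  move=> h; rewrite -[lam B]fineK ?fin_num_measure// lte_fin -Ex_indic//.
  rewrite (_ : (fun x => _) = fun y => (close D (rho / 2) (origin d) y)%:R).
    by rewrite h divr_gt0// torusvol_gt0 ?side_gt0// exprn_gt0// divr_gt0.
  by apply/funext => y; congr (_%:R); congr nat_of_bool; rewrite /B /= asboolb.
- by move=> u uB; apply: (@count_full _ _ _ _ _ _ (origin d)) => // i; exact: uB.
- exact: mean_count_lt.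
Qed.

(** [size_bias_kolmogorov] is applied to [count] on the tuple space, with [Dl^2 = eta_S / n];
    [kolmogorov_reflect] passes to [n - count], which has the law of [S]. *)
Lemma isolated_count_kolmogorov :
  kolmogorov_normal P S <=
    (n%:R - mean P S) / (5 * s ^+ 2) *
    (Num.sqrt (11 * (kappa_plus R d)%:R ^+ 2 / s
               + 5 * Num.sqrt (eta_S d n rho) / Num.sqrt n%:R)
     + 2 * (kappa_plus R d)%:R / Num.sqrt s) ^+ 2.
Proof.
have s0 := sd_isolated_count_gt0.
have -> : n%:R - mean P S = mc by rewrite mean_isolated_count opprB addrC subrK.
have -> : 5 * Num.sqrt (eta_S d n rho) / Num.sqrt n%:R =
  5 * (Num.sqrt (eta_S d n rho) / Num.sqrt n%:R) by rewrite mulrA.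
have kpE : (kappa_plus R d)%:R = 1 + (kappa R d)%:R :> R by rewrite /kappa_plus natrD.
rewrite kpE; set Dl := Num.sqrt (eta_S d n rho) / Num.sqrt n%:R.
have eta_ge := eta_S_ge d_ge1 n_ge4 phi_ge0 phi3 phi2 (mulr_ge0 (ler0n R m) p3_ge0) p3_le.
have eta0 : 0 <= eta_S d n rho.
  apply: le_trans eta_ge.
  by do ![exact: sqr_ge0 | exact: p3_ge0 | exact: ler01 | exact: ler0n | apply: addr_ge0 | apply: mulr_ge0].
have Dl2 : Dl ^+ 2 = n%:R^-1 * eta_S d n rho.
  by rewrite /Dl expr_div_n !sqr_sqrtr ?ler0n// mulrC.
have var : Ex Q (fun u => drift lam D rho p u ^+ 2) - Ex Q (drift lam D rho p) ^+ 2 <= Dl ^+ 2.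
  rewrite Dl2; apply: (le_trans (drift_variance resample mD D_sym D_tri rho_gt0 packing
    p_gt0 p_lt1 near_prob m_gt0 near3_prob)).
  by rewrite ler_wpM2l// invr_ge0 ltW.
have B0 : 0 < 1 + (kappa R d)%:R :> R by rewrite ltr_wpDr.
have Dl0 : 0 <= Dl by rewrite divr_ge0 ?sqrtr_ge0.
have bound := size_bias_kolmogorov (bmf_of_count m rho mD) (bmf_drift lam m rho mD p)
  (mean_count_gt0 p_gt0 p_lt1 m_gt0) s0 B0 Dl0 Ex_countE var_eq var
  (drift_bound mD D_sym packing p_gt0 p_lt1 near_prob m_gt0)
  (stein_taylor resample mD D_sym packing p_gt0 p_lt1 near_prob m_gt0).
apply: ge_sup; first by eexists; exists 0.
move=> _ [t _ <-]; rewrite gcdf_normal_prob.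
have -> : fine (P [set w | (S w - mean P S) / sd P S <= t]) = std_cdf Q W (n%:R - mc) s t.
  rewrite /std_cdf -(Ex_isolated_count (fun y => ((y - (n%:R - mc)) / s <= t)%R%:R)) -Ex_indic.
    by apply: eq_Ex => w; rewrite /= asboolb mean_isolated_count.
  have mS : measurable_fun setT S.
    rewrite (_ : S = fun w => \sum_i (isolated rho (joint U w) i)%:R).
      apply: (measurableT_comp (bmf_measurable (@bmf_isolated R d m rho id))).
      exact: measurable_joint.
    by apply/funext => w; exact: isolated_countE.
  have ml : measurable_fun setT (fun w => (S w - mean P S) / sd P S <= t).
    apply: measurable_fun_ler => //; apply: measurable_funM => //.
    exact: measurable_funB.
  by rewrite -[X in measurable X]setTI; apply: (ml measurableT [set true]).
exact: (kolmogorov_reflect n%:R (bmf_of_count m rho mD) bound).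
Qed.

End RandomGeometricGraph.

Theorem theorem2p2 (R : realType) (disp : measure_display)
    (T : measurableType disp) (P : probability T R)
    (d n : nat) (rho : R) (U : 'I_n -> {RV P >-> d.-tuple R})
    (d_ge1 : (1 <= d)%N) (n_ge4 : (4 <= n)%N) (rho_gt0 : 0 < rho)
    (U_uniform : forall i, uniform_on_torus P n (U i))
    (U_indep : independent_vectors P U) :
  let phi := unit_ball_vol d * rho ^+ d in
  let S := isolated_count rho U in
  let mu := mean P S in
  let sigma := sd P S in
  let kp : R := (kappa_plus R d)%:R in
  Num.max (3 ^+ d) (2 ^+ d.+1 + 1) * phi < n%:R ->
  kolmogorov_normal P S <=
    (n%:R - mu) / (5 * sigma ^+ 2) *
    (Num.sqrt (11 * kp ^+ 2 / sigma
               + 5 * Num.sqrt (eta_S d n rho) / Num.sqrt n%:R)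
     + 2 * kp / Num.sqrt sigma) ^+ 2.
Proof.
case: n U n_ge4 U_uniform U_indep => // m U n_ge4 U_uniform U_indep /=.
exact: isolated_count_kolmogorov.
Qed.
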